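(* Let $K$ be an algebraically closed field, let $A$ be a finite dimensional $K$-algebra with indexed primitive idempotents $e_1,\dots,e_n$ such that $(A,e)$ is quasi-hereditary ($e\in\mathfrak{S}_n$ the identity), and let $1\le i\le n-1$. Then $(A,e)$ is $i$th-twistable (i.e. $(A,\sigma_i)$ is also quasi-hereditary) if and only if one of the following conditions holds: $(\mathcal{E}_i)$ $E_i=0$ and $\Delta(i+1)$ has a submodule isomorphic to $\Delta(i)^{H_i}$; $(\overline{\mathcal{E}_i})$ $\overline{E_i}=0$ and $\nabla(i+1)$ has a factor module isomorphic to $\nabla(i)^{\overline{H_i}}$. In particular, if $E_i=\overline{E_i}=0$, then $(A,\sigma_i)$ is also quasi-hereditary, with $\Delta^{\sigma_i}=\Delta$ and $\nabla^{\sigma_i}=\nabla$.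
   Context: Setting: $K$ is an algebraically closed field, $A$ is a finite dimensional $K$-algebra with pairwise orthogonal primitive idempotents $e_1,\dots,e_n$ such that the modules $P(i)=e_iA$ ($i\in\Lambda=\{1,\dots,n\}$) form a complete irredundant list of indecomposable projective right $A$-modules up to isomorphism. Modules are finitely generated right $A$-modules. $S(i)$ is the top of $P(i)$, $I(i)$ is the injective envelope of $S(i)$, and $[M:S(i)]$ is the Jordan–Hölder multiplicity of $S(i)$ in $M$. $\mathfrak{S}_n$ is the symmetric group on $\{1,\dots,n\}$, $e$ its identity, $\sigma_i=(i,i+1)$ for $1\le i\le n-1$. For $\sigma\in\mathfrak{S}_n$: the standard module $\Delta^\sigma(i)$ is the maximal factor module of $P(i)$ all of whose composition factors are $S(j)$ with $\sigma(j)\le\sigma(i)$; the costandard module $\nabla^\sigma(i)$ is the maximal submodule of $I(i)$ all of whose composition factors are $S(j)$ with $\sigma(j)\le\sigma(i)$. $\Delta^\sigma=\{\Delta^\sigma(1),\dots,\Delta^\sigma(n)\}$, $\nabla^\sigma=\{\nabla^\sigma(1),\dots,\nabla^\sigma(n)\}$; for $\sigma=e$ the superscript is omitted. A module $M$ has a $\Delta^\sigma$-filtration if there is a chain of submodules $M=M_1\supset\dots\supset M_{m+1}=0$ with each $M_k/M_{k+1}\cong\Delta^\sigma(j)$ for some $j\in\Lambda$. The pair $(A,\sigma)$ is quasi-hereditary if (a) $[\Delta^\sigma(i):S(i)]=1$ for all $i\in\Lambda$, and (b) $A_A$ has a $\Delta^\sigma$-filtration. Notation: $H_i=\dim_K\operatorname{Hom}_A(\Delta(i),\Delta(i+1))$,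 $E_i=\dim_K\operatorname{Ext}^1_A(\Delta(i),\Delta(i+1))$, $\overline{H_i}=\dim_K\operatorname{Hom}_A(\nabla(i+1),\nabla(i))$, $\overline{E_i}=\dim_K\operatorname{Ext}^1_A(\nabla(i+1),\nabla(i))$. $M^m$ denotes the direct sum of $m$ copies of $M$ ($M^0=0$). *)

(* Defs.v *)
From HB Require Import structures.
From mathcomp Require Import all_boot all_order all_algebra all_fingroup all_field.
From mathcomp Require Import boolp.

Set Implicit Arguments.
Unset Strict Implicit.
Unset Printing Implicit Defensive.

Import GRing.Theory.
Local Open Scope ring_scope.

(* Finitely generated right modules over a finite dimensional K-algebra A are  *)
(* the finite dimensional K-vector spaces with a unital right A-action: here   *)
(* [act M a x] is x.a, so that [act M] reverses products.                      *)
Record rmod (K : fieldType) (A : falgType K) := Rmod {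
  rm_sort :> vectType K;
  act : A -> 'End(rm_sort);
  act_linear : linear act;
  act1 : act 1 = \1%VF;
  actM : forall a b : A, act (a * b) = (act b \o act a)%VF }.

Arguments act {K A} r a.

Section Modules.

Variables (K : fieldType) (A : falgType K).
Implicit Types M N X Q : rmod A.

Definition act_stable M (U : {vspace M}) : Prop :=
  forall (a : A) (x : M), x \in U -> act M a x \in U.

Record submodule M := Submodule {
  sm_vs :> {vspace M};
  sm_stable : act_stable sm_vs }.

Fact full_stable M : act_stable (fullv : {vspace M}).
Proof. by move=> a x _; rewrite memvf. Qed.
Definition full_sub M := Submodule (@full_stable M).

Fact zero_stable M : act_stable (0%VS : {vspace M}).
Proof. by move=> a x; rewrite !memv0 => /eqP->; rewrite linear0. Qed.
Definition zero_sub M := Submodule (@zero_stable M).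

Section Sub.
Variables (M : rmod A) (U : submodule M).

Definition sub_act (a : A) : 'End(subvs_of U) :=
  (linfun (vsproj U) \o act M a \o linfun vsval)%VF.

Lemma sub_actE a x : vsval (sub_act a x) = act M a (vsval x).
Proof.
rewrite /sub_act !comp_lfunE lfunE /= (lfunE vsval) vsprojK //.
by apply: sm_stable; apply: subvsP.
Qed.

Fact sub_act_linear : linear sub_act.
Proof.
move=> k a b; apply/lfunP=> x; apply: val_inj => /=.
rewrite sub_actE act_linear add_lfunE scale_lfunE.
by rewrite add_lfunE scale_lfunE linearP /= !sub_actE.
Qed.

Fact sub_act1 : sub_act 1 = \1%VF.
Proof. by apply/lfunP=> x; apply: val_inj; rewrite /= sub_actE act1 !id_lfunE. Qed.

Fact sub_actM a b : sub_act (a * b) = (sub_act b \o sub_act a)%VF.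
Proof.
by apply/lfunP=> x; apply: val_inj; rewrite /= comp_lfunE !sub_actE actM comp_lfunE.
Qed.

Definition submod : rmod A := Rmod sub_act_linear sub_act1 sub_actM.

(* M / U is carried by the complement U^C, acted upon through the projection   *)
(* of M onto U^C along U.                                                      *)
Definition quo_proj : 'Hom(M, subvs_of (U^C)%VS) :=
  (linfun (vsproj (U^C)%VS) \o daddv_pi (U^C)%VS U)%VF.

Definition quo_act (a : A) : 'End(subvs_of (U^C)%VS) :=
  (quo_proj \o act M a \o linfun vsval)%VF.

Lemma quo_projK x : quo_proj (vsval x) = x.
Proof.
rewrite /quo_proj comp_lfunE lfunE /= daddv_pi_id ?vsvalK ?subvsP //.
by rewrite capvC capv_compl.
Qed.

Lemma val_quo_proj x : x - vsval (quo_proj x) \in (U : {vspace M}).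
Proof.
rewrite /quo_proj comp_lfunE lfunE /= vsprojK ?memv_pi //.
have UC0 : (U^C :&: U = 0)%VS by rewrite capvC capv_compl.
have := @daddv_pi_add _ _ (U^C)%VS U x UC0.
rewrite addvC addv_complf memvf => /(_ isT) {1}<-.
by rewrite addrC addKr memv_pi.
Qed.

Lemma ker_quo_proj : lker quo_proj = U.
Proof.
apply/vspaceP=> x; rewrite memv_ker; apply/eqP/idP=> [x0|Ux].
  by have := val_quo_proj x; rewrite x0 [vsval 0]linear0 subr0.
apply: val_inj; rewrite linear0 /=; apply/eqP; rewrite -memv0 -(capv_compl U).
rewrite memv_cap subvsP andbT -[vsval _](subKr x).
by rewrite rpredB // val_quo_proj.
Qed.

Lemma quo_actE a x : quo_act a (quo_proj x) = quo_proj (act M a x).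
Proof.
rewrite /quo_act 2!comp_lfunE [linfun vsval _]lfunE /=.
apply/eqP; rewrite eq_sym -subr_eq0 -(linearB quo_proj) -memv_ker ker_quo_proj.
rewrite -(linearB (act M a)).
by apply: sm_stable; apply: val_quo_proj.
Qed.

Fact quo_act_linear : linear quo_act.
Proof.
move=> k a b; apply/lfunP=> x; rewrite -[x]quo_projK add_lfunE scale_lfunE.
by rewrite !quo_actE act_linear add_lfunE scale_lfunE linearP.
Qed.

Fact quo_act1 : quo_act 1 = \1%VF.
Proof. by apply/lfunP=> x; rewrite -[x]quo_projK quo_actE act1 !id_lfunE. Qed.

Fact quo_actM a b : quo_act (a * b) = (quo_act b \o quo_act a)%VF.
Proof.
by apply/lfunP=> x; rewrite -[x]quo_projK comp_lfunE !quo_actE actM comp_lfunE.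
Qed.

Definition quomod : rmod A := Rmod quo_act_linear quo_act1 quo_actM.

End Sub.

Section SubIn.
Variables (M : rmod A) (U V : submodule M).

Fact sub_in_stable : @act_stable (submod U) (linfun vsval @^-1: V)%VS.
Proof.
move=> a x; rewrite -!memv_preim !(lfunE vsval) /= sub_actE => Vx.
exact: sm_stable.
Qed.

Definition sub_in : submodule (submod U) := Submodule sub_in_stable.

(* U / (U :&: V); only used when V <= U. *)
Definition subquo : rmod A := quomod sub_in.

End SubIn.

Definition commutator_act M N (a : A) (f : 'Hom(M, N)) : 'Hom(M, N) :=
  ((act N a \o f) - (f \o act M a))%VF.

Fact commutator_act_linear M N a : linear (@commutator_act M N a).
Proof.
move=> k f g; apply/lfunP=> x.
rewrite /commutator_act !(add_lfunE, opp_lfunE, scale_lfunE, comp_lfunE).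
by rewrite linearP scalerBr opprD addrACA.
Qed.

HB.instance Definition _ M N a := GRing.isSemilinear.Build K 'Hom(M, N) 'Hom(M, N)
  _ (@commutator_act M N a) (GRing.semilinear_linear (@commutator_act_linear M N a)).

Definition homA M N : {vspace 'Hom(M, N)} :=
  (\bigcap_(a <- vbasis {:A}) lker (linfun (@commutator_act M N a)))%VS.

Lemma homAP M N (f : 'Hom(M, N)) :
  f \in homA M N <-> (forall a x, f (act M a x) = act N a (f x)).
Proof.
have E a : (f \in lker (linfun (@commutator_act M N a))) <->
    (forall x, f (act M a x) = act N a (f x)).
  rewrite memv_ker lfunE /= /commutator_act subr_eq0; split=> [/eqP fE x | fE].
    by rewrite -!comp_lfunE fE.
  by apply/eqP/lfunP=> x; rewrite !comp_lfunE fE.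
have big (s : seq A) : f \in (\bigcap_(a <- s) lker (linfun (@commutator_act M N a)))%VS
    <-> (forall a, a \in s -> forall x, f (act M a x) = act N a (f x)).
  elim: s => [|a s IHs]; first by rewrite big_nil memvf.
  rewrite big_cons memv_cap; split=> [/andP[/E fa /IHs fs] b | fas].
    by rewrite inE => /predU1P[->|/fs].
  apply/andP; split; first by apply/E/fas; rewrite inE eqxx.
  by apply/IHs=> b sb; apply: fas; rewrite inE sb orbT.
split=> [/big fA a x | fA]; last by apply/big=> a _ x; apply: fA.
have actL X : {linear A -> 'End(X)}.
  exact: (HB.pack (act X) (GRing.isSemilinear.Build K A 'End(X) _ (act X)
    (GRing.semilinear_linear (@act_linear _ _ X)))).
have actE X (k : 'I_(\dim {:A}) -> K) :
    act X (\sum_i k i *: (vbasis {:A})`_i) = \sum_i k i *: act X (vbasis {:A})`_i.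
  have act0 : act X 0 = 0.
    have := @act_linear _ _ X (-1) 0 0.
    by rewrite scaler0 addr0 scaleN1r addNr.
  elim/big_rec2: _ => [//|i b c _ <-]; exact: act_linear.
rewrite (coord_vbasis (memvf a)) !actE !sum_lfunE linear_sum.
apply: eq_bigr => i _; rewrite !scale_lfunE linearZ /= fA //.
by rewrite mem_nth // size_tuple.
Qed.

Lemma comp_homA M N X (g : 'Hom(N, X)) (f : 'Hom(M, N)) :
  g \in homA N X -> f \in homA M N -> (g \o f)%VF \in homA M X.
Proof.
by move=> /homAP gA /homAP fA; apply/homAP=> a x; rewrite !comp_lfunE fA gA.
Qed.

Definition incl M (U : submodule M) : 'Hom(submod U, M) := linfun vsval.

Lemma inclE M (U : submodule M) x : incl U x = vsval x.
Proof. by rewrite lfunE. Qed.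

Lemma incl_homA M (U : submodule M) : incl U \in homA (submod U) M.
Proof. by apply/homAP=> a x; rewrite !inclE sub_actE. Qed.

Lemma incl_inj M (U : submodule M) : injective (incl U).
Proof. by move=> x y; rewrite !inclE => /val_inj. Qed.

Definition isomorphic M N : Prop :=
  exists f : 'Hom(M, N), [/\ f \in homA M N, lker f = 0%VS & limg f = fullv].

Definition ker_sub M N (f : 'Hom(M, N)) (hf : f \in homA M N) : submodule M.
Proof.
exists (lker f) => a x; rewrite !memv_ker => /eqP fx0.
by move/homAP: hf => ->; rewrite fx0 linear0.
Defined.

Definition projective Q : Prop :=
  forall M N (p : 'Hom(M, N)) (g : 'Hom(Q, N)),
    p \in homA M N -> limg p = fullv -> g \in homA Q N ->
    exists2 h, h \in homA Q M & (p \o h)%VF = g.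

Definition injective_module Q : Prop :=
  forall M N (j : 'Hom(M, N)) (g : 'Hom(M, Q)),
    j \in homA M N -> lker j = 0%VS -> g \in homA M Q ->
    exists2 h, h \in homA N Q & (h \o j)%VF = g.

Definition injective_envelope M Q : Prop :=
  injective_module Q /\
  exists j : 'Hom(M, Q), [/\ j \in homA M Q, lker j = 0%VS &
    forall U : submodule Q, (U :&: limg j)%VS = 0%VS -> U = 0%VS :> {vspace Q}].

Definition indecomposable M : Prop :=
  {:M}%VS <> 0%VS /\
  forall U V : submodule M, (U + V)%VS = fullv -> (U :&: V)%VS = 0%VS ->
    U = 0%VS :> {vspace M} \/ V = 0%VS :> {vspace M}.

Definition simple_module M : Prop :=
  {:M}%VS <> 0%VS /\
  forall U : submodule M, U = 0%VS :> {vspace M} \/ U = fullv :> {vspace M}.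

Definition chain M m (F : nat -> submodule M) : Prop :=
  [/\ F 0%N = fullv :> {vspace M}, F m = 0%VS :> {vspace M} &
      forall k, (k < m)%N -> (F k.+1 <= F k)%VS].

Definition composition_series M m (F : nat -> submodule M) : Prop :=
  chain m F /\ forall k, (k < m)%N -> simple_module (subquo (F k) (F k.+1)).

Definition composition_factor M X : Prop :=
  exists m F k, [/\ composition_series m F, (k < m)%N &
                    isomorphic (@subquo M (F k) (F k.+1)) X].

(* [M : X] = d; by the Jordan-Hoelder theorem the composition series used is   *)
(* irrelevant.                                                                 *)
Definition multiplicity M X (d : nat) : Prop :=
  exists m (F : nat -> submodule M), composition_series m F /\
    d = #|[set k : 'I_m | `[< isomorphic (subquo (F k) (F k.+1)) X >]]|.

Definition has_filtration (I : Type) (D : I -> rmod A) M : Prop :=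
  exists m F, chain m F /\
    forall k, (k < m)%N -> exists j, isomorphic (@subquo M (F k) (F k.+1)) (D j).

Lemma minimal_submodule_exists M (C : submodule M -> Prop) U0 : C U0 ->
  exists U, C U /\
    forall V, C V -> (V <= U)%VS -> V = U :> {vspace M}.
Proof.
have [d] := ubnP (\dim U0); elim: d U0 => // d IHd U0 /ltnSE leU0 CU0.
have [[V [CV sVU nVU]]|noV] :=
  pselect (exists V : submodule M, [/\ C V, (V <= U0)%VS & V <> U0 :> {vspace M}]).
  apply: (IHd V) => //; apply: leq_trans leU0; rewrite ltnNge; apply/negP=> leUV.
  by apply: nVU; apply/eqP; rewrite eqEdim sVU.
exists U0; split=> // V CV sVU; apply: contrapT => nVU; apply: noV.
by exists V.
Qed.

Lemma maximal_submodule_exists M (C : submodule M -> Prop) U0 : C U0 ->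
  exists U, C U /\
    forall V, C V -> (U <= V)%VS -> V = U :> {vspace M}.
Proof.
have [d] := ubnP (dim M - \dim U0); elim: d U0 => // d IHd U0 /ltnSE leU0 CU0.
have [[V [CV sUV nVU]]|noV] :=
  pselect (exists V : submodule M, [/\ C V, (U0 <= V)%VS & V <> U0 :> {vspace M}]).
  have ltUV : (\dim U0 < \dim V)%N.
    rewrite ltnNge; apply/negP=> leVU; apply: nVU; apply/esym/eqP.
    by rewrite eqEdim sUV.
  apply: (IHd V) => //; apply: leq_trans leU0; apply: ltn_sub2l => //.
  by apply: leq_trans ltUV _; rewrite -dimvf dimvS ?subvf.
exists U0; split=> // V CV sVU; apply: contrapT => nVU; apply: noV.
by exists V.
Qed.

Fact cap_stable M (U V : submodule M) : act_stable (U :&: V)%VS.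
Proof. by move=> a x; rewrite !memv_cap => /andP[Ux Vx]; rewrite !sm_stable. Qed.

Lemma intersection_exists M (C : submodule M -> Prop) :
  exists U : submodule M, forall x, x \in (U : {vspace M}) <->
    (forall V, C V -> x \in (V : {vspace M})).
Proof.
pose R (U : submodule M) := forall x, (forall V, C V -> x \in (V : {vspace M})) ->
  x \in (U : {vspace M}).
have Rfull : R (full_sub M) by move=> x _; rewrite memvf.
have [U [RU minU]] := minimal_submodule_exists Rfull.
exists U => x; split=> [Ux V CV|]; last exact: RU.
pose W := Submodule (@cap_stable M U V).
have RW : R W by move=> y Cy; rewrite memv_cap RU ?Cy.
have eWU := minU W RW (capvSl U V).
by move: Ux; rewrite -eWU memv_cap => /andP[].
Qed.

Definition maximal_submodule M (U : submodule M) : Prop :=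
  U <> fullv :> {vspace M} /\
  forall V : submodule M, (U <= V)%VS ->
    V = U :> {vspace M} \/ V = fullv :> {vspace M}.

Definition radical M : submodule M :=
  sval (cid (intersection_exists (@maximal_submodule M))).

Definition topmod M : rmod A := quomod (radical M).

Fact regular_act_linear : linear (@amulr K A).
Proof. exact: linearP. Qed.
Fact regular_act1 : amulr (1 : A) = \1%VF.
Proof. by apply/lfunP=> x; rewrite lfunE /= mulr1 id_lfunE. Qed.
Fact regular_actM (a b : A) : amulr (a * b) = (amulr b \o amulr a)%VF.
Proof. by apply/lfunP=> x; rewrite comp_lfunE !lfunE /= mulrA. Qed.

Definition regular : rmod A := Rmod regular_act_linear regular_act1 regular_actM.

Section Power.
Variables (M : rmod A) (m : nat).

Definition power_act_fun (a : A) (x : {ffun 'I_m -> M}) : {ffun 'I_m -> M} :=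
  [ffun k => act M a (x k)].

Fact power_act_fun_linear a : linear (power_act_fun a).
Proof. by move=> c x y; apply/ffunP=> k; rewrite !ffunE linearP. Qed.
HB.instance Definition _ a := GRing.isSemilinear.Build K {ffun 'I_m -> M}
  {ffun 'I_m -> M} _ (power_act_fun a)
  (GRing.semilinear_linear (@power_act_fun_linear a)).

Definition power_act (a : A) : 'End({ffun 'I_m -> M}) := linfun (power_act_fun a).

Fact power_act_linear : linear power_act.
Proof.
move=> c a b; apply/lfunP=> x; rewrite add_lfunE scale_lfunE !lfunE /=.
by apply/ffunP=> k; rewrite !ffunE act_linear add_lfunE scale_lfunE.
Qed.
Fact power_act1 : power_act 1 = \1%VF.
Proof.
by apply/lfunP=> x; rewrite lfunE; apply/ffunP=> k; rewrite ffunE act1 !id_lfunE.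
Qed.
Fact power_actM a b : power_act (a * b) = (power_act b \o power_act a)%VF.
Proof.
apply/lfunP=> x; rewrite comp_lfunE !lfunE /=.
by apply/ffunP=> k; rewrite !ffunE actM comp_lfunE.
Qed.

Definition direct_power : rmod A := Rmod power_act_linear power_act1 power_actM.

End Power.

(* The free module on a K-basis of M, and its canonical map onto M. *)
Definition free_on M : rmod A := direct_power regular (\dim {:M}).

Definition free_cover_fun M (f : free_on M) : M :=
  \sum_k act M (f k) (vbasis {:M})`_k.

Fact free_cover_fun_linear M : linear (@free_cover_fun M).
Proof.
move=> c f g; rewrite /free_cover_fun scaler_sumr -big_split; apply: eq_bigr => k _ /=.
by rewrite !ffunE act_linear add_lfunE scale_lfunE.
Qed.
HB.instance Definition _ M := GRing.isSemilinear.Build K (free_on M) M _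
  (@free_cover_fun M) (GRing.semilinear_linear (@free_cover_fun_linear M)).

Definition free_cover M : 'Hom(free_on M, M) := linfun (@free_cover_fun M).

Lemma free_cover_homA M : free_cover M \in homA (free_on M) M.
Proof.
apply/homAP=> a f; rewrite !lfunE /= /free_cover_fun linear_sum; apply: eq_bigr => k _.
by rewrite ffunE lfunE /= actM comp_lfunE.
Qed.

Lemma free_cover_onto M : limg (free_cover M) = fullv.
Proof.
apply/vspaceP=> x; rewrite memvf; apply/memv_imgP.
exists ([ffun k => (coord (vbasis {:M}) k x)%:A] : {ffun 'I_(\dim {:M}) -> A}).
  by rewrite memvf.
rewrite lfunE /= /free_cover_fun {1}(coord_vbasis (memvf x)); apply: eq_bigr => k _.
rewrite ffunE; have := @act_linear _ _ M (coord (vbasis {:M}) k x) 1 0.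
have -> : act M 0 = 0.
  have := @act_linear _ _ M (-1) 0 0.
  by rewrite scaler0 addr0 scaleN1r addNr.
by rewrite !addr0 => ->; rewrite act1 scale_lfunE id_lfunE.
Qed.

Definition syzygy_sub M : submodule (free_on M) := ker_sub (free_cover_homA M).
Definition syzygy M : rmod A := submod (syzygy_sub M).

(* The free resolution ... -> free_on (syzygy M) -> free_on M -> M -> 0. *)
Definition resolution_diff M : 'Hom(free_on (syzygy M), free_on M) :=
  (incl (syzygy_sub M) \o free_cover (syzygy M))%VF.

Lemma resolution_diff_homA M :
  resolution_diff M \in homA (free_on (syzygy M)) (free_on M).
Proof. exact: comp_homA (incl_homA _) (free_cover_homA _). Qed.

Lemma resolution_exact0 M : limg (resolution_diff M) = lker (free_cover M).
Proof.
rewrite limg_comp free_cover_onto; apply/vspaceP=> x; apply/memv_imgP/idP.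
  by case=> y _ ->; rewrite inclE; exact: subvsP.
by move=> kx; exists (vsproj (syzygy_sub M) x); rewrite ?memvf // inclE vsprojK.
Qed.

Lemma resolution_exact1 M :
  limg (resolution_diff (syzygy M)) = lker (resolution_diff M).
Proof.
rewrite resolution_exact0; apply/vspaceP=> x; rewrite !memv_ker comp_lfunE.
apply/eqP/eqP=> [-> | x0]; first exact: linear0.
by apply: (@incl_inj _ (syzygy_sub M)); rewrite x0 linear0.
Qed.

Section Precompose.
Variables (U V W : vectType K) (d : 'Hom(U, V)).

Definition precompose_fun (f : 'Hom(V, W)) : 'Hom(U, W) := (f \o d)%VF.
Fact precompose_fun_linear : linear precompose_fun.
Proof. by move=> c f g; rewrite /precompose_fun comp_lfunDl comp_lfunZl. Qed.
HB.instance Definition _ := GRing.isSemilinear.Build K 'Hom(V, W) 'Hom(U, W) _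
  precompose_fun (GRing.semilinear_linear precompose_fun_linear).
Definition precompose : 'Hom('Hom(V, W), 'Hom(U, W)) := linfun precompose_fun.

Lemma precomposeE f : precompose f = (f \o d)%VF.
Proof. exact: lfunE. Qed.

End Precompose.

(* First cohomology of Hom_A(F_*, N), F_* the free resolution of M above. *)
Definition ext1_cocycles M N : {vspace 'Hom(free_on (syzygy M), N)} :=
  (homA (free_on (syzygy M)) N
     :&: lker (precompose N (resolution_diff (syzygy M))))%VS.

Definition ext1_coboundaries M N : {vspace 'Hom(free_on (syzygy M), N)} :=
  (precompose N (resolution_diff M) @: homA (free_on M) N)%VS.

Lemma ext1_complex M N : (ext1_coboundaries M N <= ext1_cocycles M N)%VS.
Proof.
apply/subvP=> _ /memv_imgP[f fA ->]; rewrite memv_cap precomposeE.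
apply/andP; split; first exact: comp_homA fA (resolution_diff_homA M).
rewrite memv_ker precomposeE -comp_lfunA.
suff -> : (resolution_diff M \o resolution_diff (syzygy M) = 0)%VF.
  by rewrite comp_lfun0r.
apply/lfunP=> x; rewrite zero_lfunE comp_lfunE; apply/eqP.
by rewrite -memv_ker -resolution_exact1 memv_img ?memvf.
Qed.

Definition hom_dim M N : nat := \dim (homA M N).

Definition ext1_dim M N : nat :=
  (\dim (ext1_cocycles M N) - \dim (ext1_coboundaries M N))%N.

Definition primitive_idempotent (a : A) : Prop :=
  [/\ a != 0, a * a = a &
      forall b c : A, b * b = b -> c * c = c -> b * c = 0 -> c * b = 0 ->
        a = b + c -> b = 0 \/ c = 0].

Fact right_ideal_stable (a : A) : @act_stable regular (limg (amull a)).
Proof.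
move=> b _ /memv_imgP[x _ ->]; rewrite !lfunE /= -mulrA.
by apply/memv_imgP; exists (x * b); rewrite ?memvf // lfunE.
Qed.
Definition right_ideal (a : A) : submodule regular :=
  Submodule (@right_ideal_stable a).

Section Standard.
Variables (n : nat) (e : 'I_n -> A).
Implicit Types (s : 'S_n) (i j : 'I_n) (I : 'I_n -> rmod A).

Definition Pmod i : rmod A := submod (right_ideal (e i)).
Definition Smod i : rmod A := topmod (Pmod i).

Definition indexed_primitive_idempotents : Prop :=
  [/\ forall i, primitive_idempotent (e i),
      forall i j, i != j -> e i * e j = 0,
      forall Q, projective Q /\ indecomposable Q <-> exists i, isomorphic Q (Pmod i) &
      forall i j, isomorphic (Pmod i) (Pmod j) -> i = j].

Definition factors_below s i M : Prop :=
  forall X, composition_factor M X ->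
    exists2 j, (s j <= s i)%N & isomorphic X (Smod j).

Lemma factors_below0 s i M : {:M}%VS = 0%VS -> factors_below s i M.
Proof.
move=> M0 X [m [F [k [[_ simF] ltkm _]]]]; have [+ _] := simF k ltkm.
case; apply/vspaceP=> x; rewrite memvf memv0; apply/esym/eqP.
do 2!apply: val_inj => /=; apply/eqP; rewrite -memv0 -M0; exact: memvf.
Qed.

Fact Delta_ker_exists s i : exists U : submodule (Pmod i),
  factors_below s i (quomod U) /\
  forall V : submodule (Pmod i), factors_below s i (quomod V) -> (V <= U)%VS ->
    V = U :> {vspace Pmod i}.
Proof.
apply: (@minimal_submodule_exists _ (fun U => factors_below s i (quomod U)) (full_sub _)).
apply: factors_below0; apply/vspaceP=> x; rewrite memvf memv0; apply/esym/eqP.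
apply: val_inj => /=; apply/eqP; rewrite -memv0 -(capv_compl fullv) capfv.
exact: subvsP.
Qed.

(* The maximal factor module Pmod i / U is the one with U minimal. *)
Definition Delta_ker s i : submodule (Pmod i) := sval (cid (Delta_ker_exists s i)).
Definition Delta s i : rmod A := quomod (Delta_ker s i).

Fact nabla_sub_exists I s i : exists U : submodule (I i),
  factors_below s i (submod U) /\
  forall V : submodule (I i), factors_below s i (submod V) -> (U <= V)%VS ->
    V = U :> {vspace I i}.
Proof.
apply: (@maximal_submodule_exists _ (fun U => factors_below s i (submod U)) (zero_sub _)).
apply: factors_below0; apply/vspaceP=> x; rewrite memvf memv0; apply/esym/eqP.
apply: val_inj => /=; apply/eqP; rewrite -memv0; exact: subvsP.
Qed.

Definition nabla_sub I s i : submodule (I i) := sval (cid (nabla_sub_exists I s i)).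
Definition nabla I s i : rmod A := submod (nabla_sub I s i).

Definition quasi_hereditary s : Prop :=
  (forall i, multiplicity (Delta s i) (Smod i) 1) /\
  has_filtration (Delta s) regular.

End Standard.

End Modules.

(* Main.v *)
(* For a permutation s put J_j = sum of A e_k A over s k > s j.  Then
   Delta^s(j) = e_j A / e_j J_j, and since dim Hom(M, I(j)) = dim M e_j for every
   M, dim nabla^s(j) = dim A e_j / J_j e_j.  Multiplication
   A e_j / J_j e_j (x) e_j A / e_j J_j ->> (J_j + A e_j A) / J_j shows that
   dim A <= sum_j dim Delta^s(j) dim nabla^s(j), and (A, s) is quasi-hereditary
   if and only if equality holds.

   Only j = i, i+1 contribute different terms for s = sigma_i and s = e.  Let p, q,
   p', q' be the dimensions of Delta(i), Delta(i+1), nabla(i), nabla(i+1), and let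
   m = [nabla(i+1) : S(i)], h = [Delta(i+1) : S(i)].  Quasi-heredity of (A, e) gives
   dim Delta^s(i) = p + m q, dim nabla^s(i) = p' + h q' and
   [Delta^s(i) : S(i)] = 1 + m h, while Delta^s(i+1) = Delta(i+1) / T with T the
   trace of P(i), and dually for nabla^s(i+1).  Hence (A, sigma_i) is
   quasi-hereditary if and only if m = 0 and dim T = h p, or h = 0 and the dual
   equality holds.  Finally E_i = 0 iff m = 0: if m > 0 and E_i = 0, a surjection
   from the kernel Delta(i+1)^m of Delta^s(i) ->> Delta(i) onto Delta(i+1) would
   extend to Delta^s(i), whose top is S(i).  If m = 0, T is a quotient of Delta(i)^h
   and H_i = h, so dim T = h p says that Delta(i+1) contains Delta(i)^(H_i). *)
From HB Require Import structures.
Require Import Defs.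
From mathcomp Require Import all_boot all_order all_algebra all_fingroup all_field.
From mathcomp Require Import boolp zify.

Set Implicit Arguments.
Unset Strict Implicit.
Unset Printing Implicit Defensive.

Import GRing.Theory.
Import Defs.
Local Open Scope ring_scope.

(** * Linear algebra *)

(** All comparisons take place modulo one ideal. The indices above $i$ for $\sigma_i$ are those
    above $i+1$ for $e$, so the ideal $J$ they define serves $\Delta^{\sigma_i}(i)$ and
    $\Delta(i+1)$ at once, while $\Delta(i)$ belongs to $J + A e_{i+1} A$ and
    $\Delta^{\sigma_i}(i+1)$ to $J + A e_i A$. Quasi-heredity makes multiplication through $e_{i+1}$
    injective modulo $J$, and this survives cutting by $e_i$ on the left, on the right or on both
    sides; the three cuts give $p + mq$, $p' + hq'$ and $1 + mh$. Multiplication through $e_i$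
    modulo $J$ only yields a bound, and the conditions on traces say when it is attained. Only right
    modules occur, so the statements on $\nabla$ are proved directly and not by duality. They rest
    on $\operatorname{Hom}(-, I(j))$, and the simple socle of $I(j)$ does the work that the simple
    top of $P(j)$ does for $\Delta$. $\operatorname{Ext}^1$ enters only through its vanishing, read
    as extendability of homomorphisms from kernels of epimorphisms. *)

Section Spaces.
Variable (K : fieldType).

(** A subspace of largest dimension inside [P] absorbs every line spanned by an element satisfying
    [P]. Annihilators and preimages become subspaces in this way. *)
Lemma pred_vspace (V : vectType K) (P : V -> Prop) :
  P 0 -> (forall k x y, P x -> P y -> P (k *: x + y)) ->
  exists U : {vspace V}, forall x, x \in U <-> P x.
Proof.
move=> P0 PD.
pose Q d := exists U : {vspace V}, (forall x, x \in U -> P x) /\ \dim U = d.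
have Q0 : exists d, `[< Q d >].
  exists 0%N; apply/asboolP; exists 0%VS; rewrite dimv0; split=> // x.
  by rewrite memv0 => /eqP->.
have Qb d : `[< Q d >] -> (d <= \dim {:V})%N.
  by move=> /asboolP[U [_ <-]]; rewrite dimvS ?subvf.
have [d /asboolP[U [PU dU]] maxd] := ex_maxnP Q0 Qb.
exists U => x; split=> [|Px]; first exact: PU.
suff /eqP -> : U == (<[x]> + U)%VS by apply/subvP: (memv_line x); apply: addvSl.
rewrite eqEdim addvSr /= dU; apply: maxd; apply/asboolP; exists (<[x]> + U)%VS.
split=> // _ /memv_addP[_ /vlineP[k ->] [v Uv ->]].
by apply: PD => //; apply: PU.
Qed.

Lemma lfun_factor (U V W : vectType K) (g : 'Hom(U, V)) (f : 'Hom(U, W)) :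
  limg g = fullv -> (lker g <= lker f)%VS -> exists h : 'Hom(V, W), forall x, h (g x) = f x.
Proof.
move=> g_onto gf; exists (f \o g^-1)%VF => x; rewrite comp_lfunE.
apply/eqP; rewrite -subr_eq0 -linearB -memv_ker; apply: (subvP gf).
by rewrite memv_ker linearB /= limg_lfunVK ?subrr // memv_img ?memvf.
Qed.

Lemma limg_fullP (U V : vectType K) (f : 'Hom(U, V)) :
  limg f = fullv <-> forall y, exists x, y = f x.
Proof.
split=> [fU y|fU].
  have /memv_imgP[x _ ->] : y \in limg f by rewrite fU memvf.
  by exists x.
by apply/vspaceP=> y; rewrite memvf; have [x ->] := fU y; rewrite memv_img ?memvf.
Qed.

Lemma lker0_inj (U V : vectType K) (f : 'Hom(U, V)) :
  lker f = 0%VS <-> forall x, f x = 0 -> x = 0.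
Proof.
split=> [f0 x fx | f0]; first by apply/eqP; rewrite -memv0 -f0 memv_ker fx.
apply/vspaceP=> x; rewrite memv_ker memv0; apply/eqP/eqP=> [/f0//|->].
exact: linear0.
Qed.

Lemma dim_ker_img (U V : vectType K) (f : 'Hom(U, V)) (W : {vspace U}) :
  (lker f <= W)%VS -> (\dim (lker f) + \dim (f @: W) = \dim W)%N.
Proof. by move=> /capv_idPr {1}<-; rewrite limg_ker_dim. Qed.

Lemma dim_ker_onto (U V : vectType K) (f : 'Hom(U, V)) :
  limg f = fullv -> (\dim (lker f) + \dim {:V} = \dim {:U})%N.
Proof. by move=> <-; rewrite dim_ker_img ?subvf. Qed.

Lemma dim_inj_img (U V : vectType K) (f : 'Hom(U, V)) W :
  lker f = 0%VS -> \dim (f @: W) = \dim W.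
Proof. by move=> f0; rewrite limg_dim_eq // f0 capv0. Qed.

Lemma vspace_neq0 (V : vectType K) (U : {vspace V}) :
  U <> 0%VS -> exists2 x, x \in U & x != 0.
Proof. by move=> /eqP; rewrite -vpick0; exists (vpick U); rewrite ?memv_pick. Qed.

Lemma fullv0P (V : vectType K) : {:V}%VS = 0%VS <-> forall x : V, x = 0.
Proof.
split=> [V0 x|V0]; first by apply/eqP; rewrite -memv0 -V0 memvf.
by apply/vspaceP=> x; rewrite memvf memv0 (V0 x) eqxx.
Qed.

End Spaces.

(** * Homomorphisms and isomorphisms of modules *)

Section Homs.
Variables (K : fieldType) (A : falgType K).
Implicit Types M N X Y : rmod A.

Lemma actMx M a b (x : M) : act M (a * b) x = act M b (act M a x).
Proof. by rewrite actM comp_lfunE. Qed.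

Lemma act1x M (x : M) : act M 1 x = x.
Proof. by rewrite act1 id_lfunE. Qed.

Lemma act_linear_at M (x : M) : linear (fun a : A => act M a x).
Proof. by move=> k a b; rewrite act_linear add_lfunE scale_lfunE. Qed.

Definition orbit_fun M (x : M) (a : regular A) : M := act M a x.
HB.instance Definition _ M (x : M) := GRing.isSemilinear.Build K (regular A) M _
  (orbit_fun x) (GRing.semilinear_linear (@act_linear_at M x)).
Definition orbit_map M (x : M) : 'Hom(regular A, M) := linfun (orbit_fun x).

Lemma orbit_mapE M (x : M) a : orbit_map x a = act M a x.
Proof. by rewrite lfunE. Qed.

Lemma act_regularE (a x : A) : act (regular A) a x = x * a.
Proof. by rewrite lfunE. Qed.

Lemma orbit_map_homA M (x : M) : orbit_map x \in homA (regular A) M.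
Proof. by apply/homAP=> a c; rewrite !orbit_mapE act_regularE actMx. Qed.

Lemma actDl M a b (x : M) : act M (a + b) x = act M a x + act M b x.
Proof. by rewrite -!orbit_mapE linearD. Qed.

Lemma act0l M (x : M) : act M 0 x = 0.
Proof. by rewrite -orbit_mapE linear0. Qed.

Lemma actZl M k a (x : M) : act M (k *: a) x = k *: act M a x.
Proof. by rewrite -!orbit_mapE linearZ. Qed.

Lemma homA_id M : (\1%VF : 'End(M)) \in homA M M.
Proof. by apply/homAP=> a x; rewrite !id_lfunE. Qed.

Lemma homA_factor Y M N (g : 'Hom(Y, M)) (f : 'Hom(Y, N)) :
  g \in homA Y M -> f \in homA Y N -> limg g = fullv -> (lker g <= lker f)%VS ->
  exists2 h, h \in homA M N & forall x, h (g x) = f x.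
Proof.
move=> /homAP gA /homAP fA g_onto gf; have [h hE] := lfun_factor g_onto gf.
exists h => //; apply/homAP=> a y; have /limg_fullP/(_ y)[x ->] := g_onto.
by rewrite -gA !hE fA.
Qed.

Lemma iso_of_surj Y M N (g : 'Hom(Y, M)) (f : 'Hom(Y, N)) :
  g \in homA Y M -> f \in homA Y N -> limg g = fullv -> limg f = fullv ->
  lker g = lker f -> isomorphic M N.
Proof.
move=> gA fA g_onto f_onto kgf.
have [|h hA hE] := homA_factor gA fA g_onto; first by rewrite kgf subvv.
exists h; split=> //.
  apply/lker0_inj=> y; have /limg_fullP/(_ y)[x ->] := g_onto; rewrite hE => fx0.
  by apply/eqP; rewrite -memv_ker kgf memv_ker fx0.
apply/limg_fullP=> z; have /limg_fullP/(_ z)[x ->] := f_onto.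
by exists (g x); rewrite hE.
Qed.

Lemma iso_refl M : isomorphic M M.
Proof.
exists \1%VF; split; first exact: homA_id.
  by apply/lker0_inj=> x; rewrite id_lfunE.
by apply/limg_fullP=> x; exists x; rewrite id_lfunE.
Qed.

Lemma iso_sym M N : isomorphic M N -> isomorphic N M.
Proof.
move=> [f [fA f0 f1]]; apply: (iso_of_surj fA (homA_id M) f1).
  by apply/limg_fullP=> x; exists x; rewrite id_lfunE.
by rewrite f0; apply/esym/lker0_inj=> x; rewrite id_lfunE.
Qed.

Lemma iso_trans M N X : isomorphic M N -> isomorphic N X -> isomorphic M X.
Proof.
move=> [f [fA f0 f1]] [g [gA g0 g1]]; exists (g \o f)%VF; split.
- exact: comp_homA.
- apply/lker0_inj=> x; rewrite comp_lfunE => gfx.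
  by move/lker0_inj: f0; apply; move/lker0_inj: g0; apply.
- by rewrite limg_comp f1.
Qed.

Lemma iso_dim M N : isomorphic M N -> \dim {:M} = \dim {:N}.
Proof. by move=> [f [_ f0 f1]]; rewrite -(dim_ker_onto f1) f0 dimv0. Qed.

Lemma iso_of_dim M N (f : 'Hom(M, N)) : f \in homA M N -> lker f = 0%VS ->
  (\dim {:N} <= \dim {:M})%N -> isomorphic M N.
Proof.
move=> fA f0 le; exists f; split=> //; apply/eqP.
by rewrite eqEdim subvf /= dim_inj_img.
Qed.

Lemma pred_submodule M (P : M -> Prop) :
  P 0 -> (forall k x y, P x -> P y -> P (k *: x + y)) ->
  (forall a x, P x -> P (act M a x)) ->
  exists U : submodule M, forall x, x \in (U : {vspace M}) <-> P x.
Proof.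
move=> P0 PD PA; have [U UP] := pred_vspace P0 PD.
have Ust : act_stable U by move=> a x /UP/(PA a)/UP.
by exists (Submodule Ust).
Qed.

Lemma img_submodule M N (f : 'Hom(M, N)) (U : submodule M) : f \in homA M N ->
  act_stable (f @: U)%VS.
Proof.
move=> /homAP fA a _ /memv_imgP[x Ux ->]; rewrite -fA memv_img //.
exact: sm_stable.
Qed.

Lemma quo_onto M (U : submodule M) : limg (quo_proj U) = fullv.
Proof. by apply/limg_fullP=> x; exists (vsval x); rewrite quo_projK. Qed.

Lemma quo_homA M (U : submodule M) : quo_proj U \in homA M (quomod U).
Proof. by apply/homAP=> a x; rewrite /= quo_actE. Qed.

Lemma quo_proj_eq0 M (U : submodule M) x :
  (quo_proj U x == 0) = (x \in (U : {vspace M})).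
Proof. by rewrite -memv_ker ker_quo_proj. Qed.

Lemma quo_dim M (U : submodule M) : (\dim U + \dim {:quomod U} = \dim {:M})%N.
Proof. by rewrite -(dim_ker_onto (quo_onto U)) ker_quo_proj. Qed.

Lemma sub_dim M (U : submodule M) : \dim {:submod U} = \dim U.
Proof. by rewrite dimvf. Qed.

Lemma incl_img M (U : submodule M) : limg (incl U) = U.
Proof.
apply/vspaceP=> x; apply/memv_imgP/idP=> [[y _ ->]|Ux].
  by rewrite inclE; apply: subvsP.
by exists (vsproj U x); rewrite ?memvf // inclE vsprojK.
Qed.

Lemma incl_ker M (U : submodule M) : lker (incl U) = 0%VS.
Proof. by apply/lker0_inj=> x x0; apply: (@incl_inj _ _ _ U); rewrite x0 linear0. Qed.

Lemma act_submodE M (U : submodule M) a (x : submod U) :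
  vsval (act (submod U) a x) = act M a (vsval x).
Proof. exact: sub_actE. Qed.

Lemma hom_corestrict Y M (U : submodule M) (f : 'Hom(Y, M)) :
  f \in homA Y M -> (forall x, f x \in (U : {vspace M})) ->
  exists2 g, g \in homA Y (submod U) & forall x, vsval (g x) = f x.
Proof.
move=> /homAP fA fU; exists (linfun (vsproj U) \o f)%VF.
  apply/homAP=> a x; apply: val_inj; rewrite /= sub_actE !comp_lfunE !lfunE /=.
  by rewrite !vsprojK ?fU.
by move=> x; rewrite comp_lfunE lfunE /= vsprojK.
Qed.

Lemma iso_submod_img Y M (U : submodule M) (f : 'Hom(Y, M)) :
  f \in homA Y M -> lker f = 0%VS -> limg f = U -> isomorphic Y (submod U).
Proof.
move=> fA f0 fU; have [|g gA gE] := hom_corestrict (U := U) fA.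
  by move=> x; rewrite -fU memv_img ?memvf.
apply: (iso_of_dim gA); last by rewrite sub_dim -fU dim_inj_img.
apply/lker0_inj=> x gx; move/lker0_inj: f0; apply.
by rewrite -gE gx linear0.
Qed.

Lemma iso_quomod_ker M N (U : submodule M) (f : 'Hom(M, N)) :
  f \in homA M N -> limg f = fullv -> lker f = U -> isomorphic (quomod U) N.
Proof.
move=> fA f1 fU; apply: (iso_of_surj (quo_homA U) fA (quo_onto U) f1).
by rewrite ker_quo_proj.
Qed.

Definition subquo_proj M (U V : submodule M) : 'Hom(submod U, subquo U V) :=
  quo_proj (sub_in U V).

Lemma mem_sub_in M (U V : submodule M) x :
  (x \in (sub_in U V : {vspace _})) = (vsval x \in (V : {vspace M})).
Proof. by rewrite -memv_preim lfunE. Qed.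

Lemma subquo_proj0 M (U V : submodule M) x :
  subquo_proj U V x = 0 <-> vsval x \in (V : {vspace M}).
Proof.
rewrite -mem_sub_in -[sub_in U V : {vspace _}]ker_quo_proj memv_ker.
by split=> [/eqP|/eqP].
Qed.

Lemma subquo_dim M (U V : submodule M) : (V <= U)%VS ->
  (\dim V + \dim {:subquo U V} = \dim U)%N.
Proof.
move=> VU; have := dim_ker_onto (quo_onto (sub_in U V)); rewrite sub_dim => <-.
congr addn; rewrite ker_quo_proj -(dim_inj_img _ (incl_ker U)); congr (\dim _).
apply/vspaceP=> x; apply/idP/memv_imgP=> [Vx|[y]].
  have Ux := subvP VU _ Vx.
  by exists (vsproj U x); rewrite ?mem_sub_in ?inclE vsprojK.
by rewrite mem_sub_in inclE => Vy ->.
Qed.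

Lemma quomod_sub_ext M (U V : submodule M) : U = V :> {vspace M} ->
  isomorphic (quomod U) (quomod V).
Proof.
move=> UV; apply: (iso_quomod_ker (quo_homA V) (quo_onto V)).
by rewrite ker_quo_proj.
Qed.

Lemma submod_ext M (U V : submodule M) : U = V :> {vspace M} ->
  isomorphic (submod U) (submod V).
Proof.
move=> UV; apply: (iso_submod_img (incl_homA U) (incl_ker U)).
by rewrite incl_img.
Qed.

End Homs.

(** * Tops of the indecomposable projectives *)

(* Working with a [fieldType] and this hypothesis, rather than with a
   [closedFieldType], keeps a single canonical path to the ring structure of K. *)
Definition alg_closed (K : fieldType) : Prop :=
  forall p : {poly K}, size p != 1%N -> exists x, root p x.

(** Feeds Schur's lemma: subtracting an eigenvalue from an endomorphism of a simple module leaves a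
    map that is not injective, hence zero. *)
Lemma lfun_eigenvalue (K : fieldType) (V : vectType K) (f : 'End(V)) : alg_closed K ->
  {:V}%VS <> 0%VS -> exists (k : K) (x : V), x != 0 /\ f x = k *: x.
Proof.
move=> closedK V0; have dV : (0 < \dim {:V})%N.
  by rewrite lt0n dimv_eq0; apply/eqP.
pose b := vbasis {:V}; have bP : basis_of {:V} b := vbasisP _.
have [|k /=] := closedK (char_poly (passmx.mxof b b f)) _.
  by rewrite size_char_poly; case: (\dim {:V}) dV.
rewrite -eigenvalue_root_char => kE.
have : passmx.leigenspace f k != 0%VS.
  by rewrite (passmx.leigenspaceE bP) passmx.vsof_eq0 // (basis_free bP).
move/eqP=> /vspace_neq0[x xk x0]; exists k, x; split=> //.
move: xk; rewrite memv_ker add_lfunE opp_lfunE scale_lfunE id_lfunE subr_eq0.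
by move/eqP.
Qed.

Section Modules.
Variables (K : fieldType) (A : falgType K).
Implicit Types M N X Y : rmod A.

Lemma proper_in_max M (U : submodule M) : U <> fullv :> {vspace M} ->
  exists V : submodule M, maximal_submodule V /\ (U <= V)%VS.
Proof.
move=> Uf.
have [V [[Vf UV] maxV]] := @maximal_submodule_exists _ _ M
  (fun V => V <> fullv :> {vspace M} /\ (U <= V)%VS) U (conj Uf (subvv U)).
exists V; split=> //; split=> // W VW.
have [Wf|Wf] := pselect (W = fullv :> {vspace M}); [by right | left].
by apply: maxV => //; split=> //; apply: subv_trans VW.
Qed.

Lemma radicalP M x : x \in (radical M : {vspace M}) <->
  forall V : submodule M, maximal_submodule V -> x \in (V : {vspace M}).
Proof. by rewrite /radical; case: cid. Qed.

(** Take a power [F] of [f] whose image has least dimension. Then [F] is injective on its own image,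
    so [M] is the direct sum of the image and the kernel of [F], and one of the two vanishes. *)
Lemma fitting M (f : 'End(M)) : f \in homA M M -> indecomposable M ->
  lker f = 0%VS \/ exists k, forall x, iter k f x = 0.
Proof.
move=> fA [M0 indM].
pose pw := fix pw k : 'End(M) := if k is k'.+1 then (f \o pw k')%VF else \1%VF.
have pwE k x : pw k x = iter k f x.
  by elim: k => [|k IH] /=; rewrite ?id_lfunE // comp_lfunE IH.
have pwA k : pw k \in homA M M.
  by elim: k => [|k IH]; [apply: homA_id | apply: comp_homA].
(* Only positive powers compete, so that an injective [F] forces an injective [f]. *)
have [k mink] : exists k, forall l, (\dim (limg (pw k.+1)) <= \dim (limg (pw l.+1)))%N.
  pose P d := `[< exists k, d = \dim (limg (pw k.+1)) >].
  have exP : exists d, P d by exists (\dim (limg (pw 1%N))); apply/asboolP; exists 0%N.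
  have [_ /asboolP[k ->] mink] := ex_minnP exP.
  by exists k => l; apply: mink; apply/asboolP; exists l.
set F := pw k.+1 in mink.
have capF : (limg F :&: lker F = 0)%VS.
  apply/eqP; rewrite -dimv_eq0 -leqn0.
  have := limg_ker_dim F (limg F); rewrite -limg_comp.
  have -> : (F \o F)%VF = pw (k + k.+1).+1.
    apply/lfunP=> x; rewrite comp_lfunE !pwE -iterD; congr (iter _ f x); lia.
  by have := mink (k + k.+1)%N; lia.
have sumF : (limg F + lker F = fullv)%VS.
  apply/eqP; rewrite eqEdim subvf /=.
  have := dimv_sum_cap (limg F) (lker F); rewrite capF dimv0.
  by have := limg_ker_dim F fullv; rewrite capfv; lia.
have [|kF0|kF0] := indM (Submodule (@img_submodule _ _ _ _ F (full_sub M) (pwA k.+1)))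
    (ker_sub (pwA k.+1)) sumF _.
- exact: capF.
- right; exists k.+1 => x; rewrite -pwE; apply/eqP; rewrite -memv0 -kF0.
  by rewrite memv_img ?memvf.
- left; apply/lker0_inj=> x fx; move/lker0_inj: kF0; apply.
  rewrite /F pwE iterSr fx; elim: (k) => //= l ->; exact: linear0.
Qed.

Lemma simple_onto M N (f : 'Hom(M, N)) : f \in homA M N -> simple_module N ->
  (exists x, f x != 0) -> limg f = fullv.
Proof.
move=> fA [_ simN] [x fx].
have [/= f0|//] := simN (Submodule (@img_submodule _ _ _ _ f (full_sub M) fA)).
by case/eqP: fx; apply/eqP; rewrite -memv0 -f0 memv_img ?memvf.
Qed.

Lemma simple_inj M N (f : 'Hom(M, N)) : f \in homA M N -> simple_module M ->
  (exists x, f x != 0) -> lker f = 0%VS.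
Proof.
move=> fA [_ simM] [x fx].
have [//|/= f0] := simM (ker_sub fA).
by case/negP: fx; rewrite -memv_ker f0 memvf.
Qed.

Lemma preim_submodule M N (f : 'Hom(M, N)) (U : submodule N) : f \in homA M N ->
  exists W : submodule M, forall x, x \in (W : {vspace M}) <-> f x \in (U : {vspace N}).
Proof.
move=> /homAP fA; apply: pred_submodule => [|k x y fx fy|a x fx].
- by rewrite linear0 mem0v.
- by rewrite linearP memvD ?memvZ.
- by rewrite fA sm_stable.
Qed.

Lemma add_sub_exists M (U V : submodule M) : exists W : submodule M,
  W = (U + V)%VS :> {vspace M}.
Proof.
suff st : act_stable (U + V)%VS by exists (Submodule st).
move=> a _ /memv_addP[u uU [v vV ->]]; rewrite linearD.
by rewrite memv_add ?sm_stable.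
Qed.

Lemma simple_iso M N : isomorphic M N -> simple_module M -> simple_module N.
Proof.
move=> [f [fA f0 f1]] [M0 simM]; split=> [/fullv0P N0|U].
  apply: M0; apply/fullv0P=> x; move/lker0_inj: f0; apply; exact: N0.
have [W WP] := preim_submodule U fA.
have [W0|W1] := simM W; [left | right].
  apply/vspaceP=> y; have /limg_fullP/(_ y)[x ->] := f1.
  rewrite memv0; apply/idP/eqP=> [/WP|->]; last exact: mem0v.
  by rewrite W0 memv0 => /eqP->; rewrite linear0.
apply/vspaceP=> y; have /limg_fullP/(_ y)[x ->] := f1.
by rewrite memvf; apply/WP; rewrite W1 memvf.
Qed.

Lemma simple_or_proper M : {:M}%VS <> 0%VS -> ~ simple_module M ->
  exists U : submodule M, U <> 0%VS :> {vspace M} /\ U <> fullv :> {vspace M}.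
Proof.
move=> M0 nsim; apply: contrapT => no; apply: nsim; split=> // U.
have [|U0] := pselect (U = 0%VS :> {vspace M}); [by left | right].
by apply: contrapT => U1; apply: no; exists U.
Qed.

Lemma regular_projective : projective (regular A).
Proof.
move=> M N p g pA p_onto gA; have /limg_fullP/(_ (g 1))[m gm] := p_onto.
exists (orbit_map m); first exact: orbit_map_homA.
apply/lfunP=> a; rewrite comp_lfunE orbit_mapE.
move/homAP: pA => ->; rewrite -gm; move/homAP: gA => <-.
by rewrite act_regularE mul1r.
Qed.

(** The projection onto [U] along the submodule [V] is [A]-linear, so a map on [U] extends to [X],
    lifts there, and restricts back to [U]. *)
Lemma summand_projective X (U V : submodule X) : projective X ->
  (U + V)%VS = fullv -> (U :&: V)%VS = 0%VS -> projective (submod U).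
Proof.
move=> projX UV1 UV0 M N p g pA p1 gA.
have projU a x : daddv_pi U V (act X a x) = act X a (daddv_pi U V x).
  have xE := daddv_pi_add UV0 (_ : x \in (U + V)%VS).
  rewrite -{1}xE ?UV1 ?memvf // linearD linearD /=.
  rewrite daddv_pi_id // ?sm_stable ?memv_pi //.
  suff -> : daddv_pi U V (act X a (daddv_pi V U x)) = 0 by rewrite addr0.
  have vV : act X a (daddv_pi V U x) \in (V : {vspace X}).
    by rewrite sm_stable ?memv_pi.
  set v := act X a _ in vV *.
  have := daddv_pi_add UV0 (_ : v \in (U + V)%VS); rewrite UV1 memvf => /(_ isT).
  rewrite (@daddv_pi_id _ _ V U) //; last by rewrite capvC.
  by move/eqP; rewrite addrC -subr_eq0 addrAC subrr add0r => /eqP.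
have [||pi piA piE] := @hom_corestrict _ _ X X U (daddv_pi U V).
- by apply/homAP.
- by move=> x; rewrite memv_pi.
have [h hA hE] := projX _ _ p (g \o pi)%VF pA p1 (comp_homA gA piA).
exists (h \o incl U)%VF; first exact: comp_homA hA (incl_homA U).
apply/lfunP=> x; rewrite comp_lfunA hE !comp_lfunE; congr (g _).
by apply: val_inj; rewrite /= piE inclE daddv_pi_id // subvsP.
Qed.

End Modules.

Section Tops.
Variables (K : fieldType) (A : falgType K) (n : nat) (e : 'I_n -> A).
Hypothesis closedK : alg_closed K.
Hypothesis he : indexed_primitive_idempotents e.
Implicit Types M N X Y : rmod A.

Lemma e_idem i : e i * e i = e i.
Proof. by have [/(_ i)[]] := he. Qed.

Lemma Pmod_proj i : projective (Pmod e i).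
Proof. by have [_ _ /(_ (Pmod e i))[_ [|//]]] := he; exists i; apply: iso_refl. Qed.

Lemma Pmod_indec i : indecomposable (Pmod e i).
Proof. by have [_ _ /(_ (Pmod e i))[_ [|//]]] := he; exists i; apply: iso_refl. Qed.

Definition Pgen i : Pmod e i := vsproj (right_ideal (e i)) (e i).

Lemma mem_right_ideal (c a : A) : c * c = c ->
  (a \in (right_ideal c : {vspace regular A})) = (c * a == a).
Proof.
move=> cc; apply/memv_imgP/eqP=> [[x _ ->]|ca]; last first.
  by exists a; rewrite ?memvf // lfunE /= ca.
by rewrite lfunE /= mulrA cc.
Qed.

Lemma Pgen_val i : vsval (Pgen i) = e i.
Proof. by rewrite vsprojK // mem_right_ideal ?e_idem. Qed.

Lemma Pmod_val i (y : Pmod e i) : e i * vsval y = vsval y.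
Proof. by apply/eqP; rewrite -mem_right_ideal ?e_idem // subvsP. Qed.

Lemma Pmod_gen i (y : Pmod e i) : y = act (Pmod e i) (vsval y) (Pgen i).
Proof.
apply: subvs_inj; rewrite (@act_submodE _ _ _ (right_ideal (e i))) Pgen_val act_regularE.
by rewrite Pmod_val.
Qed.

Lemma Pmod_hom i M (x : M) : exists2 f, f \in homA (Pmod e i) M &
  forall y, f y = act M (vsval y) x.
Proof.
exists (orbit_map x \o incl (right_ideal (e i)))%VF.
  exact: comp_homA (orbit_map_homA x) (incl_homA _).
by move=> y; rewrite comp_lfunE orbit_mapE inclE.
Qed.

Lemma Pmod_homE i M (f : 'Hom(Pmod e i, M)) y : f \in homA (Pmod e i) M ->
  f y = act M (vsval y) (f (Pgen i)).
Proof. by move=> /homAP fA; rewrite -fA -Pmod_gen. Qed.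

Lemma Pgen_e i : act (Pmod e i) (e i) (Pgen i) = Pgen i.
Proof. by rewrite [RHS]Pmod_gen Pgen_val. Qed.

(* Write the generator as u + v; by Fitting's lemma left multiplication by u is
   either bijective or nilpotent, and in the latter case the one by v is injective. *)
Lemma Pmod_local i (U V : submodule (Pmod e i)) : (U + V = fullv)%VS ->
  U = fullv :> {vspace Pmod e i} \/ V = fullv :> {vspace Pmod e i}.
Proof.
move=> UV; have /memv_addP[u uU [v vV guv]] : Pgen i \in (U + V)%VS.
  by rewrite UV memvf.
have [f fA fE] := Pmod_hom i u; have [g gA gE] := Pmod_hom i v.
have fg y : f y + g y = y by rewrite fE gE -linearD -guv; exact/esym/Pmod_gen.
have full (W : submodule (Pmod e i)) h w : h \in homA (Pmod e i) (Pmod e i) ->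
    (forall y, h y = act (Pmod e i) (vsval y) w) -> w \in (W : {vspace _}) ->
    lker h = 0%VS -> W = fullv :> {vspace Pmod e i}.
  move=> hA hE wW h0; apply/eqP; rewrite eqEsubv subvf /=.
  have <- : limg h = fullv by apply/eqP; rewrite eqEdim subvf /= dim_inj_img.
  by apply/subvP=> _ /memv_imgP[y _ ->]; rewrite hE; exact: (@sm_stable _ _ _ W (vsval y) w wW).
have [f0|[k fk]] := fitting fA (Pmod_indec i).
  by left; apply: (full U f u).
right; apply: (full V g v) => //; apply/lker0_inj=> y gy.
have fy : f y = y by have := fg y; rewrite gy addr0.
by rewrite -(fk y); elim: (k) => //= l <-.
Qed.

Lemma rad_proper i : (radical (Pmod e i)) <> fullv :> {vspace Pmod e i}.
Proof.
have [P0 _] := Pmod_indec i => radf.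
have [|V [maxV _]] := @proper_in_max _ _ (Pmod e i) (zero_sub _).
  by move=> /= E; apply: P0; rewrite -E.
have [Vf _] := maxV; apply: Vf; apply/vspaceP=> x; rewrite memvf.
by have := memvf x; rewrite -radf => /radicalP/(_ V maxV).
Qed.

(** If [V] escaped some maximal [W], then [V + W] would be everything, against [Pmod_local]. *)
Lemma rad_max i (V : submodule (Pmod e i)) : V <> fullv :> {vspace Pmod e i} ->
  (V <= radical (Pmod e i))%VS.
Proof.
move=> Vf; apply/subvP=> x xV; apply/radicalP=> W [Wf maxW].
have [S SE] := add_sub_exists V W.
have [|SW|Sf] := maxW S; first by rewrite SE addvSr.
  by rewrite -SW SE; apply: (subvP (addvSl V W)).
by rewrite Sf in SE; case: (Pmod_local (esym SE)).
Qed.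

Lemma Smod_simple i : simple_module (Smod e i).
Proof.
split=> [/fullv0P S0|U].
  apply: (@rad_proper i); rewrite -ker_quo_proj; apply/vspaceP=> x.
  by rewrite memv_ker memvf (S0 (quo_proj _ x)) eqxx.
have [W WP] := preim_submodule U (quo_homA (radical (Pmod e i))).
have [Wf|Wf] := pselect (W = fullv :> {vspace _}); [right | left].
  apply/vspaceP=> y; rewrite memvf -[y]quo_projK; apply/WP.
  by rewrite Wf memvf.
apply/vspaceP=> y; rewrite -[y]quo_projK memv0; apply/idP/eqP => [/WP|->].
  move=> /(subvP (rad_max Wf)).
  by rewrite -quo_proj_eq0 => /eqP.
exact: mem0v.
Qed.

Definition Sgen i : Smod e i := quo_proj (radical (Pmod e i)) (Pgen i).

Lemma Sgen_neq0 i : Sgen i != 0.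
Proof.
rewrite quo_proj_eq0; apply/negP=> gr; apply: (@rad_proper i).
apply/vspaceP=> y; rewrite memvf [y]Pmod_gen; exact: sm_stable.
Qed.

Lemma Sgen_e i : act (Smod e i) (e i) (Sgen i) = Sgen i.
Proof. by have /homAP <- := quo_homA (radical (Pmod e i)); rewrite Pgen_e. Qed.

(** The kernel is proper, hence inside the radical. If the radical had nonzero image, its sum with
    the kernel would be everything, against locality. *)
Lemma Pmod_onto_simple i M (f : 'Hom(Pmod e i, M)) : f \in homA (Pmod e i) M ->
  simple_module M -> limg f = fullv -> lker f = radical (Pmod e i).
Proof.
move=> fA [M0 simM] f1; apply/eqP; rewrite eqEsubv; apply/andP; split.
  apply: (@rad_max i (ker_sub fA)) => /= kf; apply: M0; apply/fullv0P=> y.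
  have /limg_fullP/(_ y)[x ->] := f1; apply/eqP; rewrite -memv_ker kf.
  exact: memvf.
have [f0|f2] := simM (Submodule (@img_submodule _ _ _ _ f (radical _) fA)).
  by rewrite lkerE; apply/eqP.
have [||/rad_proper//] := @Pmod_local i (ker_sub fA) (radical (Pmod e i)); last first.
  by move=> /= ->; rewrite subvf.
apply/vspaceP=> x; rewrite memvf.
have : f x \in (f @: radical (Pmod e i))%VS by rewrite [(_ @: _)%VS]f2 memvf.
move=> /memv_imgP[y ry fxy]; rewrite -[x](subrK y) memv_add //.
by rewrite memv_ker linearB /= subr_eq0; apply/eqP.
Qed.

Lemma simple_top M k (x : M) : simple_module M -> act M (e k) x != 0 ->
  isomorphic M (Smod e k).
Proof.
move=> simM xk; have [f fA fE] := Pmod_hom k x.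
have f1 : limg f = fullv.
  by apply: simple_onto => //; exists (Pgen k); rewrite fE Pgen_val.
apply/iso_sym/(iso_quomod_ker fA f1).
exact: Pmod_onto_simple.
Qed.

(** The isomorphism of tops lifts to the projectives, and the lift is onto because a proper image
    would lie in the radical. Used in both directions, it gives [Pmod e j] and [Pmod e k] the same
    dimension, so they are isomorphic. *)
Lemma Smod_cover j k : isomorphic (Smod e j) (Smod e k) ->
  exists2 h, h \in homA (Pmod e j) (Pmod e k) & limg h = fullv.
Proof.
move=> [f [fA f0 f1]]; pose q := quo_proj (radical (Pmod e j)).
have qA : q \in homA _ (Smod e j) := quo_homA _.
have [h hA hE] := @Pmod_proj j _ _ _ _ (quo_homA (radical (Pmod e k))) (quo_onto _)
  (comp_homA fA qA).
exists h => //; apply: contrapT => hf.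
have := @rad_max k (Submodule (@img_submodule _ _ _ _ h (full_sub _) hA)) hf.
rewrite -[radical _ : {vspace _}]ker_quo_proj /= lkerE -limg_comp hE limg_comp.
rewrite [(q @: _)%VS]quo_onto f1 => /eqP E; have [S0 _] := Smod_simple k; exact: S0.
Qed.

Lemma Smod_iso j k : isomorphic (Smod e j) (Smod e k) -> j = k.
Proof.
move=> iso; have [h hA h1] := Smod_cover iso.
have [g gA g1] := Smod_cover (iso_sym iso).
have [_ _ _] := he; apply; exists h; split=> //.
apply/eqP; rewrite -dimv_eq0.
have := dim_ker_onto h1; have := dim_ker_onto g1; lia.
Qed.

Lemma Smod_e0 j k x : j != k -> act (Smod e j) (e k) x = 0.
Proof.
move=> jk; apply/eqP; apply: contraNT jk => /(simple_top (Smod_simple j))/Smod_iso.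
by move=> ->.
Qed.

(* Split a projective Q with a nonzero map to M until it is indecomposable, hence
   one of the P(k). *)
Lemma exists_e_neq0 M : {:M}%VS <> 0%VS -> exists k x, act M (e k) x != 0.
Proof.
move=> M0; apply: contrapT => no.
have noe k x : act M (e k) x = 0.
  by apply/eqP; apply: contrapT => /negP xk; apply: no; exists k, x.
suff hom0 d (Q : rmod A) (f : 'Hom(Q, M)) : (\dim {:Q} <= d)%N -> projective Q -> f \in homA Q M ->
    forall x, f x = 0.
  have [x _ x0] := vspace_neq0 M0.
  have := hom0 _ _ (orbit_map x) (leqnn _) (@regular_projective K A) (orbit_map_homA x) 1.
  by rewrite orbit_mapE act1x => /eqP; rewrite (negbTE x0).
elim: d Q f => [|d IH] Q f.
  rewrite leqn0 dimv_eq0 => /eqP/fullv0P Q0 _ _ x.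
  by rewrite (Q0 x) linear0.
move=> leQ projQ fA x.
have [indQ|nindQ] := pselect (indecomposable Q).
  have [_ _ /(_ Q)[/(_ (conj projQ indQ))[i [g [gA g0 g1]]] _] _] := he.
  have [h [hA h0 h1]] : isomorphic (Pmod e i) Q by apply: iso_sym; exists g.
  have /limg_fullP/(_ x)[y ->] := h1.
  rewrite -comp_lfunE (Pmod_homE _ (comp_homA fA hA)) -Pgen_e.
  by have /homAP-> := comp_homA fA hA; rewrite noe linear0.
have [/fullv0P Q0|Q0] := pselect ({:Q}%VS = 0%VS); first by rewrite (Q0 x) linear0.
have [U [V [UV1 UV0 U0 V0]]] : exists U V : submodule Q,
    [/\ (U + V)%VS = fullv, (U :&: V)%VS = 0%VS, \dim U != 0%N & \dim V != 0%N].
  apply: contrapT => noUV; apply: nindQ; split=> // U V UV1 UV0.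
  have [|/eqP U0] := pselect (U = 0%VS :> {vspace Q}); [by left | right].
  apply: contrapT => /eqP V0; apply: noUV; exists U, V.
  by rewrite !dimv_eq0.
have dUV := dimv_sum_cap U V; rewrite UV1 UV0 dimv0 in dUV.
have sub0 (W : submodule Q) y : projective (submod W) -> (\dim W <= d)%N ->
    y \in (W : {vspace Q}) -> f y = 0.
  move=> projW leW yW.
  have := IH _ (f \o incl W)%VF _ projW (comp_homA fA (incl_homA W)) (vsproj W y).
  by rewrite sub_dim comp_lfunE inclE vsprojK //; apply.
have /memv_addP[u uU [v vV ->]] : x \in (U + V)%VS by rewrite UV1 memvf.
rewrite linearD /= (sub0 U) ?(sub0 V) ?addr0 //.
- by apply: (summand_projective projQ _ _); rewrite 1?addvC 1?capvC; eauto.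
- move: U0 dUV leQ; lia.
- exact: (summand_projective projQ UV1 UV0).
- move: V0 dUV leQ; lia.
Qed.

(* For a = e j this is the multiplicity [M : S(j)], see [multiplicityP]. *)
Definition edim M (a : A) : nat := \dim (limg (act M a)).

(** Schur's lemma over an algebraically closed field: each element [y] fixed by [e j] is the image
    of the generator under an endomorphism of $S(j)$, and that endomorphism is a scalar because it
    has an eigenvalue. *)
Lemma Smod_edim j : edim (Smod e j) (e j) = 1%N.
Proof.
rewrite /edim; suff -> : limg (act (Smod e j) (e j)) = <[Sgen j]>%VS 
  by rewrite dim_vline Sgen_neq0.
apply/eqP; rewrite eqEsubv; apply/andP; split; last first.
  by rewrite -memvE -Sgen_e memv_img ?memvf.
apply/subvP=> _ /memv_imgP[x _ ->]; set y := act _ _ x.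
have [f fA fE] := Pmod_hom j y.
pose r := radical (Pmod e j).
have [g gA gE] : exists2 g, g \in homA (Smod e j) (Smod e j) & g (Sgen j) = y.
  have fy : f (Pgen j) = y by rewrite fE Pgen_val /y -actMx e_idem.
  have [|h hA hE] := homA_factor (quo_homA r) fA (quo_onto r).
    rewrite ker_quo_proj.
    have [f0|fn0] := pselect (forall x, f x = 0).
      by apply/subvP=> z _; rewrite memv_ker f0.
    rewrite -(Pmod_onto_simple fA (Smod_simple j)) ?subvv //.
    apply: simple_onto => //; first exact: Smod_simple.
    by apply: contrapT => no; apply: fn0 => z; apply/eqP; apply: contrapT => /negP ?;
      apply: no; exists z.
  by exists h => //; rewrite /Sgen hE.
have [S0 _] := Smod_simple j.
have [k [z [z0 gz]]] := lfun_eigenvalue g closedK S0.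
have dA : g - k *: \1%VF \in homA (Smod e j) (Smod e j).
  by rewrite rpredB // rpredZ // homA_id.
have [nz|zz] := pselect (exists w, (g - k *: \1%VF) w != 0).
  have := simple_inj dA (Smod_simple j) nz => /lker0_inj/(_ z).
  rewrite add_lfunE opp_lfunE scale_lfunE id_lfunE gz subrr => /(_ erefl) zE.
  by rewrite zE eqxx in z0.
have : (g - k *: \1%VF) (Sgen j) = 0.
  by apply/eqP; apply: contrapT => /negP ?; apply: zz; exists (Sgen j).
rewrite add_lfunE opp_lfunE scale_lfunE id_lfunE gE => /eqP.
by rewrite subr_eq0 => /eqP->; apply/vlineP; exists k.
Qed.

End Tops.

(** * Exactness of multiplicities and Hom dimensions *)

Section Homs.
Variables (K : fieldType) (A : falgType K).
Implicit Types M N X Y L : rmod A.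

Lemma edim0P M a : edim M a = 0%N <-> forall x, act M a x = 0.
Proof.
rewrite /edim; split=> [/eqP + x|a0].
  by rewrite dimv_eq0 => /eqP M0; apply/eqP; rewrite -memv0 -M0 memv_img ?memvf.
apply/eqP; rewrite dimv_eq0 -subv0; apply/subvP=> _ /memv_imgP[x _ ->].
by rewrite a0 mem0v.
Qed.

(** Passing from [M] to [M a] is exact because [a] is idempotent: an element of [M a] that comes
    from [L] equals its own multiple by [a], so it comes from [L a]. *)
Lemma edim_exact L M N (i : 'Hom(L, M)) (p : 'Hom(M, N)) (a : A) : a * a = a ->
  i \in homA L M -> p \in homA M N -> lker i = 0%VS -> limg p = fullv ->
  limg i = lker p -> edim M a = (edim L a + edim N a)%N.
Proof.
move=> aa /homAP iA /homAP pA i0 p1 ip; rewrite /edim.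
rewrite -(limg_ker_dim p (limg (act M a))); congr addn.
  rewrite -(dim_inj_img _ i0); congr (\dim _); apply/vspaceP=> x.
  apply/idP/memv_imgP=> [|[_ /memv_imgP[y _ ->] ->]].
    rewrite memv_cap -ip => /andP[/memv_imgP[y _ xE] /memv_imgP[z _ xz]].
    exists (act L a z); first by rewrite memv_img ?memvf.
    by rewrite iA -xz xE -actMx aa.
  by rewrite memv_cap -ip iA memv_img ?memvf //= -iA memv_img ?memvf.
rewrite -limg_comp; congr (\dim _); apply/vspaceP=> x.
apply/memv_imgP/memv_imgP=> [[y _ ->]|[y _ ->]].
  by exists (p y); rewrite ?memvf // comp_lfunE pA.
have /limg_fullP/(_ y)[z ->] := p1.
by exists z; rewrite ?memvf // comp_lfunE pA.
Qed.

Lemma edim_iso M N a : isomorphic M N -> edim M a = edim N a.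
Proof.
move=> [f [/homAP fA f0 f1]]; rewrite /edim -(dim_inj_img _ f0) -limg_comp.
congr (\dim _); apply/vspaceP=> x.
apply/memv_imgP/memv_imgP=> [[y _ ->]|[y _ ->]].
  by exists (f y); rewrite ?memvf // comp_lfunE fA.
have /limg_fullP/(_ y)[z ->] := f1.
by exists z; rewrite ?memvf // comp_lfunE fA.
Qed.

Lemma edim_quo M (U : submodule M) a : a * a = a ->
  edim M a = (edim (submod U) a + edim (quomod U) a)%N.
Proof.
move=> aa; apply: (edim_exact aa (incl_homA U) (quo_homA U)).
- exact: incl_ker.
- exact: quo_onto.
- by rewrite incl_img ker_quo_proj.
Qed.

Lemma sub_in_iso M (U V : submodule M) : (V <= U)%VS ->
  isomorphic (submod (sub_in U V)) (submod V).
Proof.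
move=> /subvP VU; apply: iso_sym.
have [|g gA gE] := hom_corestrict (U := U) (incl_homA V).
  by move=> x; rewrite inclE; apply/VU/subvsP.
apply: (iso_submod_img gA).
  apply/lker0_inj=> x gx; apply: (@incl_inj _ _ _ V).
  by rewrite linear0 -gE gx linear0.
apply/vspaceP=> x; rewrite mem_sub_in; apply/memv_imgP/idP=> [[y _ ->]|xV].
  by rewrite gE inclE subvsP.
exists (vsproj V (vsval x)); first exact: memvf.
by apply: subvs_inj; rewrite gE inclE vsprojK.
Qed.

Lemma edim_subquo M (U V : submodule M) a : a * a = a -> (V <= U)%VS ->
  edim (submod U) a = (edim (submod V) a + edim (subquo U V) a)%N.
Proof.
by move=> aa VU; rewrite (edim_quo (sub_in U V) aa) (edim_iso _ (sub_in_iso VU)).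
Qed.

Lemma edim_full M (U : submodule M) a : U = fullv :> {vspace M} ->
  edim (submod U) a = edim M a.
Proof.
move=> U1; apply: edim_iso; exists (incl U); split.
- exact: incl_homA.
- exact: incl_ker.
- by rewrite incl_img.
Qed.

Lemma edim_zero M (U : submodule M) a : U = 0%VS :> {vspace M} ->
  edim (submod U) a = 0%N.
Proof.
move=> U0; apply/edim0P=> x; apply: subvs_inj; rewrite act_submodE.
have := subvsP x; rewrite {2}U0 memv0 => /eqP->.
by rewrite !linear0.
Qed.

Lemma subquo_simple M (V W : submodule M) : (W <= V)%VS -> W <> V :> {vspace M} ->
  (forall X : submodule M, (W <= X)%VS -> (X <= V)%VS ->
     X = W :> {vspace M} \/ X = V :> {vspace M}) ->
  simple_module (subquo V W).
Proof.
move=> WV nWV maxW; split=> [E|U].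
  apply: nWV; apply/eqP; rewrite eqEdim WV -(subquo_dim WV) E dimv0.
  by rewrite addn0 leqnn.
have [Y YP] := preim_submodule U (quo_homA (sub_in V W)).
pose X := Submodule (@img_submodule _ _ _ _ (incl V) Y (incl_homA V)).
have XP x : (vsval x \in (X : {vspace M})) = (x \in (Y : {vspace submod V})).
  apply/memv_imgP/idP=> [[y yY]|xY]; last by exists x; rewrite ?inclE.
  by rewrite inclE => /val_inj->.
have [||XW|XV] := maxW X.
- apply/subvP=> x xW; have xV := subvP WV _ xW.
  rewrite -(vsprojK xV) XP; apply/YP.
  have -> : quo_proj (sub_in V W) (vsproj V x) = 0.
    by apply/eqP; rewrite quo_proj_eq0 mem_sub_in vsprojK.
  exact: mem0v.
- by apply/subvP=> _ /memv_imgP[y _ ->]; rewrite inclE subvsP.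
- left; apply/vspaceP=> y; rewrite -[y]quo_projK memv0.
  move: (vsval y) => z; rewrite quo_proj_eq0 mem_sub_in -XW XP.
  by apply/idP/idP=> /YP.
- right; apply/vspaceP=> y; rewrite -[y]quo_projK memvf; apply/YP.
  by rewrite -XP XV subvsP.
Qed.

(** The terms of a series are submodules of [M] itself, so the induction runs over submodules [V] of
    [M], each followed by a maximal proper submodule. *)
Lemma exists_composition_series M : exists m F, @composition_series _ _ M m F.
Proof.
suff ex d (V : submodule M) : (\dim V <= d)%N -> exists m (F : nat -> submodule M),
    [/\ F 0%N = V :> {vspace M}, F m = 0%VS :> {vspace M},
        forall k, (k < m)%N -> (F k.+1 <= F k)%VS
      & forall k, (k < m)%N -> simple_module (subquo (F k) (F k.+1))].
  by have [m [F [F0 Fm Fle Fs]]] := ex _ (full_sub M) (leqnn _); exists m, F.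
elim: d V => [|d IH] V leV.
  exists 0%N, (fun _ => V); split=> //.
  by apply/eqP; rewrite -dimv_eq0 -leqn0.
have [V0|V0] := pselect (V = 0%VS :> {vspace M}).
  by exists 0%N, (fun _ => V); split.
have [|W [[WV nWV] maxW]] := @maximal_submodule_exists _ _ M
    (fun W => (W <= V)%VS /\ W <> V :> {vspace M}) (zero_sub M).
  by split; [exact: sub0v | move=> /esym].
have leW : (\dim W <= d)%N.
  rewrite -ltnS; apply: leq_trans leV; rewrite ltnNge; apply/negP=> leVW.
  by apply: nWV; apply/eqP; rewrite eqEdim WV.
have [m [F [F0 Fm Fle Fs]]] := IH W leW.
exists m.+1, (fun k => if k is k'.+1 then F k' else V); split=> //.
  by case=> [|k] /= km; [rewrite F0 | apply: Fle].
case=> [|k] /= km; last exact: Fs.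
apply: subquo_simple; rewrite F0 //.
move=> X WX XV; have [|nXV] := pselect (X = V :> {vspace M}); [by right | left].
exact: maxW.
Qed.

Lemma hom_dim_surj M N X (p : 'Hom(M, N)) : p \in homA M N -> limg p = fullv ->
  (hom_dim N X <= hom_dim M X)%N.
Proof.
move=> pA p1; rewrite /hom_dim -(@dim_inj_img _ _ _ (precompose X p)).
  apply: dimvS; apply/subvP=> _ /memv_imgP[f fA ->].
  by rewrite precomposeE comp_homA.
apply/lker0_inj=> f; rewrite precomposeE => fp0; apply/lfunP=> y.
have /limg_fullP/(_ y)[x ->] := p1.
by rewrite -comp_lfunE fp0 !zero_lfunE.
Qed.

Lemma hom_dim_iso M N X : isomorphic M N -> hom_dim M X = hom_dim N X.
Proof.
move=> iso; have [f [fA _ f1]] := iso; have [g [gA _ g1]] := iso_sym iso.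
by apply/eqP; rewrite eqn_leq (hom_dim_surj X fA f1) (hom_dim_surj X gA g1).
Qed.

Section Exact.
Variables (L M N : rmod A) (i : 'Hom(L, M)) (p : 'Hom(M, N)).
Hypotheses (iA : i \in homA L M) (pA : p \in homA M N) (p1 : limg p = fullv).
Hypothesis ip : limg i = lker p.

Lemma hom_ker_exact X :
  (\dim (homA M X :&: lker (precompose X i)) = hom_dim N X)%N.
Proof.
rewrite /hom_dim -(@dim_inj_img _ _ _ (precompose X p) (homA N X)).
  congr (\dim _); apply/vspaceP=> f; rewrite memv_cap memv_ker precomposeE.
  apply/andP/memv_imgP=> [[fA /eqP fi0]|[g gA ->]].
    have [|h hA hE] := homA_factor pA fA p1.
      rewrite -ip; apply/subvP=> _ /memv_imgP[x _ ->].
      by rewrite memv_ker -comp_lfunE fi0 zero_lfunE.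
    by exists h => //; rewrite precomposeE; apply/lfunP=> x; rewrite comp_lfunE hE.
  rewrite precomposeE comp_homA //; split=> //; apply/eqP/lfunP=> x.
  rewrite !comp_lfunE zero_lfunE.
  have -> : p (i x) = 0 by apply/eqP; rewrite -memv_ker -ip memv_img ?memvf.
  exact: linear0.
apply/lker0_inj=> f; rewrite precomposeE => fp0; apply/lfunP=> y.
have /limg_fullP/(_ y)[x ->] := p1.
by rewrite -comp_lfunE fp0 !zero_lfunE.
Qed.

(** Left exactness of $\operatorname{Hom}(-, X)$, the source of the subadditivity in [qh_count]. For
    injective [X] the next lemma turns it into an equality. *)
Lemma hom_dim_exact X : (hom_dim M X <= hom_dim N X + hom_dim L X)%N.
Proof.
rewrite {1}/hom_dim -(limg_ker_dim (precompose X i)) hom_ker_exact leq_add2l.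
apply: dimvS; apply/subvP=> _ /memv_imgP[f fA ->].
by rewrite precomposeE comp_homA.
Qed.

Lemma hom_dim_exact_inj X : injective_module X -> lker i = 0%VS ->
  hom_dim M X = (hom_dim N X + hom_dim L X)%N.
Proof.
move=> injX i0; rewrite {1}/hom_dim -(limg_ker_dim (precompose X i)) hom_ker_exact.
congr addn; congr (\dim _); apply/vspaceP=> f; apply/memv_imgP/idP=> [[g gA ->]|fA].
  by rewrite precomposeE comp_homA.
have [h hA hE] := injX _ _ i f iA i0 fA.
by exists h => //; rewrite precomposeE.
Qed.

End Exact.

Lemma hom_dim_quo M (U : submodule M) X : injective_module X ->
  hom_dim M X = (hom_dim (quomod U) X + hom_dim (submod U) X)%N.
Proof.
move=> injX; apply: (@hom_dim_exact_inj (submod U) M (quomod U) (incl U) (quo_proj U)) => //.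
- exact: incl_homA.
- exact: quo_homA.
- exact: quo_onto.
- by rewrite incl_img ker_quo_proj.
- exact: incl_ker.
Qed.

Lemma hom_dim0P M X : hom_dim M X = 0%N <-> forall f, f \in homA M X -> f = 0.
Proof.
rewrite /hom_dim; split=> [/eqP + f fA|f0].
  by rewrite dimv_eq0 => /eqP E; apply/eqP; rewrite -memv0 -E.
apply/eqP; rewrite dimv_eq0 -subv0; apply/subvP=> f /f0 ->.
exact: mem0v.
Qed.

Definition eval_fun (U V : vectType K) (x : U) (f : 'Hom(U, V)) : V := f x.
Lemma eval_fun_linear (U V : vectType K) (x : U) : linear (@eval_fun U V x).
Proof. by move=> k f g; rewrite /eval_fun add_lfunE scale_lfunE. Qed.
HB.instance Definition _ (U V : vectType K) (x : U) := GRing.isSemilinear.Build K 'Hom(U, V) V _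
  (@eval_fun U V x) (GRing.semilinear_linear (@eval_fun_linear U V x)).
Definition eval_at (U V : vectType K) (x : U) : 'Hom('Hom(U, V), V) := linfun (@eval_fun U V x).
Lemma eval_atE (U V : vectType K) (x : U) (f : 'Hom(U, V)) : eval_at V x f = f x.
Proof. by rewrite lfunE. Qed.

(** The dimension of the image of [X] in [A / J], written without forming the quotient. *)
Definition dim_mod (J X : {vspace A}) : nat := (\dim (X + J) - \dim J)%N.

Lemma dim_modE (J X : {vspace A}) : (dim_mod J X + \dim J = \dim (X + J))%N.
Proof. by rewrite subnK // dimvS // addvSr. Qed.

Lemma dim_mod_cap (J X : {vspace A}) : (dim_mod J X + \dim (X :&: J) = \dim X)%N.
Proof. by have := dim_modE J X; have := dimv_sum_cap X J; lia. Qed.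

Definition two_sided (J : {vspace A}) : Prop :=
  forall a b x, x \in J -> a * x * b \in J.

Lemma two_sidedl J a x : two_sided J -> x \in J -> a * x \in J.
Proof. by move=> tJ xJ; rewrite -[a * x]mulr1 tJ. Qed.

Lemma two_sidedr J a x : two_sided J -> x \in J -> x * a \in J.
Proof. by move=> tJ xJ; rewrite -[x]mul1r tJ. Qed.

(* r presents X as f A / f J, with 1 sent to the class of f. *)
Definition cyclic_pres X (f : A) (J : {vspace A}) (r : 'Hom(regular A, X)) : Prop :=
  [/\ r \in homA (regular A) X, limg r = fullv &
      forall a : A, r a = 0 <-> f * a \in J].

Lemma line_prodE (f : A) W x : x \in (<[f]> * W)%VS <-> exists2 y, y \in W & x = f * y.
Proof.
split=> [|[y yW ->]]; last by rewrite memv_mul ?memv_line.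
suff /subvP H : (<[f]> * W <= amull f @: W)%VS.
  by move=> /H/memv_imgP[y yW ->]; exists y; rewrite ?lfunE.
apply/prodvP=> _ y /vlineP[k ->] yW; apply/memv_imgP.
by exists (k *: y); rewrite ?memvZ // lfunE /= -scalerAl -scalerAr.
Qed.

Lemma prod_lineE (f : A) W x : x \in (W * <[f]>)%VS <-> exists2 y, y \in W & x = y * f.
Proof.
split=> [|[y yW ->]]; last by rewrite memv_mul ?memv_line.
by rewrite -limg_amulr => /memv_imgP[y yW ->]; exists y; rewrite ?lfunE.
Qed.

(** * Cyclic modules of the form f A / f J *)

Section Cyclic.
Variables (X : rmod A) (f : A) (J : {vspace A}) (r : 'Hom(regular A, X)).
Hypotheses (ff : f * f = f) (tJ : two_sided J) (rP : cyclic_pres f J r).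

Lemma cyc_act a b : act X b (r a) = r (a * b).
Proof. by have [/homAP rA _ _] := rP; rewrite -[a * b]act_regularE rA. Qed.

Lemma cyc_mull a : r (f * a) = r a.
Proof.
have [_ _ r0] := rP; apply/eqP; rewrite -subr_eq0 -linearB; apply/eqP/r0.
by rewrite mulrBr mulrA ff subrr mem0v.
Qed.

Lemma cyc_gen_f : act X f (r 1) = r 1.
Proof. by rewrite cyc_act mul1r -[f]mulr1 cyc_mull. Qed.

Lemma cyc_gen_J a : a \in J -> act X a (r 1) = 0.
Proof.
by move=> aJ; rewrite cyc_act mul1r; have [_ _ r0] := rP; apply/r0/two_sidedl.
Qed.

Lemma cyc_rE a : r a = act X a (r 1).
Proof. by rewrite cyc_act mul1r. Qed.

Lemma cyc_hom N (x : N) : act N f x = x -> (forall a, a \in J -> act N a x = 0) ->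
  exists2 h, h \in homA X N & forall a, h (r a) = act N a x.
Proof.
move=> xf xJ; have [rA r1 r0] := rP.
have [|h hA hE] := homA_factor rA (orbit_map_homA x) r1.
  apply/subvP=> a; rewrite !memv_ker orbit_mapE => /eqP/r0/xJ.
  by rewrite actMx xf => ->.
by exists h => // a; rewrite hE orbit_mapE.
Qed.

(** Evaluation at the generator is injective on homomorphisms, and by [cyc_hom] its image consists
    of all elements fixed by [f] and annihilated by [J]. *)
Lemma hom_dim_cyc N (W : {vspace N}) :
  (forall x, x \in W <-> act N f x = x /\ forall a, a \in J -> act N a x = 0) ->
  hom_dim X N = \dim W.
Proof.
move=> WP; have [/homAP rA r1 r0] := rP.
have key (h : 'Hom(X, N)) a : h \in homA X N -> h (r a) = act N a (h (r 1)).
  by move=> /homAP hA; rewrite cyc_rE hA.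
rewrite /hom_dim -(@limg_dim_eq _ _ _ (eval_at N (r 1))); last first.
  apply/eqP; rewrite -subv0; apply/subvP=> h; rewrite memv_cap memv_ker eval_atE.
  move=> /andP[hA /eqP h0]; rewrite memv0; apply/eqP/lfunP=> y.
  have /limg_fullP/(_ y)[a ->] := r1.
  by rewrite key // h0 linear0 zero_lfunE.
congr (\dim _); apply/vspaceP=> x; apply/memv_imgP/idP=> [[h hA ->]|/WP[xf xJ]].
  rewrite eval_atE; apply/WP; split=> [|a aJ].
    by move/homAP: hA => <-; rewrite cyc_gen_f.
  by move/homAP: hA => <-; rewrite cyc_gen_J // linear0.
have [h hA hE] := cyc_hom xf xJ; exists h => //.
by rewrite eval_atE hE act1x.
Qed.

(** The map [r] factors through left multiplication by [f], and what dies afterwards is the part of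
    [f W] inside [J]. *)
Lemma dim_cyc_img (W : {vspace A}) : \dim (r @: W) = dim_mod J (<[f]> * W).
Proof.
have [_ _ r0] := rP; pose g := amull f.
have gE : (<[f]> * W)%VS = (g @: W)%VS.
  apply/vspaceP=> x; apply/idP/memv_imgP=> [/line_prodE[y yW ->]|[y yW ->]].
    by exists y; rewrite ?lfunE.
  by apply/line_prodE; exists y; rewrite ?lfunE.
have capE : (g @: W :&: J)%VS = (g @: (W :&: lker r))%VS.
  apply/vspaceP=> x; rewrite memv_cap; apply/andP/memv_imgP=> [[]|[y + ->]].
    move=> /memv_imgP[y yW ->]; rewrite lfunE /= => /r0 ry.
    by exists y; rewrite ?memv_cap ?yW ?memv_ker ?ry //= lfunE.
  rewrite memv_cap memv_ker => /andP[yW /eqP/r0 fy].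
  by rewrite memv_img // lfunE.
have kg : (lker g <= lker r)%VS.
  by apply/subvP=> a; rewrite !memv_ker lfunE /= => /eqP fa; apply/eqP/r0; rewrite fa mem0v.
have := dim_mod_cap J (<[f]> * W); rewrite gE capE.
pose V : {vspace A} := (W :&: lker r)%VS; rewrite -/V.
have h1 : (\dim V + \dim (r @: W) = \dim W)%N := limg_ker_dim r W.
have h2 : (\dim (V :&: lker g) + \dim (g @: V) = \dim V)%N := limg_ker_dim g V.
have h3 : (\dim (W :&: lker g) + \dim (g @: W) = \dim W)%N := limg_ker_dim g W.
have h4 : (V :&: lker g = W :&: lker g)%VS.
  by rewrite /V -capvA; congr (_ :&: _)%VS; apply/capv_idPr.
rewrite h4 in h2.
lia.
Qed.

Lemma dim_cyc : \dim {:X} = dim_mod J (<[f]> * fullv).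
Proof. by have [_ <- _] := rP; rewrite dim_cyc_img. Qed.

Lemma edim_cyc b : edim X b = dim_mod J (<[f]> * (fullv * <[b]>)).
Proof.
rewrite -dim_cyc_img /edim; congr (\dim _); apply/vspaceP=> x.
apply/memv_imgP/memv_imgP=> [[y _ ->]|[_ /prod_lineE[a _ ->] ->]].
  have [_ /limg_fullP/(_ y)[a ->] _] := rP; exists (a * b).
    by apply/prod_lineE; exists a; rewrite ?memvf.
  by rewrite cyc_act.
by exists (r a); rewrite ?memvf // cyc_act.
Qed.

End Cyclic.

Lemma cyc_exists f J : two_sided J -> exists X (r : 'Hom(regular A, X)), cyclic_pres f J r.
Proof.
move=> tJ; have [|k x y fx fy|a x fx|W WP] :=
  @pred_submodule _ _ (regular A) (fun a : A => f * a \in J).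
- by rewrite mulr0 mem0v.
- by rewrite mulrDr -scalerAr memvD ?memvZ.
- by rewrite act_regularE mulrA two_sidedr.
exists (quomod W), (quo_proj W); split; first exact: quo_homA.
  exact: quo_onto.
move=> a; split=> [/eqP|/WP]; first by rewrite quo_proj_eq0 => /WP.
by rewrite -quo_proj_eq0 => /eqP.
Qed.

End Homs.

(** * Composition factors, standard and costandard modules *)

Section Algebra.
Variables (K : fieldType) (A : falgType K) (n : nat) (e : 'I_n -> A).
Hypothesis closedK : alg_closed K.
Hypothesis he : indexed_primitive_idempotents e.
Implicit Types M N X Y Q : rmod A.

Lemma simple_edim M j : simple_module M ->
  edim M (e j) = `[< isomorphic M (Smod e j) >] :> nat.
Proof.
move=> simM; have [iso|niso] := asboolP (isomorphic M (Smod e j)).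
  by rewrite (edim_iso _ iso) Smod_edim.
apply/edim0P=> x; apply/eqP; apply: contrapT => /negP xj; apply: niso.
exact: simple_top xj.
Qed.

(** Additivity of [edim] telescopes along the series, each simple factor contributing 1 or 0. Since
    the right-hand side does not mention [F], this contains the Jordan-Hoelder theorem for the
    factors $S(j)$. *)
Lemma composition_count M m (F : nat -> submodule M) j : composition_series m F ->
  #|[set k : 'I_m | `[< isomorphic (subquo (F k) (F k.+1)) (Smod e j) >]]| = edim M (e j).
Proof.
move=> [[F0 Fm Fle] Fs].
pose b k := edim (subquo (F k) (F k.+1)) (e j).
have tele l : (l <= m)%N ->
    edim M (e j) = (\sum_(0 <= k < l) b k + edim (submod (F l)) (e j))%N.
  elim: l => [|l IH] lm; first by rewrite big_geq // -(edim_full _ F0).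
  rewrite (IH (ltnW lm)) (big_nat_recr _ _ _ (leq0n l)) -addnA; congr (_ + _)%N.
  by rewrite (edim_subquo (e_idem he j) (Fle _ lm)) addnC.
rewrite (tele m (leqnn m)) (edim_zero _ Fm) addn0 -sum1_card big_mkcond big_mkord.
apply: eq_bigr => k _; rewrite inE /b (simple_edim _ (Fs _ (ltn_ord k))).
by case: ifP.
Qed.

Lemma multiplicityP M j d : multiplicity M (Smod e j) d <-> d = edim M (e j).
Proof.
split=> [[m [F [FP ->]]]|->]; first exact: composition_count.
have [m [F FP]] := exists_composition_series M.
by exists m, F; split=> //; rewrite composition_count.
Qed.

(** Removes composition series from the definitions: $S(k)$ occurs in [M] exactly when [e k] acts
    nontrivially on it. *)
Lemma factors_belowP (s : 'S_n) i M : factors_below e s i M <->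
  forall k, (s i < s k)%N -> forall x, act M (e k) x = 0.
Proof.
split=> [fb k ik|M0 X [m [F [k [[[F0 Fm Fle] Fs] km isoX]]]]].
  have [m [F FP]] := exists_composition_series M.
  apply/edim0P; rewrite -(composition_count k FP); apply: eq_card0 => l.
  rewrite inE; apply/asboolP=> iso.
  have [|j jle isoj] := fb (subquo (F l) (F l.+1)).
    by exists m, F, l; split=> //; apply: iso_refl.
  have := Smod_iso he (iso_trans (iso_sym iso) isoj) => kj.
  by rewrite kj ltnNge jle in ik.
have simX := simple_iso isoX (Fs k km); have [X0 _] := simX.
have [j [x xj]] := exists_e_neq0 he X0; exists j; last exact: simple_top xj.
rewrite leqNgt; apply/negP=> ij; case/eqP: xj; move: x; apply/edim0P.
rewrite -(edim_iso _ isoX); apply/eqP; rewrite -leqn0.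
have Mj : edim M (e j) = 0%N by apply/edim0P; exact: M0.
have := edim_subquo (e_idem he j) (Fle k km).
have := edim_quo (F k) (e_idem he j); lia.
Qed.

(* The trace in A of the projectives P(k) with C k. *)
Definition trace_ideal (C : pred 'I_n) : {vspace A} :=
  (\sum_(k | C k) (fullv * <[e k]>) * (<[e k]> * fullv))%VS.

Lemma trace_ideal_mem (C : pred 'I_n) k a b : C k -> a * e k * b \in trace_ideal C.
Proof.
move=> Ck; apply: (subvP (sumv_sup k Ck (subvv _))).
have -> : a * e k * b = (a * e k) * (e k * b) by rewrite mulrA -(mulrA a (e k) (e k)) (e_idem he).
apply: memv_mul; first by apply/prod_lineE; exists a; rewrite ?memvf.
by apply/line_prodE; exists b; rewrite ?memvf.
Qed.

Lemma trace_ideal_sub (C : pred 'I_n) (W : {vspace A}) :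
  (forall k a b, C k -> a * e k * b \in W) -> (trace_ideal C <= W)%VS.
Proof.
move=> CW; apply/subv_sumP=> k Ck; apply/prodvP=> u v.
move=> /prod_lineE[a _ ->] /line_prodE[b _ ->].
by rewrite mulrA -(mulrA a (e k) (e k)) (e_idem he) // CW.
Qed.

Lemma trace_ideal_ind (C : pred 'I_n) (P : A -> Prop) : P 0 ->
  (forall c x y, P x -> P y -> P (c *: x + y)) ->
  (forall k a b, C k -> P (a * e k * b)) -> forall x, x \in trace_ideal C -> P x.
Proof.
move=> P0 PD PC x; have [W WP] := pred_vspace P0 PD => xC.
by apply/WP; apply: subvP xC; apply: trace_ideal_sub => k a b Ck; apply/WP/PC.
Qed.

Lemma trace_ideal_two_sided (C : pred 'I_n) : two_sided (trace_ideal C).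
Proof.
move=> a b; apply: trace_ideal_ind => [|c x y xC yC|k c d Ck].
- by rewrite mulr0 mul0r mem0v.
- by rewrite mulrDr mulrDl -scalerAr -scalerAl memvD ?memvZ.
- have -> : a * (c * e k * d) * b = (a * c) * e k * (d * b) by rewrite !mulrA.
  exact: trace_ideal_mem.
Qed.

Lemma trace_ideal_kill (C : pred 'I_n) M : (forall k x, C k -> act M (e k) x = 0) ->
  forall a, a \in trace_ideal C -> forall x, act M a x = 0.
Proof.
move=> MC; apply: trace_ideal_ind => [|c a b a0 b0|k a b Ck] x.
- by rewrite act0l.
- by rewrite actDl actZl a0 b0 scaler0 addr0.
- by rewrite !actMx MC // linear0.
Qed.

(** The module $S(j)$ separates them: the ideal annihilates it and [e j] does not. *)
Lemma e_notin_trace_ideal (C : pred 'I_n) j : ~~ C j -> e j \notin trace_ideal C.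
Proof.
move=> nCj; apply/negP=> jC; have := Sgen_neq0 he j.
rewrite -(Sgen_e he j) (@trace_ideal_kill C _ _ _ jC) ?eqxx // => k x Ck.
by apply: Smod_e0 => //; apply: contraNneq nCj => ->.
Qed.

Definition above (s : 'S_n) (i : 'I_n) : pred 'I_n := fun k => (s i < s k)%N.

(** The quotient by the part of [e i A] in the ideal has only allowed factors; conversely, a kernel
    with allowed quotient contains every [e i * a * e k * b] with [k] above [i]. Thus the kernel
    chosen by minimality becomes explicit. *)
Lemma Delta_kerP s i y : y \in (Delta_ker e s i : {vspace Pmod e i}) <->
  vsval y \in trace_ideal (above s i).
Proof.
set J := trace_ideal _; have tJ : two_sided J := @trace_ideal_two_sided _.
have [||a z|W WP] := @pred_submodule _ _ (Pmod e i) (fun y => vsval y \in J).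
- by rewrite linear0 mem0v.
- by move=> k z w zJ wJ; rewrite linearP memvD ?memvZ.
- by move=> zJ; rewrite act_submodE act_regularE two_sidedr.
suff -> : (Delta_ker e s i : {vspace _}) = W by apply: WP.
rewrite /Delta_ker; case: cid => U [/= /factors_belowP fbU minU].
symmetry; apply: minU.
  apply/factors_belowP=> k ik x; rewrite -[x]quo_projK quo_actE.
  apply/eqP; rewrite quo_proj_eq0; apply/WP; rewrite act_submodE act_regularE.
  by rewrite -[_ * e k]mulr1 trace_ideal_mem.
apply/subvP=> z /WP zJ.
suff H x : x \in J -> vsproj (right_ideal (e i)) (e i * x) \in (U : {vspace Pmod e i}).
  by have := H _ zJ; rewrite Pmod_val // vsvalK.
move: x; apply: trace_ideal_ind => [|c x w xU wU|k a b Ck].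
- by rewrite mulr0 linear0 mem0v.
- by rewrite mulrDr -scalerAr linearP memvD ?memvZ.
have mem_i (x : A) : (e i * x : A) \in (right_ideal (e i) : {vspace regular A}).
  by rewrite (mem_right_ideal _ (e_idem he i)) mulrA (e_idem he).
pose w : Pmod e i := vsproj (right_ideal (e i)) (e i * a).
have -> : vsproj (right_ideal (e i)) (e i * (a * e k * b)) =
    act (Pmod e i) b (act (Pmod e i) (e k) w).
  apply: subvs_inj; rewrite !(@act_submodE _ _ _ (right_ideal (e i))).
  rewrite vsprojK; last exact: mem_i.
  by rewrite vsprojK ?mem_i // !act_regularE !mulrA.
apply: (@sm_stable _ _ _ U); rewrite -quo_proj_eq0 -quo_actE; apply/eqP.
exact: fbU.
Qed.

Lemma Delta_pres s i : exists r : 'Hom(regular A, Delta e s i),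
  cyclic_pres (e i) (trace_ideal (above s i)) r.
Proof.
pose R := right_ideal (e i).
have mem_i (x : A) : (e i * x : A) \in (R : {vspace regular A}).
  by rewrite (mem_right_ideal _ (e_idem he i)) mulrA (e_idem he).
have [||g gA gE] := @hom_corestrict _ _ (regular A) (regular A) R (amull (e i)).
- by apply/homAP=> a x; rewrite !act_regularE !lfunE /= mulrA.
- by move=> x; rewrite lfunE; apply: mem_i.
exists (quo_proj (Delta_ker e s i) \o g)%VF; split.
- exact: comp_homA (quo_homA _) gA.
- apply/limg_fullP=> y; exists (vsval (vsval y)).
  rewrite comp_lfunE -[y in LHS]quo_projK; congr (quo_proj _ _).
  by apply: subvs_inj; rewrite gE lfunE /= Pmod_val.
- move=> a; rewrite comp_lfunE; have := Delta_kerP s (g a).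
  have -> : vsval (g a) = e i * a by rewrite gE lfunE.
  rewrite -quo_proj_eq0 => H.
  by split=> [/eqP/H|/H/eqP].
Qed.

(** * Homomorphisms into the injective envelope of a simple module *)

Section Envelope.
Variables (j : 'I_n) (Q : rmod A).
Hypothesis QP : injective_envelope (Smod e j) Q.

(** The element [z] is the image of the generator of $S(j)$: by essentiality a nonzero submodule
    meets this copy of $S(j)$, and by simplicity contains it. *)
Lemma env_socle : exists z : Q, [/\ z != 0, act Q (e j) z = z &
  forall U : submodule Q, U <> 0%VS :> {vspace Q} -> z \in (U : {vspace Q})].
Proof.
have [injQ [f [fA f0 ess]]] := QP; exists (f (Sgen e j)); split.
- apply: contraNneq (Sgen_neq0 he j) => fz; apply/eqP.
  by move/lker0_inj: f0; apply.
- by move/homAP: fA => <-; rewrite Sgen_e.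
- move=> U U0; have [W WP] := preim_submodule U fA.
  have [_ simS] := Smod_simple he j; have [W0|W1] := simS W; last first.
    by apply/WP; rewrite W1 memvf.
  case: U0; apply: ess; apply/eqP; rewrite -subv0; apply/subvP=> y.
  rewrite memv_cap => /andP[yU /memv_imgP[x _ xE]].
  have : x \in (W : {vspace _}) by apply/WP; rewrite -xE.
  by rewrite W0 xE !memv0 => /eqP->; rewrite linear0.
Qed.

Lemma env_e_neq0 (U : submodule Q) :
  (forall x, x \in (U : {vspace Q}) -> act Q (e j) x = 0) -> U = 0%VS :> {vspace Q}.
Proof.
move=> Ue; apply: contrapT => U0; have [z [z0 zj /(_ U U0) zU]] := env_socle.
by rewrite -zj Ue ?eqxx in z0.
Qed.

Lemma env_cap (U V : submodule Q) : (U :&: V)%VS = 0%VS ->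
  U = 0%VS :> {vspace Q} \/ V = 0%VS :> {vspace Q}.
Proof.
move=> UV; have [z [z0 _ zP]] := env_socle.
have [|U0] := pselect (U = 0%VS :> {vspace Q}); [by left | right].
apply: contrapT => V0; have : z \in (U :&: V)%VS by rewrite memv_cap !zP.
by rewrite UV memv0 (negbTE z0).
Qed.

Lemma hom_env0 M (f : 'Hom(M, Q)) : f \in homA M Q ->
  (forall x, act M (e j) x = 0) -> f = 0.
Proof.
move=> fA Mj; apply/lfunP=> x; rewrite zero_lfunE; apply/eqP; rewrite -memv0.
have /= <- := @env_e_neq0 (Submodule (@img_submodule _ _ _ _ f (full_sub M) fA)) _.
  by rewrite memv_img ?memvf.
move=> _ /memv_imgP[y _ ->]; move/homAP: fA => <-.
by rewrite Mj linear0.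
Qed.

(** For two nonzero maps [f] and [g] both images contain the socle element [z]. As [z] is fixed by
    [e j] and [e j] cuts $S(j)$ down to the line of its generator, [z] is a multiple of both images
    of that generator, so [g] is a multiple of [f]. *)
Lemma hom_dim_Smod_env : hom_dim (Smod e j) Q = 1%N.
Proof.
have [injQ [f [fA f0 _]]] := QP.
have Sj_line (y : Smod e j) : exists c, act (Smod e j) (e j) y = c *: Sgen e j.
  have := Smod_edim closedK he j; rewrite /edim => d1.
  have : (<[Sgen e j]> == limg (act (Smod e j) (e j)))%VS.
    rewrite eqEdim d1 dim_vline Sgen_neq0 // andbT -memvE -{1}(Sgen_e he).
    by rewrite memv_img ?memvf.
  move=> /eqP E; apply/vlineP; rewrite E memv_img ?memvf //.
have gen (y : Smod e j) : exists a, y = act (Smod e j) a (Sgen e j).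
  exists (vsval (vsval y)); rewrite -[LHS]quo_projK [vsval y in LHS](Pmod_gen he).
  by rewrite /Sgen quo_actE.
rewrite /hom_dim; suff -> : homA (Smod e j) Q = <[f]>%VS.
  rewrite dim_vline; case: eqP => // f00; have := Sgen_neq0 he j.
  move/lker0_inj: f0 => /(_ (Sgen e j)); rewrite f00 zero_lfunE => -> //.
  by rewrite eqxx.
apply/eqP; rewrite eqEsubv -memvE fA andbT; apply/subvP=> g gA.
have [g0|gn0] := pselect (g = 0); first by rewrite g0 mem0v.
have [z [z0 zj zP]] := env_socle.
have zf : exists c, z = c *: f (Sgen e j).
  have : z \in limg f.
    apply: (zP (Submodule (@img_submodule _ _ _ _ f (full_sub _) fA))) => /= E.
    have /negP := Sgen_neq0 he j; apply; apply/eqP; move/lker0_inj: f0; apply.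
    by apply/eqP; rewrite -memv0 -E memv_img ?memvf.
  move=> /memv_imgP[y _ zE]; have [c yE] := Sj_line y.
  by exists c; rewrite -linearZ /= -yE; move/homAP: fA => ->; rewrite -zE zj.
have zg : exists c, z = c *: g (Sgen e j).
  have : z \in limg g.
    apply: (zP (Submodule (@img_submodule _ _ _ _ g (full_sub _) gA))) => /= E.
    apply: gn0; apply/lfunP=> x; rewrite zero_lfunE; apply/eqP.
    by rewrite -memv0 -E memv_img ?memvf.
  move=> /memv_imgP[y _ zE]; have [c yE] := Sj_line y.
  by exists c; rewrite -linearZ /= -yE; move/homAP: gA => ->; rewrite -zE zj.
have [c cE] := zf; have [d dE] := zg.
have d0 : d != 0 by apply: contraNneq z0 => d0; rewrite dE d0 scale0r.
apply/vlineP; exists (d^-1 * c); apply/lfunP=> y; have [a ->] := gen y.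
move/homAP: (gA) => ->; rewrite scale_lfunE; move/homAP: (fA) => ->.
by rewrite -linearZ /= -scalerA -cE dE scalerA mulVf // scale1r.
Qed.

(** Both sides are additive on short exact sequences, the left one because [Q] is injective, and
    they agree on simple modules; the rest is induction on the dimension. *)
Lemma hom_dim_env M : hom_dim M Q = edim M (e j).
Proof.
have [injQ _] := QP.
have [d] := ubnP (\dim {:M}); elim: d M => // d IH M leM.
have [M0|M0] := pselect ({:M}%VS = 0%VS).
  have -> : edim M (e j) = 0%N.
    by apply/edim0P=> x; move/fullv0P: M0.
  by apply/hom_dim0P=> f _; apply/lfunP=> x; move/fullv0P: M0 => /(_ x)->; rewrite !linear0.
have [simM|nsimM] := pselect (simple_module M).
  rewrite (simple_edim j simM); case: asboolP => [iso|niso].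
    by rewrite (hom_dim_iso _ iso) hom_dim_Smod_env.
  apply/hom_dim0P=> f fA; apply: hom_env0 => // x.
  apply/eqP; apply: contrapT => /negP xj; apply: niso; exact: simple_top xj.
have [U [U0 U1]] := simple_or_proper M0 nsimM.
have dE := quo_dim U; rewrite (hom_dim_quo U) // (edim_quo U (e_idem he j)).
have n0 : \dim U != 0%N by rewrite dimv_eq0; apply/eqP.
have lt1 : (\dim U < \dim {:M})%N.
  rewrite ltnNge; apply/negP=> le; apply: U1; apply/eqP; by rewrite eqEdim subvf.
have leq1 : (\dim {:quomod U} < d)%N by lia.
have leq2 : (\dim {:submod U} < d)%N by rewrite sub_dim; lia.
by rewrite (IH _ leq1) (IH _ leq2) addnC.
Qed.

End Envelope.

(** * Costandard modules as annihilators of trace ideals *)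

Section Nabla.
Variables (I : 'I_n -> rmod A).
Hypothesis hI : forall j, injective_envelope (Smod e j) (I j).

(** A submodule has only allowed factors exactly when the ideal kills it, and the annihilator of the
    ideal in [I j] is the largest such submodule. *)
Lemma nabla_subP s j x : x \in (nabla_sub e I s j : {vspace I j}) <->
  forall a, a \in trace_ideal (above s j) -> act (I j) a x = 0.
Proof.
set J := trace_ideal _; have tJ : two_sided J := @trace_ideal_two_sided _.
have [|k u v u0 v0 a aJ|b u u0 a aJ|W WP] :=
  @pred_submodule _ _ (I j) (fun x => forall a, a \in J -> act (I j) a x = 0).
- by move=> a _; rewrite linear0.
- by rewrite linearP /= u0 // v0 // scaler0 addr0.
- by rewrite -actMx u0 // two_sidedl.
suff -> : (nabla_sub e I s j : {vspace _}) = W by apply: WP.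
rewrite /nabla_sub; case: cid => U [/= /factors_belowP fbU maxU].
symmetry; apply: maxU.
  apply/factors_belowP=> k ik y; apply: subvs_inj; rewrite act_submodE linear0.
  have /WP -> // := subvsP y.
  by rewrite -[e k]mulr1 -[e k]mul1r trace_ideal_mem.
apply/subvP=> y yU; apply/WP=> a aJ.
have := trace_ideal_kill (fun k x ik => fbU k ik x) aJ (vsproj U y).
by move/(congr1 vsval); rewrite act_submodE vsprojK // linear0.
Qed.

(** The elements of $I(j) f$ killed by the ideal are the homomorphisms from $fA/fJ$ to $I(j)$, and
    by [hom_dim_env] these are counted by the [e j]-part of $fA/fJ$. Hence one corner of [A]
    measures both standard and costandard modules. *)
Lemma edim_nabla s j f : f * f = f ->
  edim (nabla e I s j) f = dim_mod (trace_ideal (above s j)) (<[f]> * (fullv * <[e j]>)).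
Proof.
move=> ff; set J := trace_ideal _; have tJ : two_sided J := @trace_ideal_two_sided _.
have [X [r rP]] := cyc_exists f tJ.
rewrite -(edim_cyc rP) -(hom_dim_env (hI j)).
pose N := nabla_sub e I s j.
rewrite (hom_dim_cyc ff tJ rP (W := (act (I j) f @: N)%VS)).
  rewrite /edim -(dim_inj_img _ (incl_ker N)); congr (\dim _).
  apply/vspaceP=> x; apply/memv_imgP/memv_imgP=> [[_ /memv_imgP[y _ ->] ->]|[y yN ->]].
    by exists (vsval y); rewrite ?subvsP // inclE act_submodE.
  exists (act (nabla e I s j) f (vsproj N y)); first by rewrite memv_img ?memvf.
  by rewrite inclE act_submodE vsprojK.
move=> x; split=> [/memv_imgP[y yN ->]|[xf xJ]].
  split=> [|a aJ]; first by rewrite -actMx ff.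
  by rewrite -actMx; move/nabla_subP: yN; apply; rewrite two_sidedl.
by apply/memv_imgP; exists x => //; apply/nabla_subP.
Qed.

Lemma dim_nabla s j : \dim {:nabla e I s j} =
  dim_mod (trace_ideal (above s j)) (fullv * <[e j]>).
Proof.
have := @edim_nabla s j 1 (mul1r _); rewrite prod1v => <-.
rewrite /edim; congr (\dim _); symmetry; apply/limg_fullP=> x.
by exists x; rewrite act1x.
Qed.

End Nabla.
End Algebra.

(** * Dimensions modulo an ideal *)

(* [lia] does not identify convertible dimensions taken in [A] and in [regular A];
   they are abstracted first. *)
Ltac dlia :=
  repeat match goal with |- context [@dimv ?K ?V ?X] =>
    let d := fresh "d" in move: (@dimv K V X) => d end; lia.

Section DimMod.
Variables (K : fieldType) (A : falgType K).
Implicit Types (J X Y : {vspace A}) (f : A).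

Lemma addvACA (U V W Z : {vspace A}) : (U + V + (W + Z) = U + W + (V + Z))%VS.
Proof. by rewrite -!addvA (addvA V) (addvC V) !addvA. Qed.

Lemma dim_mod_sub J X Y : (X <= Y + J)%VS -> (dim_mod J X <= dim_mod J Y)%N.
Proof. by move=> XY; rewrite leq_sub2r // dimvS // subv_add XY addvSr. Qed.

Lemma dim_mod_add J X Y : (dim_mod J (X + Y) <= dim_mod J X + dim_mod J Y)%N.
Proof.
have := dim_modE J (X + Y); have := dim_modE J X; have := dim_modE J Y.
have := dimv_sum_cap (X + J) (Y + J).
have : (\dim J <= \dim ((X + J) :&: (Y + J)))%N by rewrite dimvS // subv_cap !addvSr.
have -> : (X + J + (Y + J) = X + Y + J)%VS by rewrite addvACA addvv.
lia.
Qed.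

Lemma dim_mod_gt0 J X x : x \in X -> x \notin J -> (0 < dim_mod J X)%N.
Proof.
move=> xX xJ; rewrite lt0n; apply: contra xJ => /eqP d0.
have := dim_mod_cap J X; rewrite d0 add0n => dE.
have /eqP XE : (X :&: J == X)%VS by rewrite eqEdim capvSl dE /=.
by move: xX; rewrite -XE memv_cap => /andP[].
Qed.

Lemma dim_mod_eq0 J X : dim_mod J X = 0%N -> (X <= J)%VS.
Proof.
move=> d0; apply/subvP=> x xX; apply: contraT => xJ.
by have := dim_mod_gt0 xX xJ; rewrite d0.
Qed.

Lemma dim_mod_tower J J' X : (J <= J')%VS ->
  dim_mod J X = (dim_mod J' X + dim_mod J (X :&: J'))%N.
Proof.
move=> JJ; have := dim_mod_cap J X; have := dim_mod_cap J' X.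
have := dim_mod_cap J (X :&: J').
have -> : (X :&: J' :&: J = X :&: J)%VS by rewrite -capvA (capv_idPr JJ).
lia.
Qed.

(** Replacing [X] and [Y] by complements of their intersections with [J] changes the product only by
    elements of [J], since [J] is two-sided. *)
Lemma dim_mod_mul J X Y : two_sided J ->
  (dim_mod J (X * Y) <= dim_mod J X * dim_mod J Y)%N.
Proof.
move=> tJ.
have dE Z : \dim (Z :\: J) = dim_mod J Z.
  by have := dimv_cap_compl Z J; have := dim_mod_cap J Z; lia.
rewrite -(dE X) -(dE Y); apply: leq_trans (dim_prodv _ _).
apply: (@leq_trans (dim_mod J ((X :\: J) * (Y :\: J)))).
  apply: dim_mod_sub; apply/prodvP=> x y.
  rewrite -{1}(addv_diff_cap X J) -{1}(addv_diff_cap Y J).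
  move=> /memv_addP[x1 x1P [x2]]; rewrite memv_cap => /andP[_ x2J] ->.
  move=> /memv_addP[y1 y1P [y2]]; rewrite memv_cap => /andP[_ y2J] ->.
  rewrite mulrDl mulrDr -addrA memv_add //; first exact: memv_mul.
  by apply: memvD; [apply: two_sidedl | apply: two_sidedr].
rewrite -(dim_mod_cap J ((X :\: J) * (Y :\: J))); exact: leq_addr.
Qed.

(** Peirce decomposition modulo [J]: left multiplication by [f] fixes the first summand and kills
    the second, so the two meet only in [J]. *)
Lemma dim_mod_splitl J X f : f * f = f -> two_sided J -> (<[f]> * X <= X)%VS ->
  (dim_mod J (<[f]> * X) + dim_mod J (<[1 - f]> * X) <= dim_mod J X)%N.
Proof.
move=> ff tJ fX.
have fX' : (<[1 - f]> * X <= X)%VS.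
  apply/subvP=> _ /line_prodE[x xX ->]; rewrite mulrBl mul1r memvB //.
  by apply: (subvP fX); apply/line_prodE; exists x.
set X1 := (<[f]> * X)%VS in fX *; set X2 := (_ * X)%VS in fX' *.
have : (\dim ((X1 + J) :&: (X2 + J)) <= \dim J)%N.
  rewrite dimvS //; apply/subvP=> v; rewrite memv_cap => /andP[].
  move=> /memv_addP[_ /line_prodE[x xX ->] [q qJ vE]].
  move=> /memv_addP[_ /line_prodE[y yX ->] [q' qJ' vE']].
  have fv : f * v \in J.
    by rewrite vE' mulrDr mulrA mulrBr mulr1 ff subrr mul0r add0r (two_sidedl _ tJ).
  have fx : f * x = f * v - f * q by rewrite vE mulrDr mulrA ff addrK.
  by rewrite vE fx memvD // memvB // (two_sidedl _ tJ).
have : (\dim (X1 + J + (X2 + J)) <= \dim (X + J))%N.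
  by rewrite dimvS // addvACA addvv addvS // subv_add fX fX'.
have := dimv_sum_cap (X1 + J) (X2 + J).
have := dim_modE J X1; have := dim_modE J X2; have := dim_modE J X; dlia.
Qed.

Lemma dim_mod_splitr J X f : f * f = f -> two_sided J -> (X * <[f]> <= X)%VS ->
  (dim_mod J (X * <[f]>) + dim_mod J (X * <[1 - f]>) <= dim_mod J X)%N.
Proof.
move=> ff tJ fX.
have fX' : (X * <[1 - f]> <= X)%VS.
  apply/subvP=> _ /prod_lineE[x xX ->]; rewrite mulrBr mulr1 memvB //.
  by apply: (subvP fX); apply/prod_lineE; exists x.
set X1 := (X * <[f]>)%VS in fX *; set X2 := (X * _)%VS in fX' *.
have : (\dim ((X1 + J) :&: (X2 + J)) <= \dim J)%N.
  rewrite dimvS //; apply/subvP=> v; rewrite memv_cap => /andP[].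
  move=> /memv_addP[_ /prod_lineE[x xX ->] [q qJ vE]].
  move=> /memv_addP[_ /prod_lineE[y yX ->] [q' qJ' vE']].
  have fv : v * f \in J.
    by rewrite vE' mulrDl -mulrA mulrBl mul1r ff subrr mulr0 add0r (two_sidedr _ tJ).
  have fx : x * f = v * f - q * f by rewrite vE mulrDl -mulrA ff addrK.
  by rewrite vE fx memvD // memvB // (two_sidedr _ tJ).
have : (\dim (X1 + J + (X2 + J)) <= \dim (X + J))%N.
  by rewrite dimvS // addvACA addvv addvS // subv_add fX fX'.
have := dimv_sum_cap (X1 + J) (X2 + J).
have := dim_modE J X1; have := dim_modE J X2; have := dim_modE J X; dlia.
Qed.

Lemma addv_split_line f : (<[f]> + <[1 - f]> = <[f]> + 1 :> {vspace A})%VS.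
Proof.
apply/eqP; rewrite eqEsubv !subv_add !addvSl -!memvE /=; apply/andP; split.
  by rewrite addrC memv_add ?memvN ?memv_line.
by rewrite -[X in X \in _](subrK f) addrC memv_add ?memv_line.
Qed.

(** The bound [dim_mod_mul] holds for the two Peirce parts of [X] separately. If the sum of the two
    bounds is attained, each of them is attained. *)
Lemma dim_mod_mul_eql J X Y f : f * f = f -> two_sided J -> (<[f]> * X <= X)%VS ->
  dim_mod J (X * Y) = (dim_mod J X * dim_mod J Y)%N ->
  dim_mod J (<[f]> * X * Y) = (dim_mod J (<[f]> * X) * dim_mod J Y)%N.
Proof.
move=> ff tJ fX E.
have := dim_mod_splitl ff tJ fX.
have := dim_mod_mul (<[f]> * X) Y tJ; have := dim_mod_mul (<[1 - f]> * X) Y tJ.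
have : (dim_mod J (X * Y) <=
    dim_mod J (<[f]> * X * Y) + dim_mod J (<[1 - f]> * X * Y))%N.
  apply: leq_trans (dim_mod_add _ _ _); apply: dim_mod_sub.
  rewrite -!prodvDl addv_split_line prodvDl prod1v prodvDl.
  by rewrite -addvA (subv_trans (addvSl _ J)) ?addvSr.
rewrite E; set x := dim_mod J X; set y := dim_mod J Y; set x1 := dim_mod J (_ * X).
set x2 := dim_mod J (_ * X); set z1 := dim_mod J _; set z2 := dim_mod J _.
move=> h1 h2 h3 h4; apply/eqP; rewrite eqn_leq h3 /=.
have := leq_mul h4 (leqnn y); rewrite mulnDl; lia.
Qed.

Lemma dim_mod_mul_eqr J X Y f : f * f = f -> two_sided J -> (Y * <[f]> <= Y)%VS ->
  dim_mod J (X * Y) = (dim_mod J X * dim_mod J Y)%N ->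
  dim_mod J (X * (Y * <[f]>)) = (dim_mod J X * dim_mod J (Y * <[f]>))%N.
Proof.
move=> ff tJ fY E.
have := dim_mod_splitr ff tJ fY.
have := dim_mod_mul X (Y * <[f]>) tJ; have := dim_mod_mul X (Y * <[1 - f]>) tJ.
have : (dim_mod J (X * Y) <=
    dim_mod J (X * (Y * <[f]>)) + dim_mod J (X * (Y * <[1 - f]>)))%N.
  apply: leq_trans (dim_mod_add _ _ _); apply: dim_mod_sub.
  rewrite -!prodvDr addv_split_line prodvDr prodv1 prodvDr.
  by rewrite -addvA (subv_trans (addvSl _ J)) ?addvSr.
rewrite E; set x := dim_mod J X; set y := dim_mod J Y.
set x1 := dim_mod J (Y * _); set x2 := dim_mod J (Y * _).
set z1 := dim_mod J _; set z2 := dim_mod J _.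
move=> h1 h2 h3 h4; apply/eqP; rewrite eqn_leq h3 /=.
have := leq_mul (leqnn x) h4; rewrite mulnDr; lia.
Qed.

Lemma two_sided_stable J : two_sided J -> @act_stable _ _ (regular A) J.
Proof. by move=> tJ a x xJ; rewrite act_regularE two_sidedr. Qed.

End DimMod.

(** * Filtrations of ideals *)

Section Filtrations.
Variables (K : fieldType) (A : falgType K).
Implicit Types M N X Y : rmod A.

Section Postcompose.
Variables (U V W : vectType K) (i : 'Hom(V, W)).

Definition postcompose_fun (f : 'Hom(U, V)) : 'Hom(U, W) := (i \o f)%VF.
Fact postcompose_fun_linear : linear postcompose_fun.
Proof. by move=> c f g; rewrite /postcompose_fun comp_lfunDr comp_lfunZr. Qed.
HB.instance Definition _ := GRing.isSemilinear.Build K 'Hom(U, V) 'Hom(U, W) _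
  postcompose_fun (GRing.semilinear_linear postcompose_fun_linear).
Definition postcompose : 'Hom('Hom(U, V), 'Hom(U, W)) := linfun postcompose_fun.

Lemma postcomposeE f : postcompose f = (i \o f)%VF.
Proof. exact: lfunE. Qed.

Lemma postcompose_inj : lker i = 0%VS -> lker postcompose = 0%VS.
Proof.
move=> i0; apply/lker0_inj=> f; rewrite postcomposeE => if0; apply/lfunP=> y.
move/lker0_inj: i0 => /(_ (f y)); rewrite -comp_lfunE if0 !zero_lfunE.
exact.
Qed.

End Postcompose.

Lemma hom_dim_sub_le M N X (i : 'Hom(N, X)) : i \in homA N X -> lker i = 0%VS ->
  (hom_dim M N <= hom_dim M X)%N.
Proof.
move=> iA i0; rewrite /hom_dim -(dim_inj_img (homA M N) (postcompose_inj M i0)).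
apply: dimvS; apply/subvP=> _ /memv_imgP[f fA ->].
by rewrite postcomposeE comp_homA.
Qed.

Lemma hom_dim_corestrict M X (U : submodule X) :
  (forall f x, f \in homA M X -> f x \in (U : {vspace X})) ->
  hom_dim M (submod U) = hom_dim M X.
Proof.
move=> MU; apply/eqP; rewrite eqn_leq.
rewrite (hom_dim_sub_le _ (incl_homA U) (incl_ker U)) /=.
rewrite /hom_dim -(dim_inj_img (homA M (submod U)) (postcompose_inj M (incl_ker U))).
apply: dimvS; apply/subvP=> f fA; apply/memv_imgP.
have [g gA gE] := hom_corestrict fA (fun x => MU f x fA).
by exists g => //; rewrite postcomposeE; apply/lfunP=> x; rewrite comp_lfunE inclE gE.
Qed.

Lemma hom_dim_subquo M (U V : submodule M) X : (V <= U)%VS ->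
  (hom_dim (submod U) X <= hom_dim (subquo U V) X + hom_dim (submod V) X)%N.
Proof.
move=> VU; rewrite -(hom_dim_iso X (sub_in_iso VU)).
apply: (@hom_dim_exact _ _ (submod (sub_in U V)) (submod U) (subquo U V)
  (incl (sub_in U V)) (quo_proj (sub_in U V))).
- exact: incl_homA.
- exact: quo_homA.
- exact: quo_onto.
- by rewrite incl_img ker_quo_proj.
Qed.

(** The quotient of [U] by [V] is generated by the class of [x], so it is an image of [X]; equal
    dimensions leave no kernel. *)
Lemma subquo_cyclic M (U V : submodule M) (x : M) X f J (r : 'Hom(regular A, X)) :
  cyclic_pres f J r -> (V <= U)%VS -> act M f x = x ->
  (forall a, a \in J -> act M a x \in (V : {vspace M})) ->
  U = (V + limg (orbit_map x))%VS :> {vspace M} ->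
  (\dim U <= \dim V + \dim {:X})%N /\
  ((\dim V + \dim {:X} <= \dim U)%N -> isomorphic (subquo U V) X).
Proof.
move=> [rA r1 r0] VU xf xJ UE.
have [||g gA gE] := @hom_corestrict _ _ (regular A) M U (orbit_map x).
- exact: orbit_map_homA.
- by move=> a; rewrite UE (subvP (addvSr _ _)) // memv_img ?memvf.
pose q := (subquo_proj U V \o g)%VF.
have qA : q \in homA (regular A) (subquo U V) := comp_homA (quo_homA _) gA.
have q1 : limg q = fullv.
  apply/limg_fullP=> y; have := subvsP (vsval y); rewrite {2}UE.
  move=> /memv_addP[v vV [_ /memv_imgP[a _ ->] yE]]; exists a.
  rewrite comp_lfunE -[LHS]quo_projK; apply/eqP; rewrite -subr_eq0 -linearB.
  by rewrite quo_proj_eq0 mem_sub_in linearB /= gE yE addrK.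
have kq : (lker r <= lker q)%VS.
  apply/subvP=> a; rewrite !memv_ker comp_lfunE => /eqP/r0 /xJ.
  rewrite actMx xf -orbit_mapE -gE => aV; apply/eqP.
  exact/subquo_proj0.
have [h hA hE] := homA_factor rA qA r1 kq.
have h1 : limg h = fullv.
  apply/limg_fullP=> y; have /limg_fullP/(_ y)[a ->] := q1.
  by exists (r a); rewrite hE.
have d1 := dim_ker_onto h1; have d2 := subquo_dim VU.
split=> [|le]; first by lia.
apply: iso_sym; exists h; split=> //; apply/eqP; rewrite -dimv_eq0; lia.
Qed.

(** The chain starts at a submodule of a fixed ambient module, so that layers can be put on top one
    at a time. *)
Definition sub_filtration (T : Type) (D : T -> rmod A) M (V : submodule M) : Prop :=
  exists m (F : nat -> submodule M), [/\ F 0%N = V :> {vspace M},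
    F m = 0%VS :> {vspace M}, forall k, (k < m)%N -> (F k.+1 <= F k)%VS &
    forall k, (k < m)%N -> exists j, isomorphic (subquo (F k) (F k.+1)) (D j)].

Lemma subquo_ext M (U U' V V' : submodule M) : U = U' :> {vspace M} ->
  V = V' :> {vspace M} -> (V <= U)%VS -> isomorphic (subquo U V) (subquo U' V').
Proof.
move=> UU VV VU.
have [|g gA gE] := hom_corestrict (U := U') (incl_homA U).
  by move=> x; rewrite inclE -UU subvsP.
have g1 : limg g = fullv.
  apply/limg_fullP=> y; exists (vsproj U (vsval y)); apply: subvs_inj.
  by rewrite gE inclE vsprojK // UU subvsP.
have pA : (subquo_proj U' V' \o g)%VF \in homA (submod U) (subquo U' V').
  exact: comp_homA (quo_homA _) gA.
apply: (iso_of_surj (quo_homA (sub_in U V)) pA (quo_onto _)).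
  by rewrite limg_comp g1 quo_onto.
apply/vspaceP=> x; rewrite ker_quo_proj mem_sub_in memv_ker comp_lfunE.
apply/idP/eqP=> [xV|/subquo_proj0]; last by rewrite gE inclE -VV.
by apply/subquo_proj0; rewrite gE inclE -VV.
Qed.

Lemma sub_filtration_cons (T : Type) (D : T -> rmod A) M (U V : submodule M) j :
  (V <= U)%VS -> isomorphic (subquo U V) (D j) -> sub_filtration D V ->
  sub_filtration D U.
Proof.
move=> VU iso [m [F [F0 Fm Fle Fs]]].
exists m.+1, (fun k => if k is k'.+1 then F k' else U); split=> //.
  by case=> [|k] /= km; [rewrite F0 | apply: Fle].
case=> [|k] /= km; last exact: Fs.
exists j; apply: iso_trans iso; apply: subquo_ext => //.
by rewrite F0.
Qed.

Lemma sub_filtration_ext (T : Type) (D : T -> rmod A) M (U V : submodule M) :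
  U = V :> {vspace M} -> sub_filtration D U -> sub_filtration D V.
Proof. by move=> UV [m [F [F0 Fm Fle Fs]]]; exists m, F; split; rewrite -?UV. Qed.

Section Block.
Variables (f : A) (J : submodule (regular A)) (X : rmod A) (r : 'Hom(regular A, X)).
Hypotheses (ff : f * f = f) (tJ : two_sided J) (rP : cyclic_pres f J r).

(** Each element of [xs] enlarges the submodule by an image of [X]. When the total dimension reaches
    the bound, no layer can be smaller than [X], so all layers are copies of [X]. *)
Lemma block_filtration (xs : seq A) : all (fun x => x * f == x) xs ->
  exists U : submodule (regular A), U = (J + <<xs>> * fullv)%VS :> {vspace A} /\
  (\dim U <= \dim J + size xs * \dim {:X})%N /\
  ((\dim J + size xs * \dim {:X} <= \dim U)%N ->
    (forall (T : Type) (D : T -> rmod A) j, isomorphic X (D j) -> sub_filtration D J ->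
       sub_filtration D U) /\
    forall b, b * b = b ->
      edim (submod U) b = (edim (submod J) b + size xs * edim X b)%N).
Proof.
elim: xs => [_|x xs IH /= /andP[/eqP xf /IH[V [VE [dV VP]]]]].
  exists J; rewrite span_nil prod0v addv0 /= mul0n addn0; split=> //; split=> // _.
  by split=> // b _; rewrite mul0n addn0.
have orbE : limg (orbit_map (x : regular A)) = (<[x]> * fullv)%VS.
  apply/vspaceP=> y; apply/memv_imgP/idP=> [[a _ ->]|/line_prodE[a _ ->]].
    by rewrite orbit_mapE act_regularE; apply/line_prodE; exists a; rewrite ?memvf.
  by exists a; rewrite ?memvf // orbit_mapE act_regularE.
pose O := Submodule (@img_submodule _ _ _ _ (orbit_map (x : regular A))
  (full_sub _) (orbit_map_homA _)).
have [U UE] := add_sub_exists V O; exists U; rewrite /= orbE in UE.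
have UE' : U = (J + <<x :: xs>> * fullv)%VS :> {vspace A}.
  by rewrite UE VE span_cons prodvDl -addvA; congr (_ + _)%VS; exact: addvC.
have VU : (V <= U)%VS by rewrite UE addvSl.
have [||| dU isoU] := @subquo_cyclic (regular A) U V x _ _ _ _ rP VU.
- by rewrite act_regularE.
- move=> a aJ; rewrite act_regularE VE; apply: (subvP (addvSl _ _)).
  exact: two_sidedl.
- by rewrite orbE.
split=> //; split; first by rewrite mulSn; move: dU dV; dlia.
rewrite mulSn => dU'; have [|VF Ve] := VP; first by move: dU dU'; dlia.
have iso : isomorphic (subquo U V) X by apply: isoU; move: dV dU'; dlia.
split=> [T D j isoD FJ|b bb].
  apply: (sub_filtration_cons VU (iso_trans iso isoD)); exact: VF isoD FJ.
by rewrite (edim_subquo bb VU) (edim_iso _ iso) Ve // mulSn; lia.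
Qed.

End Block.
End Filtrations.

(** * The numerical criterion for quasi-heredity *)

Section Count.
Variables (K : fieldType) (A : falgType K) (n : nat) (e : 'I_n -> A).
Variable (I : 'I_n -> rmod A).
Hypothesis closedK : alg_closed K.
Hypothesis he : indexed_primitive_idempotents e.
Hypothesis hI : forall j, injective_envelope (Smod e j) (I j).
Variable (s : 'S_n).

Local Notation D := (Delta e s).
Local Notation N := (nabla e I s).
Local Notation L j := (fullv * <[e j]>)%VS.
Local Notation R j := (<[e j]> * fullv)%VS.
Local Notation J j := (trace_ideal e (above s j)).

(** The heredity chain, falling from [A] at 0 to zero at [n]. The ideal [J j] is convertible to its
    term at [(s j).+1]. *)
Definition heredity_ideal (t : nat) : {vspace A} := trace_ideal e (fun k => t <= s k)%N.
Local Notation H := heredity_ideal.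

Lemma dim_Delta j : \dim {:D j} = dim_mod (J j) (R j).
Proof. by have [r rP] := Delta_pres closedK he s j; rewrite (dim_cyc rP). Qed.

Lemma edim_Delta j b : edim (D j) b = dim_mod (J j) (<[e j]> * (fullv * <[b]>)).
Proof. by have [r rP] := Delta_pres closedK he s j; rewrite (edim_cyc rP). Qed.

(** The [e k] need not sum to 1. Instead, on a nonzero quotient of [A] by this ideal some [e k]
    would act nontrivially, whereas all products [x * e k] lie in the ideal. *)
Lemma heredity_ideal0 : H 0 = fullv.
Proof.
have tH : two_sided (H 0) := @trace_ideal_two_sided _ _ _ _ he _.
pose W : submodule (regular A) := Submodule (two_sided_stable tH).
have [Q0|Q0] := pselect ({:quomod W}%VS = 0%VS).
  apply/vspaceP=> x; rewrite memvf.
  have : quo_proj W x == 0 by apply/eqP; move/fullv0P: Q0; apply.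
  by rewrite quo_proj_eq0.
have [k [x]] := exists_e_neq0 he Q0; rewrite -[x]quo_projK quo_actE => /negP[].
rewrite quo_proj_eq0 act_regularE -[_ * e k]mulr1.
exact: trace_ideal_mem.
Qed.

Lemma heredity_idealn : H n = 0%VS.
Proof.
by rewrite /H /trace_ideal big_pred0 // => k; rewrite leqNgt ltn_ord.
Qed.

Lemma perm_nat_eq j k : (s j == s k :> nat) = (k == j).
Proof. by rewrite (inj_eq (@ord_inj n)) (inj_eq perm_inj) eq_sym. Qed.

Lemma heredity_ideal_step j : H (s j) = (H (s j).+1 + L j * R j)%VS.
Proof.
rewrite addvC /H /trace_ideal (bigD1 j) ?leqnn //=; congr (_ + _)%VS.
apply: eq_bigl => k; rewrite ltn_neqAle [RHS]andbC; congr andb.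
by rewrite perm_nat_eq.
Qed.

Lemma dim_heredity_step j :
  (\dim (H (s j)) <= \dim (J j) + \dim {:D j} * \dim {:N j})%N.
Proof.
have tJ : two_sided (J j) := @trace_ideal_two_sided _ _ _ _ he _.
rewrite heredity_ideal_step dim_Delta (dim_nabla closedK he hI) mulnC.
rewrite addvC -(dim_modE (J j)) addnC leq_add2l; exact: dim_mod_mul.
Qed.

Definition weight j := (\dim {:D j} * \dim {:N j})%N.

Lemma weight_sum_step j :
  (\sum_(k | (s j <= s k)%N) weight k =
   weight j + \sum_(k | (s j < s k)%N) weight k)%N.
Proof.
rewrite (bigD1 j) ?leqnn //=; congr addn; apply: eq_bigl => k.
rewrite ltn_neqAle andbC; congr andb.
by rewrite perm_nat_eq.
Qed.

(** Call the sum of the weights over [t <= s k] minus [\dim (H t)] the defect at [t]; the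
    inequality, free of truncated subtraction, says that it does not increase with [t]. It is 0 at
    [n], so if it is also 0 at 0 it vanishes throughout. *)
Lemma defect_mono t : (t < n)%N ->
  (\dim (H t) + \sum_(k | (t < s k)%N) weight k <=
   \dim (H t.+1) + \sum_(k | (t <= s k)%N) weight k)%N.
Proof.
move=> tn; have [j sj] : exists j, s j = t :> nat.
  by exists (s^-1%g (Ordinal tn)); rewrite permKV.
have := dim_heredity_step j; have := weight_sum_step j.
rewrite -/(weight j) sj; move=> ->.
change (trace_ideal e (above s j)) with (H (s j).+1); rewrite sj => h.
by rewrite addnA leq_add2r.
Qed.

Lemma defect_mono_leq t u : (t <= u)%N -> (u <= n)%N ->
  (\dim (H t) + \sum_(k | (u <= s k)%N) weight k <=
   \dim (H u) + \sum_(k | (t <= s k)%N) weight k)%N.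
Proof.
elim: u => [|u IH]; first by rewrite leqn0 => /eqP->.
rewrite leq_eqVlt => /predU1P[->//|tu] un.
have := IH tu (ltnW un); have := defect_mono un; lia.
Qed.

Lemma dim_le_weight : (\dim {:A} <= \sum_j weight j)%N.
Proof.
have := defect_mono_leq (leq0n n) (leqnn n); rewrite heredity_ideal0 heredity_idealn.
rewrite dimv0 add0n big_pred0 ?addn0 // => k.
by rewrite leqNgt ltn_ord.
Qed.

Lemma heredity_equality : \dim {:A} = (\sum_j weight j)%N -> forall t, (t <= n)%N ->
  \dim (H t) = (\sum_(k | (t <= s k)%N) weight k)%N.
Proof.
move=> E t tn.
have := defect_mono_leq tn (leqnn n); have := defect_mono_leq (leq0n t) tn.
rewrite heredity_ideal0 heredity_idealn dimv0 add0n E /=.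
rewrite (_ : (\sum_(k | (n <= s k)%N) weight k = 0)%N).
  rewrite addn0 addnC leq_add2r => h1 h2; apply/eqP.
  by rewrite eqn_leq h1 h2.
by rewrite big_pred0 // => k; rewrite leqNgt ltn_ord.
Qed.

Lemma heredity_equality_step j : \dim {:A} = (\sum_j weight j)%N ->
  \dim (H (s j)) = (\dim (J j) + \dim {:D j} * \dim {:N j})%N.
Proof.
move=> E; rewrite (heredity_equality E) ?weight_sum_step; last exact: ltnW.
have -> : \dim (J j) = (\sum_(k | (s j < s k)%N) weight k)%N.
  exact: (heredity_equality E (ltn_ord (s j))).
by rewrite addnC.
Qed.

Lemma heredity_mul_equality j : \dim {:A} = (\sum_j weight j)%N ->
  dim_mod (J j) (L j * R j) = (dim_mod (J j) (L j) * dim_mod (J j) (R j))%N.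
Proof.
move=> /(heredity_equality_step j); rewrite heredity_ideal_step addvC.
rewrite -(dim_modE (J j)) dim_Delta (dim_nabla closedK he hI) mulnC addnC.
by move/addnI.
Qed.

Lemma e_mod_gt0 j : (0 < dim_mod (J j) (L j))%N /\ (0 < dim_mod (J j) (R j))%N.
Proof.
have ej : e j \notin J j by apply: e_notin_trace_ideal => //; rewrite /above ltnn.
by split; apply: dim_mod_gt0 ej; [apply/prod_lineE | apply/line_prodE];
  exists 1; rewrite ?memvf ?mul1r ?mulr1.
Qed.

(** Three cases. For [k = j] the bound is $[\Delta(j):S(j)]$. If [s k < s j], then [e j] kills
    [D k], so even maps to [I j] vanish. If [s j < s k], then [e k] kills [N j] but fixes the
    generator of [D k]. *)
Lemma hom_Delta_nabla j k : edim (D j) (e j) = 1%N ->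
  (hom_dim (D k) (N j) <= (k == j))%N.
Proof.
move=> Dj; have [r rP] := Delta_pres closedK he s k.
have ek := e_idem he k.
have incl_le : (hom_dim (D k) (N j) <= edim (D k) (e j))%N.
  rewrite -(hom_dim_env closedK he (hI j)).
  exact: hom_dim_sub_le (incl_homA _) (incl_ker _).
have [ekj|nkj] := eqVneq k j; first by rewrite (leq_trans incl_le) // ekj Dj.
have : s k != s j by rewrite (inj_eq perm_inj).
rewrite -(inj_eq (@ord_inj n)) neq_ltn => /orP[lt|lt].
  rewrite (leq_trans incl_le) // leqn0; apply/eqP/edim0P=> x.
  have [_ /limg_fullP/(_ x)[a ->] r0] := rP.
  rewrite (cyc_act rP); apply/r0; rewrite mulrA -[_ * e j]mulr1.
  exact: trace_ideal_mem.
rewrite leqn0; apply/eqP/hom_dim0P=> f /homAP fA; apply/lfunP=> x.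
have [_ /limg_fullP/(_ x)[a ->] r0] := rP.
rewrite -(cyc_mull ek rP) -(cyc_act rP) fA.
suff -> : f (r (e k)) = 0 by rewrite linear0 zero_lfunE.
rewrite -[e k]mul1r -(cyc_act rP) fA; apply: subvs_inj.
rewrite act_submodE linear0.
have /(nabla_subP closedK he) := subvsP (f (r 1)); apply.
by rewrite -[e k]mulr1 -[e k]mul1r trace_ideal_mem.
Qed.

Lemma hom_regular M : hom_dim (regular A) M = \dim {:M}.
Proof.
have rP : cyclic_pres 1 0%VS (\1%VF : 'Hom(regular A, regular A)).
  split; [exact: homA_id | | ].
    by apply/limg_fullP=> x; exists x; rewrite id_lfunE.
  move=> a; rewrite id_lfunE mul1r memv0; split=> [->|/eqP//]; exact: eqxx.
have t0 : two_sided (0%VS : {vspace A}).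
  by move=> a b x; rewrite !memv0 => /eqP->; rewrite mulr0 mul0r eqxx.
apply: (hom_dim_cyc (mul1r 1) t0 rP) => x; rewrite memvf; split=> // _.
split=> [|a]; first exact: act1x.
by rewrite memv0 => /eqP->; rewrite act0l.
Qed.

Definition heredity_sub (t : nat) : submodule (regular A) :=
  Submodule (two_sided_stable (@trace_ideal_two_sided _ _ _ _ he (fun k => t <= s k)%N)).

Lemma heredity_filtration j : \dim {:A} = (\sum_j weight j)%N ->
  (sub_filtration D (heredity_sub (s j).+1) -> sub_filtration D (heredity_sub (s j))) /\
  edim (D j) (e j) = 1%N.
Proof.
move=> E; have ej := e_idem he j.
have tJ : two_sided (J j) := @trace_ideal_two_sided _ _ _ _ he _.
have [r rP] := Delta_pres closedK he s j.
pose W := heredity_sub (s j).+1.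
(* A basis of [L j] modulo [J j], each element of which generates one layer. *)
pose xs := vbasis (L j :\: J j).
have spanxs : <<xs>>%VS = (L j :\: J j)%VS := span_basis (vbasisP _).
have dNE : \dim (L j :\: J j) = \dim {:N j}.
  rewrite (dim_nabla closedK he hI).
  by have := dimv_cap_compl (L j) (J j); have := dim_mod_cap (J j) (L j); dlia.
have dxs : size xs = \dim {:N j} by rewrite size_tuple.
have xsP : all (fun x => x * e j == x) xs.
  apply/allP=> x /vbasis_mem; move/(subvP (diffvSl _ _)) => /prod_lineE[y _ ->].
  by rewrite -mulrA ej.
have [U [UE [_ UP]]] := @block_filtration _ _ _ W _ r tJ rP xs xsP.
have UH : U = H (s j) :> {vspace A}.
  rewrite UE heredity_ideal_step spanxs; apply/eqP; rewrite eqEsubv !subv_add !addvSl /=.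
  apply/andP; split; apply/prodvP=> x y.
    move/(subvP (diffvSl _ _)) => /prod_lineE[z _ ->] _.
    apply: (subvP (addvSr _ _)); rewrite -{1}ej mulrA -mulrA.
    by rewrite memv_mul //; [apply/prod_lineE; exists z | apply/line_prodE; exists y];
      rewrite ?memvf.
  rewrite -{1}(addv_diff_cap (L j) (J j)) => /memv_addP[x1 x1P [x2]].
  rewrite memv_cap => /andP[_ x2J] -> _; rewrite mulrDl addrC memv_add //.
    exact: two_sidedr.
  by rewrite memv_mul ?memvf.
have [|UF Ue] := UP.
  by rewrite UH dxs (heredity_equality_step j E) mulnC; apply: leqnn.
split=> [WF|].
  apply: sub_filtration_ext (UF _ _ _ (iso_refl _) WF).
  exact: UH.
have {Ue} := Ue _ ej; rewrite dxs.
have edimL (V : submodule (regular A)) : two_sided V ->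
    edim (submod V) (e j) = \dim (L j :&: V).
  move=> tV; rewrite /edim -(dim_inj_img _ (incl_ker V)); congr (\dim _).
  apply/vspaceP=> x; rewrite memv_cap.
  apply/memv_imgP/andP=> [[_ /memv_imgP[y _ ->] ->]|[/prod_lineE[y _ xE] xV]].
    rewrite inclE act_submodE act_regularE; split; last first.
      by apply: two_sidedr tV _; apply: subvsP.
    by apply/prod_lineE; exists (vsval y); rewrite ?memvf.
  exists (act (submod V) (e j) (vsproj V x)); first by rewrite memv_img ?memvf.
  by rewrite inclE act_submodE act_regularE vsprojK // xE -mulrA ej.
rewrite !edimL //; last by rewrite UH; apply: trace_ideal_two_sided.
have -> : (L j :&: U = L j)%VS.
  apply/capv_idPl/subvP=> x /prod_lineE[y _ ->]; rewrite UH -[_ * e j]mulr1.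
  by apply: trace_ideal_mem => //; apply: leqnn.
(* Modulo its part in [W], the space [L j] has dimension [size xs]; the layers give [size xs] times
   [edim (D j) (e j)]. As [xs] is not empty, the factor is 1. *)
have : (\dim (L j :\: J j) + \dim (L j :&: W) = \dim (L j))%N.
  by rewrite addnC dimv_cap_compl.
have := e_mod_gt0 j; rewrite -(dim_nabla closedK he hI) dNE => -[N0 _] <-.
rewrite addnC => /addnI/eqP; rewrite -{1}[\dim _]muln1 eqn_pmul2l //.
by move/eqP.
Qed.

(* Left to right, sum_j dim Delta(j) dim Hom(-, nabla(j)) is subadditive and at
   most the dimension on each Delta(k). *)
Theorem qh_count : quasi_hereditary e s <-> \dim {:A} = (\sum_j weight j)%N.
Proof.
split=> [[mult [m [F [[F0 Fm Fle] Fs]]]]|E]; last split.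
- have D1 j : edim (D j) (e j) = 1%N.
    by symmetry; apply/(multiplicityP closedK he).
  apply/eqP; rewrite eqn_leq dim_le_weight /=.
  pose Phi M := (\sum_j \dim {:D j} * hom_dim M (N j))%N.
  have PhiD k : (Phi (D k) <= \dim {:D k})%N.
    rewrite /Phi (bigD1 k) //= big1 ?addn0 => [|j jk].
      by rewrite -{2}[\dim _]muln1 leq_mul2l (leq_trans (hom_Delta_nabla k (D1 k))) ?eqxx ?orbT.
    by apply/eqP; have := hom_Delta_nabla k (D1 j); rewrite eq_sym (negbTE jk) leqn0 => /eqP->;
      rewrite muln0.
  have PhiF k : (k <= m)%N -> (Phi (submod (F (m - k)%N)) <= \dim (F (m - k)%N))%N.
    elim: k => [|k IH] km.
      rewrite subn0 Fm dimv0 leqn0 /Phi; apply/eqP/big1 => j _.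
      suff -> : hom_dim (submod (F m)) (N j) = 0%N by rewrite muln0.
      apply/hom_dim0P=> f _; apply/lfunP=> x.
      have -> : x = 0.
        by apply: subvs_inj; apply/eqP; have := subvsP x; rewrite {2}Fm memv0 linear0.
      by rewrite !linear0.
    have lt : (m - k.+1 < m)%N by lia.
    have eqk : (m - k = (m - k.+1).+1)%N by lia.
    have [i iso] := Fs _ lt; have VU := Fle _ lt.
    rewrite -(subquo_dim VU) (iso_dim iso).
    have := IH (ltnW km); rewrite eqk => IHk.
    apply: leq_trans (leq_add IHk (PhiD i)).
    rewrite /Phi -big_split /=; apply: leq_sum => j _.
    rewrite -mulnDr leq_mul2l -(hom_dim_iso _ iso) addnC hom_dim_subquo //.
    exact: orbT.
  (* On the regular module $\operatorname{Hom}(A, \nabla(j))$ is $\nabla(j)$, so [Phi] becomes the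
     sum of the weights. *)
  have := PhiF m (leqnn m); rewrite subnn F0; apply: leq_trans.
  rewrite /Phi; apply: leq_sum => j _; rewrite leq_mul2l; apply/orP; right.
  rewrite -hom_regular; apply: (hom_dim_surj _ (incl_homA _)).
  by rewrite incl_img F0.
- move=> j; apply/(multiplicityP closedK he).
  by have [_ ->] := heredity_filtration j E.
- suff [m [F [F0 Fm Fle Fs]]] : sub_filtration D (heredity_sub 0).
    by exists m, F; split=> //; split=> //; rewrite F0 /= -[RHS]heredity_ideal0.
  suff step t : (t <= n)%N -> sub_filtration D (heredity_sub (n - t)).
    by have := step n (leqnn n); rewrite subnn.
  elim: t => [_|t IH tn].
    exists 0%N, (fun _ => heredity_sub n); rewrite subn0; split=> //.
    exact: heredity_idealn.
  have lt : (n - t.+1 < n)%N by lia.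
  have [j sj] : exists j, s j = (n - t.+1)%N :> nat.
    by exists (s^-1%g (Ordinal lt)); rewrite permKV.
  have [+ _] := heredity_filtration j E; rewrite sj; apply.
  have -> : ((n - t.+1).+1 = n - t)%N by lia.
  by apply: IH; apply: ltnW.
Qed.
End Count.

(** * Extensions and powers *)

Section Powers.
Variables (K : fieldType) (A : falgType K).
Implicit Types M N X Y : rmod A.

Lemma dim_power M m : \dim {:direct_power M m} = (m * \dim {:M})%N.
Proof. by rewrite !dimvf /dim /= card_ord. Qed.

Lemma act_powerE M m a (y : direct_power M m) k :
  (act (direct_power M m) a y : {ffun 'I_m -> M}) k = act M a ((y : {ffun _ -> _}) k).
Proof. by rewrite /= lfunE ffunE. Qed.

Lemma homA_sum M N m (t : 'I_m -> 'Hom(M, N)) : (forall k, t k \in homA M N) ->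
  exists2 f, f \in homA (direct_power M m) N &
  forall y : {ffun 'I_m -> M}, f y = \sum_k t k (y k).
Proof.
move=> tA; pose F (y : {ffun 'I_m -> M}) : N := \sum_k t k (y k).
have lin : linear F.
  move=> c x y; rewrite /F scaler_sumr -big_split; apply: eq_bigr => k _ /=.
  by rewrite !ffunE linearP.
pose L : {linear {ffun 'I_m -> M} -> N} :=
  HB.pack F (GRing.isLinear.Build _ _ _ _ F lin).
exists (linfun L : 'Hom(direct_power M m, N)); last by move=> y; rewrite lfunE.
have LE (y : {ffun 'I_m -> M}) : linfun L y = \sum_k t k (y k) := lfunE L y.
apply/homAP=> a y; apply: etrans (LE _) _; symmetry.
apply: etrans (congr1 (act N a) (LE y)) _; rewrite linear_sum.
apply: eq_bigr => k _.
by rewrite act_powerE; move/homAP: (tA k) => ->.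
Qed.

Lemma homA_tuple M N m (t : 'I_m -> 'Hom(M, N)) : (forall k, t k \in homA M N) ->
  exists2 f, f \in homA M (direct_power N m) &
  forall x k, (f x : {ffun 'I_m -> N}) k = t k x.
Proof.
move=> tA; pose F (x : M) : {ffun 'I_m -> N} := [ffun k => t k x].
have lin : linear F.
  by move=> c x y; apply/ffunP=> k; rewrite !ffunE linearP.
pose L : {linear M -> {ffun 'I_m -> N}} :=
  HB.pack F (GRing.isLinear.Build _ _ _ _ F lin).
exists (linfun L : 'Hom(M, direct_power N m)); last first.
  by move=> x k; rewrite lfunE /= ffunE.
apply/homAP=> a x; apply/ffunP=> k; rewrite act_powerE !(lfunE L) /= !ffunE.
by move/homAP: (tA k) => ->.
Qed.

Lemma power_proj_homA M m (k : 'I_m) : exists2 f, f \in homA (direct_power M m) M &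
  forall y : {ffun 'I_m -> M}, f y = y k.
Proof.
have [|f fA fE] := @homA_sum M M m (fun l => if l == k then \1%VF else 0).
  by move=> l; case: ifP => _; [apply: homA_id | apply: mem0v].
exists f => // y; rewrite fE (bigD1 k) //= eqxx id_lfunE big1 ?addr0 // => l lk.
by rewrite (negbTE lk) zero_lfunE.
Qed.

(** A form of $\operatorname{Ext}^1(M, N) = 0$ that mentions no resolution: the pushout along [f] of
    the extension given by [p] splits. *)
Definition ext_vanish M N : Prop :=
  forall X (p : 'Hom(X, M)) (U : submodule X) (f : 'Hom(submod U, N)),
    p \in homA X M -> limg p = fullv -> U = lker p :> {vspace X} ->
    f \in homA (submod U) N ->
    exists2 g, g \in homA X N & forall u, g (vsval u) = f u.

Lemma free_lift M X (p : 'Hom(X, M)) : p \in homA X M -> limg p = fullv ->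
  exists2 g, g \in homA (free_on M) X & forall y, p (g y) = free_cover M y.
Proof.
move=> pA p1; pose x (k : 'I_(\dim {:M})) := p^-1%VF (vbasis {:M})`_k.
have px k : p (x k) = (vbasis {:M})`_k by rewrite limg_lfunVK // p1 memvf.
have [|g gA gE] := @homA_sum (regular A) X _ (fun k => orbit_map (x k)).
  by move=> k; apply: orbit_map_homA.
exists g => // y; rewrite gE lfunE /= /free_cover_fun linear_sum /=.
apply: eq_bigr => k _; rewrite orbit_mapE.
by move/homAP: pA => ->; rewrite px.
Qed.

(** By exactness cocycles are maps from the first syzygy to [N], and coboundaries are those that
    extend to the free cover. So the vanishing is extendability for one epimorphism, and lifting the
    free cover to [X] carries it over to every [p]. *)
Lemma ext1_dim0P M N : ext1_dim M N = 0%N <-> ext_vanish M N.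
Proof.
pose S := syzygy M; pose c := free_cover S.
have cA : c \in homA (free_on S) S := free_cover_homA S.
have c1 : limg c = fullv := free_cover_onto S.
have cocP f : f \in ext1_cocycles M N <->
    exists2 f', f' \in homA S N & forall y, f y = f' (c y).
  rewrite /ext1_cocycles memv_cap memv_ker precomposeE.
  split=> [/andP[fA /eqP fd]|[f' f'A fE]].
    have [|f' f'A f'E] := homA_factor cA fA c1.
      rewrite -resolution_exact0; apply/subvP=> _ /memv_imgP[y _ ->].
      by rewrite memv_ker -comp_lfunE fd zero_lfunE.
    by exists f' => // y; rewrite f'E.
  have -> : f = (f' \o c)%VF by apply/lfunP=> y; rewrite comp_lfunE fE.
  apply/andP; split; first exact: comp_homA f'A cA.
  apply/eqP/lfunP=> y; rewrite zero_lfunE !comp_lfunE.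
  have -> : c (incl (syzygy_sub S) (free_cover (syzygy S) y)) = 0.
    apply/eqP; rewrite -memv_ker -resolution_exact0.
    by rewrite -comp_lfunE memv_img ?memvf.
  exact: linear0.
have -> : (ext1_dim M N = 0%N <-> (ext1_cocycles M N <= ext1_coboundaries M N)%VS).
  have le := ext1_complex M N; rewrite /ext1_dim; split=> [/eqP|le'].
    by rewrite subn_eq0 => d; rewrite -(geq_leqif (dimv_leqif_sup le)).
  by apply/eqP; rewrite subn_eq0 dimvS.
split=> [le X p U f pA p1 UE fA|ext].
  have [g gA gE] := free_lift pA p1.
  have [||gS gSA gSE] := @hom_corestrict _ _ S X U (g \o incl (syzygy_sub M))%VF.
  - exact: comp_homA gA (incl_homA _).
  - move=> x; rewrite UE memv_ker !comp_lfunE gE inclE -memv_ker.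
    exact: subvsP.
  have /(subvP le)/memv_imgP[h hA hE] : (f \o gS \o c)%VF \in ext1_cocycles M N.
    by apply/cocP; exists (f \o gS)%VF; [apply: comp_homA | move=> y; rewrite comp_lfunE].
  have hS (x : S) : h (vsval x) = f (gS x).
    have /limg_fullP/(_ x)[y ->] := c1.
    have /lfunP/(_ y) := hE; rewrite precomposeE !comp_lfunE inclE.
    by move=> ->.
  pose sg : 'Hom(M, free_on M) := ((free_cover M)^-1)%VF.
  have sgK x : free_cover M (sg x) = x by rewrite limg_lfunVK // free_cover_onto memvf.
  pose fX := (f \o linfun (vsproj U))%VF.
  have fXE u (uU : u \in (U : {vspace X})) : fX u = f (vsproj U u).
    by rewrite comp_lfunE lfunE.
  have fXact u a : u \in (U : {vspace X}) -> fX (act X a u) = act N a (fX u).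
    move=> uU; rewrite !fXE ?sm_stable //; move/homAP: fA => <-.
    by congr (f _); apply: subvs_inj; rewrite act_submodE !vsprojK ?sm_stable.
  have fXS (y : free_on M) : y \in lker (free_cover M) -> fX (g y) = h y.
    move=> yS; rewrite -[y in RHS](vsprojK (U := syzygy_sub M)) // hS fXE.
      by congr (f _); apply: subvs_inj; rewrite gSE comp_lfunE inclE !vsprojK //
        UE memv_ker gE -memv_ker.
    by rewrite UE memv_ker gE -memv_ker.
  (* The section [sg] is only linear. It does no harm: [fX] after [g] agrees with [h] on the syzygy
     ([fXS]), so the value does not depend on the preimage chosen in the free module. *)
  pose ph := (fX \o (\1 - (g \o sg \o p)) + (h \o sg \o p))%VF.
  have phE x : ph x = fX (x - g (sg (p x))) + h (sg (p x)).
    by rewrite add_lfunE !comp_lfunE add_lfunE opp_lfunE !comp_lfunE id_lfunE.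
  have inU x : x - g (sg (p x)) \in (U : {vspace X}).
    by rewrite UE memv_ker linearB /= gE sgK subrr.
  exists ph.
    apply/homAP=> a x; rewrite !phE.
    have actD u v : act N a (u + v) = act N a u + act N a v by exact: linearD.
    rewrite actD.
    rewrite -(fXact _ a (inU x)).
    move/homAP: (hA) => <-; move/homAP: (pA) => ->.
    set y := sg (p x); set y' := sg _.
    have yS : act (free_on M) a y - y' \in lker (free_cover M).
      rewrite memv_ker linearB /= sgK; move/homAP: (free_cover_homA M) => ->.
      by rewrite sgK subrr.
    have -> : act X a x - g y' = act X a (x - g y) + g (act (free_on M) a y - y').
      rewrite !linearB /=; move/homAP: (gA) => ->.
      by rewrite addrA subrK.
    rewrite linearD /= (fXS _ yS) -addrA; congr (_ + _).
    by rewrite -linearD /= subrK.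
  move=> u; have pu : p (vsval u) = 0.
    by apply/eqP; rewrite -memv_ker -UE subvsP.
  have sg0 : sg 0 = 0 by exact: linear0.
  have [g0 h0] : g 0 = 0 /\ h 0 = 0 by split; exact: linear0.
  by rewrite phE pu sg0 g0 h0 subr0 addr0 (fXE _ (subvsP u)) vsvalK.
apply/subvP=> f /cocP[f' f'A fE].
have [|||g gA gE] := ext (free_on M) (free_cover M) (syzygy_sub M) f' _ _ _ f'A.
- exact: free_cover_homA.
- exact: free_cover_onto.
- by [].
apply/memv_imgP; exists g => //; apply/lfunP=> y.
by rewrite precomposeE fE !comp_lfunE inclE gE.
Qed.

(* The image of t is the trace in M of the projective f A. *)
Lemma trace_map M X f J (r : 'Hom(regular A, X)) : f * f = f -> two_sided J ->
  cyclic_pres f J r -> (forall x a, act M f x = x -> a \in J -> act M a x = 0) ->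
  exists2 t, t \in homA (direct_power X (edim M f)) M &
  forall U : submodule M, (limg t <= U)%VS <-> forall x, act M f x \in (U : {vspace M}).
Proof.
move=> ff tJ rP MJ; pose b := vbasis (limg (act M f)).
have bf k : act M f b`_k = b`_k.
  have [lt|ge] := ltnP k (edim M f); last by rewrite nth_default ?linear0 ?size_tuple.
  have /memv_imgP[x _ ->] : b`_k \in limg (act M f).
    by apply: vbasis_mem; rewrite mem_nth ?size_tuple.
  by rewrite -actMx ff.
pose h k := s2val (cid2 (cyc_hom rP (bf k) (fun a => MJ _ a (bf k)))).
have hA k : h k \in homA X M by rewrite /h; case: cid2.
have hE k a : h k (r a) = act M a b`_k by rewrite /h; case: cid2.
have [|t tA tE] := @homA_sum X M (edim M f) (fun k => h k); first by move=> k; apply: hA.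
exists t => // U; split=> [/subvP tU x|Uf].
  have : act M f x \in limg (act M f) by rewrite memv_img ?memvf.
  move/coord_vbasis => ->; apply: memv_suml => k _; apply: memvZ; apply: tU.
  apply/memv_imgP; exists [ffun l => if l == k then r 1 else 0]; first exact: memvf.
  rewrite tE (bigD1 k) //= ffunE eqxx hE act1x big1 ?addr0 // => l lk.
  by rewrite ffunE (negbTE lk) linear0.
apply/subvP=> _ /memv_imgP[y _ ->]; rewrite tE; apply: memv_suml => k _.
have [_ /limg_fullP/(_ ((y : {ffun _ -> _}) k))[a ->] _] := rP.
by rewrite hE sm_stable // -bf.
Qed.

End Powers.

(** * Maps into powers of a submodule of I(j) *)

Section Cotrace.
Variables (K : fieldType) (A : falgType K) (n : nat) (e : 'I_n -> A).
Hypothesis closedK : alg_closed K.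
Hypothesis he : indexed_primitive_idempotents e.
Implicit Types M N X Y Q : rmod A.

(* The kernel of t is the largest submodule of M without composition factor S(j). *)
Lemma cotrace_map j Q (V : submodule Q) M : injective_envelope (Smod e j) Q ->
  (forall f x, f \in homA M Q -> f x \in (V : {vspace Q})) ->
  exists2 t, t \in homA M (direct_power (submod V) (edim M (e j))) &
  forall W : submodule M, (W <= lker t)%VS <->
    forall x, x \in (W : {vspace M}) -> act M (e j) x = 0.
Proof.
move=> QP MV; rewrite -(hom_dim_env closedK he QP).
pose b := vbasis (homA M Q).
have bA k : b`_k \in homA M Q.
  have [lt|ge] := ltnP k (hom_dim M Q); last by rewrite nth_default ?mem0v ?size_tuple.
  by apply: vbasis_mem; rewrite mem_nth ?size_tuple.
pose h k := s2val (cid2 (hom_corestrict (bA k) (fun x => MV _ x (bA k)))).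
have hA k : h k \in homA M (submod V) by rewrite /h; case: cid2.
have hE k x : vsval (h k x) = b`_k x by rewrite /h; case: cid2.
have [|t tA tE] := @homA_tuple _ _ M (submod V) (hom_dim M Q) (fun k => h k).
  by move=> k; apply: hA.
have tk x : x \in lker t <-> forall k : 'I_(hom_dim M Q), b`_k x = 0.
  rewrite memv_ker; split=> [/eqP tx k|b0].
    by rewrite -hE -tE tx ffunE.
  apply/eqP/ffunP=> k; apply: subvs_inj; rewrite tE hE b0.
  by rewrite ffunE.
exists t => // W; split=> [/subvP Wt|We]; last first.
  apply/subvP=> x xW; apply/tk=> k.
  have := @hom_env0 _ _ _ _ he _ _ QP (submod W) (b`_k \o incl W)%VF.
  move/(_ (comp_homA (bA k) (incl_homA W))) => E.
  have {}E : (b`_k \o incl W)%VF = 0.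
    by apply: E => y; apply: subvs_inj; rewrite act_submodE We ?subvsP.
  by have /lfunP/(_ (vsproj W x)) := E; rewrite comp_lfunE inclE vsprojK // zero_lfunE.
suff /edim0P We : edim (submod W) (e j) = 0%N.
  move=> x xW; have := congr1 vsval (We (vsproj W x)).
  by rewrite act_submodE vsprojK // linear0.
rewrite -(hom_dim_env closedK he QP); apply/hom_dim0P=> g gA.
have [injQ _] := QP.
have [k kA kE] := injQ _ _ (incl W) g (incl_homA W) (incl_ker W) gA.
apply/lfunP=> w; rewrite -kE comp_lfunE inclE (coord_vbasis kA) sum_lfunE.
rewrite zero_lfunE big1 // => l _; rewrite scale_lfunE.
have /tk -> : vsval w \in lker t by apply: Wt; apply: subvsP.
exact: scaler0.
Qed.

End Cotrace.

(** * Enlarging the set of excluded composition factors by one *)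

Section Compare.
Variables (K : fieldType) (A : falgType K) (n : nat) (e : 'I_n -> A).
Variable (I : 'I_n -> rmod A).
Hypothesis closedK : alg_closed K.
Hypothesis he : indexed_primitive_idempotents e.
Hypothesis hI : forall j, injective_envelope (Smod e j) (I j).
Implicit Types (M N X Y : rmod A) (C : pred 'I_n).

Local Notation L j := (fullv * <[e j]>)%VS.
Local Notation R j := (<[e j]> * fullv)%VS.

Lemma trace_ideal_ext C C' : C =1 C' -> trace_ideal e C = trace_ideal e C'.
Proof. exact: eq_bigl. Qed.

Lemma trace_idealU1 C C' k : (forall l, C' l = C l || (l == k)) ->
  trace_ideal e C' = (trace_ideal e C + L k * R k)%VS.
Proof.
move=> CE; apply/eqP; rewrite eqEsubv subv_add; apply/andP; split.
  apply: trace_ideal_sub => // l a b; rewrite CE => /orP[Cl|/eqP->].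
    by apply: (subvP (addvSl _ _)); apply: trace_ideal_mem.
  apply: (subvP (addvSr _ _)).
  have -> : a * e k * b = (a * e k) * (e k * b).
    by rewrite mulrA -(mulrA a (e k) (e k)) e_idem.
  by apply: memv_mul; [apply/prod_lineE; exists a | apply/line_prodE; exists b];
    rewrite ?memvf.
apply/andP; split.
  by apply: trace_ideal_sub => // l a b Cl; apply: trace_ideal_mem; rewrite // CE Cl.
apply: (sumv_sup k) => //.
by rewrite CE eqxx orbT.
Qed.

(** Applied with [X] one of $e_j A$, $A e_j$, $e_j A e_j$, with [W] the ideal $A e_k A$ and [Z] the
    corresponding corner of [W]. *)
Lemma dim_mod_add_tower (J X W Z : {vspace A}) : (Z <= X)%VS -> (Z <= J + W)%VS ->
  (X :&: (J + W) <= Z + J)%VS ->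
  dim_mod J X = (dim_mod (J + W) X + dim_mod J Z)%N.
Proof.
move=> ZX ZJ XZ; rewrite (@dim_mod_tower _ _ J (J + W)) ?addvSl //; congr addn.
apply/eqP; rewrite eqn_leq !dim_mod_sub //.
by rewrite (subv_trans _ (addvSl _ _)) // subv_cap ZX ZJ.
Qed.

Section OneStep.
Variables (s0 s2 : 'S_n) (j k : 'I_n).
Hypothesis Cjk : forall l, above s2 j l = above s0 j l || (l == k).
Local Notation J0 := (trace_ideal e (above s0 j)).
Local Notation J2 := (trace_ideal e (above s2 j)).

Let J2E : J2 = (J0 + L k * R k)%VS := trace_idealU1 Cjk.
Let tJ0 : two_sided J0. Proof. exact: trace_ideal_two_sided. Qed.
Let ej := e_idem he j.

Lemma corner_left_sub : (<[e j]> * L k <= L k)%VS.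
Proof.
apply/subvP=> _ /line_prodE[_ /prod_lineE[a _ ->] ->]; apply/prod_lineE.
by exists (e j * a); rewrite ?memvf ?mulrA.
Qed.

Lemma corner_right_sub l : (R k * <[e l]> <= R k)%VS.
Proof.
apply/subvP=> _ /prod_lineE[_ /line_prodE[a _ ->] ->]; apply/line_prodE.
by exists (a * e l); rewrite ?memvf ?mulrA.
Qed.

Lemma dim_Delta_step : \dim {:Delta e s0 j} =
  (\dim {:Delta e s2 j} + dim_mod J0 (<[e j]> * L k * R k))%N.
Proof.
rewrite !(dim_Delta closedK he) J2E; apply: dim_mod_add_tower.
- by rewrite -prodvA prodvSr ?subvf.
- by rewrite (subv_trans _ (addvSr _ _)) // prodvSl ?corner_left_sub.
apply/subvP=> x; rewrite memv_cap => /andP[/line_prodE[y _ ->]].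
move=> /memv_addP[q qJ [w wLR yE]].
(* Doubling [e j] lets it be multiplied into the decomposition of [e j * y], which moves the second
   summand into the corner. *)
have -> : e j * y = e j * (e j * y) by rewrite mulrA ej.
rewrite yE mulrDr addrC memv_add //; last exact: two_sidedl.
by rewrite -prodvA; apply/line_prodE; exists w.
Qed.

Lemma dim_nabla_step : \dim {:nabla e I s0 j} =
  (\dim {:nabla e I s2 j} + dim_mod J0 (L k * (R k * <[e j]>)))%N.
Proof.
rewrite !(dim_nabla closedK he hI) J2E; apply: dim_mod_add_tower.
- by rewrite prodvA prodvSl ?subvf.
- by rewrite (subv_trans _ (addvSr _ _)) // prodvSr ?corner_right_sub.
apply/subvP=> x; rewrite memv_cap => /andP[/prod_lineE[y _ ->]].
move=> /memv_addP[q qJ [w wLR yE]].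
have -> : y * e j = y * e j * e j by rewrite -mulrA ej.
rewrite yE mulrDl addrC memv_add //; last exact: two_sidedr.
by rewrite prodvA; apply/prod_lineE; exists w.
Qed.

Lemma edim_Delta_step : edim (Delta e s0 j) (e j) =
  (edim (Delta e s2 j) (e j) + dim_mod J0 (<[e j]> * L k * (R k * <[e j]>)))%N.
Proof.
rewrite !(edim_Delta closedK he) J2E; apply: dim_mod_add_tower.
- rewrite -prodvA prodvSr // prodvA prodvSl ?subvf //.
- rewrite (subv_trans _ (addvSr _ _)) // (subv_trans (prodvSl _ corner_left_sub)) //.
  by rewrite prodvSr ?corner_right_sub.
apply/subvP=> x; rewrite memv_cap => /andP[/line_prodE[_ /prod_lineE[y _ ->] ->]].
move=> /memv_addP[q qJ [w wLR yE]].
have -> : e j * (y * e j) = e j * (e j * (y * e j)) * e j.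
  by rewrite !mulrA ej -(mulrA _ (e j) (e j)) ej.
rewrite yE mulrDr mulrDl addrC memv_add //; last exact: tJ0.
by rewrite -prodvA prodvA prodvA; apply/prod_lineE; exists (e j * w) => //;
  rewrite -prodvA; apply/line_prodE; exists w.
Qed.

(** The kernel of the projection is $e_j (J_0 + A e_k A) / e_j J_0$, the submodule generated by the
    image of [e k], that is, the trace of $P(k)$. The condition on [t] is the one that [trace_map]
    delivers. *)
Lemma Delta_trace : exists pi : 'Hom(Delta e s0 j, Delta e s2 j),
  [/\ pi \in homA (Delta e s0 j) (Delta e s2 j), limg pi = fullv &
   forall Y (t : 'Hom(Y, Delta e s0 j)), t \in homA Y (Delta e s0 j) ->
     (forall U : submodule (Delta e s0 j), (limg t <= U)%VS <->
        forall x, act (Delta e s0 j) (e k) x \in (U : {vspace Delta e s0 j})) ->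
     limg t = lker pi].
Proof.
have [r0 rP0] := Delta_pres closedK he s0 j.
have [r2 rP2] := Delta_pres closedK he s2 j.
have [r0A r01 r00] := rP0; have [r2A r21 r20] := rP2.
have [|pi piA piE] := homA_factor r0A r2A r01.
  apply/subvP=> a; rewrite !memv_ker => /eqP/r00 aJ; apply/eqP/r20.
  by rewrite J2E; apply: (subvP (addvSl _ _)).
exists pi; split=> //.
  apply/limg_fullP=> y; have /limg_fullP/(_ y)[a ->] := r21.
  by exists (r0 a); rewrite piE.
move=> Y t tA tP; apply/eqP; rewrite eqEsubv; apply/andP; split.
  apply/(tP (ker_sub piA)) => x; have /limg_fullP/(_ x)[a ->] := r01.
  rewrite memv_ker (cyc_act rP0) piE; apply/eqP/r20; rewrite mulrA -[_ * e k]mulr1.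
  by apply: trace_ideal_mem; rewrite // Cjk eqxx orbT.
have /(tP (Submodule (@img_submodule _ _ _ _ t (full_sub Y) tA))) tk := subvv (limg t).
apply/subvP=> x; have /limg_fullP/(_ x)[a ->] := r01.
rewrite memv_ker piE -(cyc_mull ej rP0) => /eqP/r20; move: (e j * a) => {}a.
rewrite J2E => /memv_addP[q qJ [w wLR ->]].
rewrite linearD /=; have -> : r0 q = 0 by apply/r00/two_sidedl.
rewrite add0r.
have stT : act_stable (limg t) := @img_submodule _ _ _ _ t (full_sub Y) tA.
have /subvP : (L k * R k <= r0 @^-1: limg t)%VS.
  apply/prodvP=> _ v /prod_lineE[c _ ->] /line_prodE[d _ ->].
  rewrite -memv_preim mulrA -!(cyc_act rP0); apply: (stT); apply: (stT); apply: tk.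
by move/(_ w wLR); rewrite -memv_preim.
Qed.

(** Dual to [Delta_trace]: an element of $\nabla^{s_0}(j)$ is killed by $A e_k A$ exactly when the
    submodule it generates lacks the factor $S(k)$. *)
Lemma nabla_reject Y (t : 'Hom(nabla e I s0 j, Y)) : t \in homA (nabla e I s0 j) Y ->
  (forall W : submodule (nabla e I s0 j), (W <= lker t)%VS <->
     forall x, x \in (W : {vspace nabla e I s0 j}) -> act (nabla e I s0 j) (e k) x = 0) ->
  (forall x, x \in lker t <-> vsval x \in (nabla_sub e I s2 j : {vspace I j})) /\
  \dim (lker t) = \dim {:nabla e I s2 j}.
Proof.
move=> tA tP.
have tk : forall x, x \in lker t -> act (nabla e I s0 j) (e k) x = 0.
  exact/(tP (ker_sub tA))/subvv.
have key x : x \in lker t <-> vsval x \in (nabla_sub e I s2 j : {vspace I j}).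
  split=> [xt|].
    apply/(nabla_subP closedK he) => a; rewrite J2E => /memv_addP[q qJ [w wLR ->]].
    rewrite actDl; have /(nabla_subP closedK he) -> // := subvsP x; rewrite add0r.
    have /subvP : (L k * R k <= lker (orbit_map (vsval x : I j)))%VS.
      apply/prodvP=> _ v /prod_lineE[c _ ->] /line_prodE[d _ ->].
      rewrite memv_ker orbit_mapE !actMx.
      have := tk _ (@sm_stable _ _ _ (ker_sub tA) c _ xt).
      move/(congr1 vsval); rewrite !act_submodE => ->.
      by rewrite !linear0.
    by move/(_ w wLR); rewrite memv_ker orbit_mapE => /eqP.
  have [||b z zW|W WP] := @pred_submodule _ _ (nabla e I s0 j)
      (fun y => vsval y \in (nabla_sub e I s2 j : {vspace I j})).
  - by rewrite linear0 mem0v.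
  - by move=> c y z yW zW; rewrite linearP memvD ?memvZ.
  - by rewrite act_submodE sm_stable.
  have /subvP Wt : (W <= lker t)%VS.
    apply/tP => y /WP/(nabla_subP closedK he) yJ; apply: subvs_inj.
    rewrite act_submodE linear0 yJ //.
    rewrite -[e k]mulr1 -[e k]mul1r; apply: trace_ideal_mem => //.
    by rewrite Cjk eqxx orbT.
  by move=> xs2; apply: Wt; apply/WP.
split=> //; rewrite sub_dim -(dim_inj_img _ (incl_ker (nabla_sub e I s0 j))).
congr (\dim _); apply/vspaceP=> x; apply/memv_imgP/idP=> [[y /key + ->]|xs2].
  by rewrite inclE.
have x0 : x \in (nabla_sub e I s0 j : {vspace I j}).
  apply/(nabla_subP closedK he) => a aJ; move/(nabla_subP closedK he): xs2; apply.
  by rewrite J2E; apply: (subvP (addvSl _ _)).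
exists (vsproj (nabla_sub e I s0 j) x); last by rewrite inclE vsprojK.
by apply/key; rewrite vsprojK.
Qed.

End OneStep.

Lemma nabla_hom_into s j M f x :
  (forall k y, above s j k -> act M (e k) y = 0) -> f \in homA M (I j) ->
  f x \in (nabla_sub e I s j : {vspace I j}).
Proof.
move=> MC /homAP fA; apply/(nabla_subP closedK he) => a aJ.
by rewrite -fA (trace_ideal_kill he MC aJ) linear0.
Qed.

Lemma nabla_kill s j k x : above s j k -> act (nabla e I s j) (e k) x = 0.
Proof.
move=> jk; apply: subvs_inj; rewrite act_submodE linear0.
have /(nabla_subP closedK he) := subvsP x; apply.
by rewrite -[e k]mulr1 -[e k]mul1r trace_ideal_mem.
Qed.

Lemma Delta_kill s j k x : above s j k -> act (Delta e s j) (e k) x = 0.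
Proof.
move=> jk; have [r rP] := Delta_pres closedK he s j.
have [_ /limg_fullP/(_ x)[a ->] r0] := rP.
rewrite (cyc_act rP); apply/r0; rewrite mulrA -[_ * e k]mulr1.
exact: trace_ideal_mem.
Qed.

(* X is projective over A modulo the trace ideal; a lift y of its generator
   satisfies g (y a) = 0 for all a in the ideal, which makes the obvious extension
   of g well defined. *)
Lemma ext_vanish_cyclic C f X N (r : 'Hom(regular A, X)) : f * f = f ->
  cyclic_pres f (trace_ideal e C) r -> (forall k x, C k -> act N (e k) x = 0) ->
  ext_vanish X N.
Proof.
move=> ff rP NC Y p U g pA p1 UE gA.
have tC : two_sided (trace_ideal e C) := @trace_ideal_two_sided _ _ _ _ he C.
have [rA r1 r0] := rP; have /homAP pA' := pA; have /homAP gA' := gA.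
have [y [py yf]] : exists y, p y = r 1 /\ act Y f y = y.
  have /limg_fullP/(_ (r 1))[y py] := p1; exists (act Y f y).
  by rewrite pA' -py (cyc_gen_f ff rP) -actMx ff.
pose gY := (g \o linfun (vsproj U))%VF.
have gYE u (uU : u \in (U : {vspace Y})) : gY u = g (vsproj U u).
  by rewrite comp_lfunE lfunE.
have gYact u a : u \in (U : {vspace Y}) -> gY (act Y a u) = act N a (gY u).
  move=> uU; rewrite !gYE ?sm_stable // -gA'.
  by congr (g _); apply: subvs_inj; rewrite act_submodE !vsprojK ?sm_stable.
have pyE a : p (act Y a y) = r a by rewrite pA' py (cyc_act rP) mul1r.
have yJ a : a \in trace_ideal e C ->
    act Y a y \in (U : {vspace Y}) /\ gY (act Y a y) = 0.
  move: a; apply: (trace_ideal_ind he) => [|c a b [aU a0] [bU b0]|k a b Ck].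
  - by rewrite act0l; split; [exact: mem0v | exact: linear0].
  - rewrite actDl actZl; split; first by rewrite memvD ?memvZ.
    by rewrite linearP /= a0 b0 scaler0 addr0.
  have akU : act Y (a * e k) y \in (U : {vspace Y}).
    rewrite UE memv_ker pyE; apply/eqP/r0; apply: two_sidedl => //.
    by rewrite -[_ * e k]mulr1 trace_ideal_mem.
  rewrite actMx sm_stable // gYact //; split=> //.
  have -> : act Y (a * e k) y = act Y (e k) (act Y (a * e k) y).
    by rewrite -actMx -mulrA e_idem.
  by rewrite gYact // NC // linear0.
pose sg : 'Hom(X, regular A) := (r^-1)%VF.
have sgK x : r (sg x) = x by rewrite limg_lfunVK // r1 memvf.
pose q : 'Hom(Y, Y) := (\1 - (orbit_map y \o sg \o p))%VF.
have qE x : q x = x - act Y (sg (p x)) y.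
  by rewrite add_lfunE opp_lfunE !comp_lfunE id_lfunE orbit_mapE.
have qU x : q x \in (U : {vspace Y}).
  by rewrite UE memv_ker qE linearB /= pyE sgK subrr.
exists (gY \o q)%VF; last first.
  move=> u; rewrite comp_lfunE qE.
  have -> : p (vsval u) = 0 by apply/eqP; rewrite -memv_ker -UE subvsP.
  have -> : sg 0 = 0 by exact: linear0.
  by rewrite act0l subr0 (gYE _ (subvsP u)) vsvalK.
have cE x : (gY \o q)%VF x = gY (q x) by apply: comp_lfunE.
apply/homAP=> a x; rewrite !cE -(gYact _ a (qU x)).
suff [dU d0] : act Y a (q x) - q (act Y a x) \in (U : {vspace Y}) /\
    gY (act Y a (q x) - q (act Y a x)) = 0.
  by apply/eqP; rewrite eq_sym -subr_eq0 -linearB /= d0.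
set c := sg (p x); set c' := sg (p (act Y a x)).
have -> : act Y a (q x) - q (act Y a x) = act Y (f * (c' - c * a)) y.
  have -> : act Y (f * (c' - c * a)) y = act Y c' y - act Y a (act Y c y).
    rewrite actMx yf -(actMx c a) -!orbit_mapE; exact: linearB.
  rewrite !qE -/c -/c' linearB /= opprB addrC.
  by rewrite addrA subrK.
apply: yJ; apply/r0; rewrite linearB /= sgK pA'.
have -> : r (c * a) = act X a (r c) by rewrite (cyc_act rP).
by rewrite sgK subrr.
Qed.

End Compare.

(** * Obstructions to Ext-vanishing, and powers inside or below standard and costandard modules *)

Section Twist.
Variables (K : fieldType) (A : falgType K) (n : nat) (e : 'I_n -> A).
Variable (I : 'I_n -> rmod A).
Hypothesis closedK : alg_closed K.
Hypothesis he : indexed_primitive_idempotents e.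
Hypothesis hI : forall j, injective_envelope (Smod e j) (I j).
Implicit Types (M N X Y : rmod A) (C : pred 'I_n).

(** Extend first into the injective [I i]. The extension stays in the costandard module: for [k]
    above, [e k] kills the target of [p], so it sends [X] into [U], where the values already lie in
    a module killed by [e k]. *)
Lemma ext_vanish_nabla s s' i j : above s' i =1 above s j ->
  nabla_sub e I s' i = nabla_sub e I s i :> {vspace I i} ->
  ext_vanish (nabla e I s j) (nabla e I s i).
Proof.
move=> Cij Neq X p U f pA p1 UE fA; have [injQ _] := hI i.
pose V := nabla_sub e I s i; have /homAP pA' := pA; have /homAP fA' := fA.
have [g gA gE] := injQ _ _ (incl U) (incl V \o f)%VF (incl_homA U) (incl_ker U)
  (comp_homA (incl_homA V) fA).
have gU u : g (vsval u) = vsval (f u).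
  by have /lfunP/(_ u) := gE; rewrite !comp_lfunE !inclE.
have /homAP gA' := gA.
have Vk k (y : submod V) : above s' i k -> act (submod V) (e k) y = 0.
  move=> ik; apply: subvs_inj; rewrite act_submodE linear0.
  have := subvsP y; move: (vsval y) => z; rewrite -[V : {vspace _}]Neq.
  move=> /(nabla_subP closedK he); apply.
  by rewrite -[e k]mulr1 -[e k]mul1r; apply: trace_ideal_mem.
have [|h hA hE] := hom_corestrict (U := V) gA.
  move=> x; rewrite -[V : {vspace _}]Neq; apply/(nabla_subP closedK he).
  apply: (trace_ideal_ind he) => [|c a b a0 b0|k a b ik].
  - by rewrite act0l.
  - by rewrite actDl actZl a0 b0 scaler0 addr0.
  rewrite !actMx -!gA'; set u := act X (e k) _.
  have uU : u \in (U : {vspace X}).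
    rewrite UE memv_ker pA' (@nabla_kill _ _ _ _ I closedK he) -?Cij ?eqxx //.
  rewrite gA' -[u](vsprojK uU) gU.
  have -> : f (vsproj U u) = act (submod V) (e k) (f (vsproj U u)).
    rewrite -fA'; congr (f _); apply: subvs_inj; rewrite act_submodE !vsprojK //.
    by rewrite /u -(actMx (e k) (e k)) (e_idem he).
  by rewrite Vk // !linear0.
by exists h => // u; apply: subvs_inj; rewrite hE gU.
Qed.

Section OneStep.
Variables (s0 s2 : 'S_n) (j k : 'I_n).
Hypothesis Cjk : forall l, above s2 j l = above s0 j l || (l == k).
Local Notation J0 := (trace_ideal e (above s0 j)).

Section Nonsplit.
Hypothesis Ck : above s2 k =1 above s0 j.

(* A projection Delta(k)^m -> Delta(k) defined on the kernel of
   Delta^s0(j) ->> Delta^s2(j) cannot extend, as Delta^s0(j) has top S(j). *)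
Lemma ext_Delta_nonvanish : k != j ->
  \dim {:Delta e s0 j} = (\dim {:Delta e s2 j} +
    edim (Delta e s0 j) (e k) * \dim {:Delta e s2 k})%N ->
  ext_vanish (Delta e s2 j) (Delta e s2 k) -> edim (Delta e s0 j) (e k) = 0%N.
Proof.
move=> kj dE ext; apply/eqP; rewrite -leqn0 leqNgt; apply/negP=> m0.
have ek := e_idem he k; have ej := e_idem he j.
have [r0 rP0] := Delta_pres closedK he s0 j.
have [rk rPk] := Delta_pres closedK he s2 k.
have tk : two_sided (trace_ideal e (above s2 k)) := @trace_ideal_two_sided _ _ _ _ he _.
have [|t tA tP] := @trace_map _ _ (Delta e s0 j) _ _ _ _ ek tk rPk.
  move=> x a _; rewrite (trace_ideal_ext _ Ck) => aJ.
  by apply: (trace_ideal_kill he _ aJ) => l y lC; apply: Delta_kill.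
have [pi [piA pi1 piP]] := Delta_trace closedK he Cjk.
have tpi := piP _ t tA tP.
have t0 : lker t = 0%VS.
  apply/eqP; rewrite -dimv_eq0.
  have := limg_ker_dim t fullv; rewrite capfv dim_power tpi.
  have := dim_ker_onto pi1; rewrite dE; dlia.
pose U := ker_sub piA.
have [|g gA gE] := hom_corestrict (U := U) tA.
  by move=> y; rewrite /= -tpi memv_img ?memvf.
have g1 : limg g = fullv.
  apply/limg_fullP=> u.
  have /memv_imgP[y _ uE] : vsval u \in limg t by rewrite tpi; exact: (subvsP u).
  by exists y; apply: subvs_inj; rewrite gE.
have [q qA qE] := power_proj_homA (Delta e s2 k) (Ordinal m0).
have [|f fA fE] := homA_factor gA qA g1.
  apply/subvP=> y; rewrite memv_ker => /eqP gy.
  have -> : y = 0 by move/lker0_inj: t0; apply; rewrite -gE gy linear0.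
  exact: mem0v.
have [phi phiA phiE] := ext _ pi U f piA pi1 erefl fA.
(* The map [psi] goes onto the top $S(k)$ of $\Delta(k)$. After [phi] it kills the generator of
   $\Delta^{s_0}(j)$, which [e j] fixes, since $S(k) e_j = 0$; but it also has to reach the
   generator of $S(k)$. *)
have [||psi psiA psiE] := @cyc_hom _ _ _ _ _ _ rPk (Smod e k) (Sgen e k).
- exact: Sgen_e.
- move=> a aJ; apply: (trace_ideal_kill he _ aJ) => l y lC.
  by apply: Smod_e0 => //; apply: contraTneq lC => <-; rewrite /above ltnn.
have w0 : psi (phi (r0 1)) = 0.
  rewrite -(cyc_gen_f ej rP0).
  by move/homAP: phiA => ->; move/homAP: psiA => ->; apply: Smod_e0.
have z0 x : psi (phi x) = 0.
  have [_ /limg_fullP/(_ x)[a ->] _] := rP0.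
  rewrite -[a]mul1r -(cyc_act rP0).
  by move/homAP: phiA => ->; move/homAP: psiA => ->; rewrite w0 linear0.
have /negP := Sgen_neq0 he k; apply.
rewrite -[Sgen e k]act1x -psiE.
pose y : direct_power (Delta e s2 k) (edim (Delta e s0 j) (e k)) := [ffun=> rk 1].
have <- : phi (vsval (g y)) = rk 1 by rewrite phiE fE qE ffunE.
by rewrite z0.
Qed.

(* Otherwise a preimage X in nabla^s0(j) of one summand of
   nabla^s0(j) / nabla^s2(j) = nabla(k)^m would retract onto nabla^s2(j), against
   the simplicity of the socle of I(j). *)
Lemma ext_nabla_nonvanish :
  \dim {:nabla e I s0 j} = (\dim {:nabla e I s2 j} +
    edim (nabla e I s0 j) (e k) * \dim {:nabla e I s2 k})%N ->
  (0 < \dim {:nabla e I s2 j})%N -> (0 < \dim {:nabla e I s2 k})%N ->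
  ext_vanish (nabla e I s2 k) (nabla e I s2 j) -> edim (nabla e I s0 j) (e k) = 0%N.
Proof.
move=> dE dj dk ext; apply/eqP; rewrite -leqn0 leqNgt; apply/negP=> m0.
pose M := nabla e I s0 j; pose V := nabla_sub e I s2 k.
have [|t tA tP] := @cotrace_map _ _ _ _ closedK he k (I k) V M (hI k).
  move=> f x fA; apply: (nabla_hom_into closedK he) => // l y lC.
  by apply: (nabla_kill closedK he); rewrite -Ck.
have [tk dt] := nabla_reject closedK he Cjk tA tP.
have t1 : limg t = fullv.
  apply/eqP; rewrite eqEdim subvf andTb dim_power.
  have dE' : \dim {:M} =
    (\dim {:nabla e I s2 j} + edim M (e k) * \dim {:submod V})%N := dE.
  have := limg_ker_dim t fullv; rewrite capfv dt dE'; dlia.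
pose k0 := Ordinal m0.
have [||a x xP l lk|X XP] := @pred_submodule _ _ M
  (fun x => forall l, l != k0 -> (t x : {ffun _ -> _}) l = 0).
- by move=> l _; rewrite linear0 ffunE.
- by move=> c x y x0 y0 l lk; rewrite linearP !ffunE x0 // y0 // scaler0 addr0.
- by move/homAP: (tA) => ->; rewrite act_powerE xP // linear0.
have [q qA qE] := power_proj_homA (submod V) k0.
pose p := (q \o (t \o incl X))%VF.
have pA : p \in homA (submod X) (submod V).
  exact: comp_homA qA (comp_homA tA (incl_homA X)).
have pE x : p x = (t (vsval x) : {ffun _ -> _}) k0 by rewrite !comp_lfunE inclE qE.
have p1 : limg p = fullv.
  apply/limg_fullP=> z.
  pose y : direct_power (submod V) (edim M (e k)) := [ffun l => if l == k0 then z else 0].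
  have /limg_fullP/(_ y)[x yE] := t1.
  have xX : x \in (X : {vspace M}).
    by apply/XP => l lk; rewrite -yE ffunE (negbTE lk).
  by exists (vsproj X x); rewrite pE vsprojK // -yE ffunE eqxx.
pose U := ker_sub pA.
have Ut (u : submod X) : p u = 0 -> vsval u \in lker t.
  rewrite pE => pu; rewrite memv_ker; apply/eqP/ffunP=> l; rewrite [RHS]ffunE.
  have [->//|lk] := eqVneq l k0.
  by have /XP := subvsP u; apply.
pose i0 := (incl (nabla_sub e I s0 j) \o incl X)%VF.
have i0A : i0 \in homA (submod X) (I j) := comp_homA (incl_homA _) (incl_homA X).
have i0E x : i0 x = vsval (vsval x) by rewrite comp_lfunE !inclE.
have i00 x : i0 x = 0 -> x = 0.
  by rewrite i0E => x0; apply: subvs_inj; apply: subvs_inj; rewrite x0 !linear0.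
have [|f fA fE] := @hom_corestrict _ _ (submod U) (I j) (nabla_sub e I s2 j)
    (i0 \o incl U)%VF (comp_homA i0A (incl_homA U)).
  move=> u; rewrite comp_lfunE inclE i0E; apply/tk/Ut.
  by apply/eqP; rewrite -memv_ker; apply: subvsP.
have [phi phiA phiE] := ext _ p U f pA p1 erefl fA.
pose N2 := nabla_sub e I s2 j.
(* The kernel of [phi], seen in [I j], avoids [N2], on which [phi] is the identity, so one of the
   two is zero. If the kernel is, then [phi] is injective and already onto on [U], hence [U] is
   everything and [p] vanishes. *)
pose W := Submodule (@img_submodule _ _ _ _ i0 (ker_sub phiA) i0A).
have [|W0|N0] := env_cap he (hI j) (U := W) (V := N2).
- apply/eqP; rewrite -subv0; apply/subvP=> v; rewrite memv_cap.
  move=> /andP[/memv_imgP[w wphi ->]]; rewrite i0E => /tk wt.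
  have wU : w \in (U : {vspace submod X}).
    rewrite memv_ker pE; move: wt; rewrite memv_ker => /eqP->.
    by rewrite ffunE.
  have := fE (vsproj U w); rewrite comp_lfunE inclE vsprojK // i0E => <-.
  rewrite -phiE vsprojK //; move: wphi; rewrite memv_ker => /eqP->.
  by rewrite linear0 mem0v.
- have phi0 x : phi x = 0 -> x = 0.
    move=> phx; apply: i00; apply/eqP; rewrite -memv0 -W0 /=.
    by rewrite memv_img // memv_ker phx.
  have f1 z : exists u, z = f u.
    have zN : vsval z \in (N2 : {vspace I j}) := subvsP z.
    have zN0 : vsval z \in (nabla_sub e I s0 j : {vspace I j}).
      apply/(nabla_subP closedK he) => a aJ; move/(nabla_subP closedK he): zN; apply.
      move: aJ; apply: subvP; apply: trace_ideal_sub => // l b c lC.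
      by apply: trace_ideal_mem; rewrite // Cjk lC.
    pose x : M := vsproj (nabla_sub e I s0 j) (vsval z).
    have xt : t x = 0.
      by apply/eqP; rewrite -memv_ker; apply/tk; rewrite vsprojK.
    have xX : x \in (X : {vspace M}) by apply/XP => l _; rewrite xt ffunE.
    have xU : vsproj X x \in (U : {vspace submod X}).
      by rewrite memv_ker pE vsprojK // xt ffunE.
    exists (vsproj U (vsproj X x)); apply: subvs_inj; rewrite fE comp_lfunE inclE.
    by rewrite vsprojK // i0E !vsprojK.
  suff V0 : forall z : submod V, z = 0.
    by move: dk; rewrite lt0n dimv_eq0 => /negP; apply; apply/eqP/fullv0P.
  move=> z; have /limg_fullP/(_ z)[x ->] := p1.
  have [u uE] := f1 (phi x).
  have -> : x = vsval u.
    apply/eqP; rewrite -subr_eq0; apply/eqP/phi0.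
    by rewrite linearB /= phiE -uE subrr.
  by apply/eqP; rewrite -memv_ker; apply: subvsP.
- by move: dj; rewrite sub_dim [nabla_sub e I s2 j : {vspace _}]N0 dimv0.
Qed.

End Nonsplit.

(** The kernel of the projection between the two standard modules is the image of the trace map from
    the power of [X], so equality of dimensions means that this map is injective. An arbitrary copy
    of the power also lies in the trace and forces the equality. *)
Lemma Delta_embed X (r : 'Hom(regular A, X)) : cyclic_pres (e k) J0 r ->
  [/\ hom_dim X (Delta e s0 j) = edim (Delta e s0 j) (e k),
      (\dim {:Delta e s0 j} <= \dim {:Delta e s2 j} +
         edim (Delta e s0 j) (e k) * \dim {:X})%N &
      \dim {:Delta e s0 j} = (\dim {:Delta e s2 j} +
         edim (Delta e s0 j) (e k) * \dim {:X})%N <->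
      exists U : submodule (Delta e s0 j),
        isomorphic (submod U) (direct_power X (edim (Delta e s0 j) (e k)))].
Proof.
move=> rP; have ek := e_idem he k; set D0 := Delta e s0 j.
have tJ : two_sided J0 := @trace_ideal_two_sided _ _ _ _ he _.
have DJ (x : D0) a : a \in J0 -> act D0 a x = 0.
  by move=> aJ; apply: (trace_ideal_kill he _ aJ) => l y lC; apply: Delta_kill.
have [|t tA tP] := @trace_map _ _ D0 _ _ _ _ ek tJ rP; first by move=> x a _; apply: DJ.
have [pi [piA pi1 piP]] := Delta_trace closedK he Cjk.
have tpi := piP _ t tA tP.
have dpi := dim_ker_onto pi1; rewrite -/D0 -tpi in dpi.
have dt := limg_ker_dim t fullv; rewrite capfv dim_power in dt.
split.
- rewrite /edim; apply: (hom_dim_cyc ek tJ rP) => x; split=> [/memv_imgP[y _ ->]|[xk _]].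
    by split=> [|a aJ]; [rewrite -actMx ek | apply: DJ].
  by apply/memv_imgP; exists x; rewrite ?memvf.
- by move: dpi dt; dlia.
split=> [dE|[U /iso_sym[f [fA f0 f1]]]].
  pose T := Submodule (@img_submodule _ _ _ _ t (full_sub _) tA); exists T.
  apply: iso_sym; apply: (iso_submod_img tA) => //.
  apply/eqP; rewrite -dimv_eq0; move: dpi dt dE; dlia.
pose psi := (incl U \o f)%VF.
have psiA : psi \in homA _ D0 := comp_homA (incl_homA U) fA.
have psi0 : lker psi = 0%VS.
  apply/lker0_inj=> y; rewrite comp_lfunE => /= fy; move/lker0_inj: f0; apply.
  by apply: (@incl_inj _ _ _ U); rewrite fy linear0.
(* The power of [X] is generated by elements fixed by [e k], so each of its images lies in the
   trace. *)
suff /dimvS : (limg psi <= limg t)%VS.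
  by rewrite dim_inj_img // dim_power; move: dpi dt; dlia.
pose T := Submodule (@img_submodule _ _ _ _ t (full_sub _) tA).
have Tk : forall x, act D0 (e k) x \in (T : {vspace D0}) by apply/(tP T)/subvv.
apply/subvP=> _ /memv_imgP[y _ ->]; have [_ r1 _] := rP.
have [a aE] : exists a : 'I_(edim D0 (e k)) -> A, forall l, (y : {ffun _ -> _}) l = r (a l).
  apply: (@fin_all_exists _ (fun _ => A) (fun l a => (y : {ffun _ -> _}) l = r a)) => l.
  by move/limg_fullP: r1; apply.
pose d (l : 'I_(edim D0 (e k))) : direct_power X (edim D0 (e k)) :=
  [ffun i => if i == l then r 1 else 0].
have -> : y = \sum_l act (direct_power X _) (a l) (act (direct_power X _) (e k) (d l)).
  apply/ffunP=> i; rewrite sum_ffunE (bigD1 i) //= !act_powerE ffunE eqxx.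
  rewrite (cyc_gen_f ek rP) -(cyc_rE rP) aE big1 ?addr0 // => l li.
  by rewrite !act_powerE ffunE eq_sym (negbTE li) !linear0.
rewrite linear_sum; apply: memv_suml => l _ /=.
move/homAP: (psiA) => psiA'; rewrite !psiA'.
exact: (@sm_stable _ _ _ T).
Qed.

(** Dual to [Delta_embed], with surjectivity of the cotrace map in place of injectivity. Two orders
    occur because the target is costandard for [s], while its relation to the ideal at [j] is known
    for [s']. *)
Lemma nabla_quot s s' : above s' k =1 above s0 j ->
  nabla_sub e I s' k = nabla_sub e I s k :> {vspace I k} ->
  [/\ hom_dim (nabla e I s0 j) (nabla e I s k) = edim (nabla e I s0 j) (e k),
      (\dim {:nabla e I s0 j} <= \dim {:nabla e I s2 j} +
         edim (nabla e I s0 j) (e k) * \dim {:nabla e I s k})%N &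
      \dim {:nabla e I s0 j} = (\dim {:nabla e I s2 j} +
         edim (nabla e I s0 j) (e k) * \dim {:nabla e I s k})%N <->
      exists V : submodule (nabla e I s0 j),
        isomorphic (quomod V)
          (direct_power (nabla e I s k) (edim (nabla e I s0 j) (e k)))].
Proof.
move=> Ck Neq; set M := nabla e I s0 j; pose V := nabla_sub e I s k.
have MV f x : f \in homA M (I k) -> f x \in (V : {vspace I k}).
  move=> fA; rewrite -[V : {vspace _}]Neq; apply: (nabla_hom_into closedK he) => // l y lC.
  by apply: (nabla_kill closedK he); rewrite -Ck.
have [t tA tP] := @cotrace_map _ _ _ _ closedK he k (I k) V M (hI k) MV.
have [tk dt] := nabla_reject closedK he Cjk tA tP.
have dM := limg_ker_dim t fullv; rewrite capfv dt in dM.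
have dI : (\dim (limg t) <= edim M (e k) * \dim {:submod V})%N.
  by rewrite -dim_power dimvS ?subvf.
split.
- by rewrite (hom_dim_corestrict MV) (hom_dim_env closedK he (hI k)).
- by move: dM dI; dlia.
split=> [dE|[W [f [fA f0 f1]]]].
  pose W := ker_sub tA; exists W; apply: (iso_quomod_ker tA) => //.
  apply/eqP; rewrite eqEdim subvf andTb dim_power; move: dM dI dE; dlia.
pose psi := (f \o quo_proj W)%VF.
have psiA : psi \in homA M _ := comp_homA fA (quo_homA W).
have psi1 : limg psi = fullv by rewrite limg_comp quo_onto f1.
have dpsi := dim_ker_onto psi1; rewrite dim_power in dpsi.
(* On the kernel of [t] the idempotent [e k] acts as zero, so no nonzero map leads from it to
   [I k]. *)
suff /dimvS : (lker t <= lker psi)%VS.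
  by rewrite dt; move: dM dI dpsi; dlia.
have tke : forall x, x \in lker t -> act M (e k) x = 0.
  exact/(tP (ker_sub tA))/subvv.
apply/subvP=> x xt; rewrite memv_ker; apply/eqP/ffunP=> l; rewrite [RHS]ffunE.
have [q qA qE] := power_proj_homA (submod V) l.
pose T := ker_sub tA.
have := @hom_env0 _ _ _ _ he _ _ (hI k) (submod T) (incl V \o (q \o (psi \o incl T)))%VF.
move/(_ (comp_homA (incl_homA V) (comp_homA qA (comp_homA psiA (incl_homA T))))) => E.
have {}E : (incl V \o (q \o (psi \o incl T)))%VF = 0.
  apply: E => y; apply: subvs_inj; rewrite act_submodE linear0 tke //.
  exact: subvsP.
have /lfunP/(_ (vsproj T x)) := E; rewrite !comp_lfunE zero_lfunE.
rewrite [incl T _]inclE vsprojK // inclE qE => v0; apply: subvs_inj.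
by rewrite linear0 -v0 ?comp_lfunE.
Qed.

End OneStep.
End Twist.

Section Monotone.
Variables (K : fieldType) (A : falgType K) (n : nat) (e : 'I_n -> A).
Variable (I : 'I_n -> rmod A).
Hypothesis closedK : alg_closed K.
Hypothesis he : indexed_primitive_idempotents e.
Hypothesis hI : forall j, injective_envelope (Smod e j) (I j).
Variables (s0 s2 : 'S_n) (j : 'I_n).
Hypothesis C02 : forall l, above s0 j l -> above s2 j l.

Lemma trace_ideal_above_sub :
  (trace_ideal e (above s0 j) <= trace_ideal e (above s2 j))%VS.
Proof.
by apply: trace_ideal_sub => // k a b /C02 kC; apply: trace_ideal_mem.
Qed.

Lemma Delta_iso_of_dim : \dim {:Delta e s0 j} = \dim {:Delta e s2 j} ->
  isomorphic (Delta e s0 j) (Delta e s2 j).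
Proof.
move=> dE; apply: quomod_sub_ext; apply/eqP; rewrite eqEdim; apply/andP; split.
  apply/subvP=> y /(Delta_kerP closedK he) yJ; apply/(Delta_kerP closedK he).
  exact: (subvP trace_ideal_above_sub).
have := quo_dim (Delta_ker e s0 j); have := quo_dim (Delta_ker e s2 j).
by rewrite -/(Delta e s0 j) -/(Delta e s2 j) dE; dlia.
Qed.

Lemma nabla_sub_of_dim : \dim {:nabla e I s0 j} = \dim {:nabla e I s2 j} ->
  nabla_sub e I s0 j = nabla_sub e I s2 j :> {vspace I j}.
Proof.
move=> dE; apply/esym/eqP; rewrite eqEdim; apply/andP; split.
  apply/subvP=> y /(nabla_subP closedK he) yJ; apply/(nabla_subP closedK he) => a aJ.
  by apply: yJ; apply: (subvP trace_ideal_above_sub).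
by rewrite -!sub_dim -/(nabla e I s0 j) dE.
Qed.

End Monotone.

(** * Twisting by an adjacent transposition *)

Section Main.
Variables (K : fieldType) (A : falgType K) (n : nat) (e : 'I_n -> A).
Variable (I : 'I_n -> rmod A).
Hypothesis closedK : alg_closed K.
Hypothesis he : indexed_primitive_idempotents e.
Hypothesis hI : forall j, injective_envelope (Smod e j) (I j).
Hypothesis hqh : quasi_hereditary e 1%g.
Variables (i i' : 'I_n).
Hypothesis hi' : i' = i.+1 :> nat.

Local Notation s := (tperm i i').
Local Notation D := (Delta e 1%g).
Local Notation N := (nabla e I 1%g).
Local Notation Ds := (Delta e s).
Local Notation Ns := (nabla e I s).
Local Notation L j := (fullv * <[e j]>)%VS.
Local Notation R j := (<[e j]> * fullv)%VS.
Local Notation J := (trace_ideal e (above 1%g i')).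
Local Notation m := (edim (Ds i) (e i')).
Local Notation h := (edim (D i') (e i)).

Let ii' : i != i'. Proof. by rewrite -(inj_eq (@ord_inj n)) hi' neq_ltn ltnSn. Qed.

(** The twist moves [i] to the place of [i'] and permutes nothing beyond it; hence the single ideal
    [J]. *)
Lemma above_twist_i : above s i =1 above 1%g i'.
Proof.
move=> l; rewrite /above tpermL perm1.
case: tpermP => [->|->|/eqP li /eqP li']; rewrite ?perm1 //.
- by rewrite hi' ltnn; apply/esym/negbTE; rewrite -leqNgt leqW.
- by rewrite ltnn hi' ltnNge leqnSn.
Qed.

Lemma above_1_i l : above 1%g i l = above 1%g i' l || (l == i').
Proof.
rewrite /above !perm1 hi' leq_eqVlt orbC; congr orb.
by rewrite -hi' eq_sym (inj_eq (@ord_inj n)).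
Qed.

(** At [i] the twisted order excludes fewer factors than the identity, at [i'] it excludes more. So
    [D i] is a quotient of [Ds i], whereas [Ds i'] is a quotient of [D i']. *)
Lemma above_step_i l : above 1%g i l = above s i l || (l == i').
Proof. by rewrite above_1_i above_twist_i. Qed.

Lemma above_step_i' l : above s i' l = above 1%g i' l || (l == i).
Proof.
rewrite /above tpermR !perm1.
case: tpermP => [->|->|/eqP li /eqP li'].
- by rewrite eqxx orbT hi' ltnSn.
- by rewrite !ltnn eq_sym (negbTE ii').
rewrite (negbTE li) orbF hi' [LHS]leq_eqVlt -hi' -[X in X || _ = _]/(nat_of_ord i' == l).
by rewrite eq_sym (inj_eq (@ord_inj n)) (negbTE li').
Qed.

Lemma above_twist_other j : j != i -> j != i' -> above s j =1 above 1%g j.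
Proof.
move=> ji ji' l; rewrite /above tpermD 1?eq_sym // !perm1.
have jn : (j : nat) != i by rewrite (inj_eq (@ord_inj n)).
have jn' : (j : nat) != i.+1 by rewrite -hi' (inj_eq (@ord_inj n)).
by case: tpermP => [->|->|//]; rewrite hi'; lia.
Qed.

Let tJ : two_sided J. Proof. exact: trace_ideal_two_sided. Qed.
Let JsE : trace_ideal e (above s i) = J. Proof. exact: trace_ideal_ext above_twist_i. Qed.
Let ei := e_idem he i.
Let ei' := e_idem he i'.

Let dimA : \dim {:A} = (\sum_j weight e I 1%g j)%N.
Proof. exact/(qh_count closedK he hI). Qed.

Let mul_eq : dim_mod J (L i' * R i') = (dim_mod J (L i') * dim_mod J (R i'))%N.
Proof. exact: (heredity_mul_equality closedK he hI i' dimA). Qed.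

Let mul_eql : dim_mod J (<[e i]> * L i' * R i') =
  (dim_mod J (<[e i]> * L i') * dim_mod J (R i'))%N.
Proof. by apply: dim_mod_mul_eql => //; apply: corner_left_sub. Qed.

Lemma edim_Ds_corner : m = dim_mod J (<[e i]> * L i').
Proof. by rewrite (edim_Delta closedK he) JsE. Qed.

Lemma edim_D_corner : h = dim_mod J (<[e i']> * L i).
Proof. by rewrite (edim_Delta closedK he). Qed.

(** The corner $e_i A e_{i+1}$ modulo [J] is $\Delta^{\sigma_i}(i) e_{i+1}$ on one side and has the
    dimension of $\nabla(i+1) e_i$ on the other. *)
Lemma edim_nabla_i' : edim (N i') (e i) = m.
Proof. by rewrite (edim_nabla closedK he hI) // edim_Ds_corner. Qed.

Lemma edim_nabla_i : edim (Ns i) (e i') = h.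
Proof. by rewrite (edim_nabla closedK he hI) // edim_D_corner JsE. Qed.

(** The kernel of $\Delta^{\sigma_i}(i) \to \Delta(i)$ is $e_i A e_{i+1} A$ modulo [J], and by
    [mul_eql] its dimension is that of the corner times that of $\Delta(i+1)$. *)
Lemma dim_Ds_i : \dim {:Ds i} = (\dim {:D i} + m * \dim {:D i'})%N.
Proof.
rewrite (dim_Delta_step closedK he above_step_i) JsE mul_eql edim_Ds_corner.
by rewrite -(dim_Delta closedK he).
Qed.

Lemma dim_Ns_i : \dim {:Ns i} = (\dim {:N i} + h * \dim {:N i'})%N.
Proof.
rewrite (dim_nabla_step closedK he hI above_step_i) JsE.
rewrite dim_mod_mul_eqr //; last exact: corner_right_sub.
by rewrite -(dim_nabla closedK he hI) edim_D_corner prodvA mulnC.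
Qed.

Lemma edim_D_diag j : edim (D j) (e j) = 1%N.
Proof. by have [/(_ j)/(multiplicityP closedK he)<-] := hqh. Qed.

Lemma edim_Ds_i : edim (Ds i) (e i) = (1 + m * h)%N.
Proof.
rewrite (edim_Delta_step closedK he above_step_i) JsE edim_D_diag edim_Ds_corner edim_D_corner.
by rewrite dim_mod_mul_eqr //; [rewrite (prodvA <[e i']>%VS) | apply: corner_right_sub].
Qed.

(** Only a bound: for products through [e i] quasi-heredity gives the equality modulo the larger
    ideal $J + A e_{i+1} A$, and here the product is taken modulo [J]. *)
Lemma dim_D_i'_le : (\dim {:D i'} <= \dim {:Ds i'} + h * \dim {:Ds i})%N.
Proof.
rewrite (dim_Delta_step closedK he above_step_i') leq_add2l edim_D_corner.
by rewrite (dim_Delta closedK he s) JsE dim_mod_mul.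
Qed.

Lemma dim_N_i'_le : (\dim {:N i'} <= \dim {:Ns i'} + m * \dim {:Ns i})%N.
Proof.
rewrite (dim_nabla_step closedK he hI above_step_i') leq_add2l edim_Ds_corner mulnC.
by rewrite (dim_nabla closedK he hI s) JsE -(prodvA <[e i]>%VS) dim_mod_mul.
Qed.

Lemma dim_D_i'_ge : (\dim {:Ds i'} <= \dim {:D i'})%N.
Proof. by rewrite (dim_Delta_step closedK he above_step_i') leq_addr. Qed.

Lemma dim_N_i'_ge : (\dim {:Ns i'} <= \dim {:N i'})%N.
Proof. by rewrite (dim_nabla_step closedK he hI above_step_i') leq_addr. Qed.

Lemma dim_D_gt0 j : (0 < \dim {:D j})%N.
Proof. by rewrite (dim_Delta closedK he); have [] := e_mod_gt0 he 1%g j. Qed.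

Lemma dim_N_gt0 j : (0 < \dim {:N j})%N.
Proof. by rewrite (dim_nabla closedK he hI); have [] := e_mod_gt0 he 1%g j. Qed.

Lemma dim_twist_other j : j != i -> j != i' ->
  \dim {:Ds j} = \dim {:D j} /\ \dim {:Ns j} = \dim {:N j}.
Proof.
move=> ji ji'; have E := trace_ideal_ext e (above_twist_other ji ji').
by rewrite !(dim_Delta closedK he) !(dim_nabla closedK he hI) E.
Qed.

Lemma twist_count : quasi_hereditary e s <->
  (\dim {:Ds i} * \dim {:Ns i} + \dim {:Ds i'} * \dim {:Ns i'} =
   \dim {:D i} * \dim {:N i} + \dim {:D i'} * \dim {:N i'})%N.
Proof.
rewrite (qh_count closedK he hI) dimA.
have split2 t : (\sum_j weight e I t j =
    \dim {:Delta e t i} * \dim {:nabla e I t i} +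
    (\dim {:Delta e t i'} * \dim {:nabla e I t i'} +
     \sum_(j | (j != i) && (j != i')) weight e I t j))%N.
  by rewrite (bigD1 i) //= (bigD1 i') //= eq_sym.
rewrite !split2 (eq_bigr (weight e I s)); last first.
  by move=> j /andP[ji ji']; have [dD dN] := dim_twist_other ji ji'; rewrite /weight dD dN.
rewrite !addnA; split=> [/addIn->//|->//].
Qed.

(** Condition (a) at [i] forces [m * h = 0]. If [m = 0], the bound for [N i'] gives [Ns i'] the same
    dimension, and the count in [twist_count] reduces to the other equality after cancelling the
    positive factor [\dim {:N i'}]. The case [h = 0] is symmetric. *)
Lemma twist_dims : quasi_hereditary e s <->
  (m = 0 /\ \dim {:D i'} = \dim {:Ds i'} + h * \dim {:D i})%N \/
  (h = 0 /\ \dim {:N i'} = \dim {:Ns i'} + m * \dim {:N i})%N.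
Proof.
have := dim_D_i'_le; have := dim_N_i'_le; have := dim_D_i'_ge; have := dim_N_i'_ge.
have qh_mh : quasi_hereditary e s -> (m * h = 0)%N.
  move=> [/(_ i)/(multiplicityP closedK he) + _]; rewrite edim_Ds_i; lia.
have := dim_D_gt0 i'; have := dim_N_gt0 i'; move: qh_mh.
rewrite twist_count dim_Ds_i dim_Ns_i.
move: (\dim {:D i}) (\dim {:N i}) (\dim {:D i'}) (\dim {:N i'}) (\dim {:Ds i'})
  (\dim {:Ns i'}) (edim (Ds i) (e i')) (edim (D i') (e i)).
(* Here [u] and [u'] are the dimensions of [Ds i'] and [Ns i'], and [a], [b] are [m], [h]. *)
move=> p p' q q' u u' a b mh q0 q0' le1 le2 le3 le4.
split=> [E|].
  move: (mh E) => /eqP; rewrite muln_eq0 => /orP[/eqP a0|/eqP b0]; [left|right]; subst.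
    have {le1} ? : u' = q' by lia.
    subst; split=> //; have : (q' * q = q' * (u + b * p))%N by nia.
    by move/eqP; rewrite eqn_pmul2l // => /eqP.
  have {le2} ? : u = q by lia.
  subst; split=> //; have : (q * q' = q * (u' + a * p'))%N by nia.
  by move/eqP; rewrite eqn_pmul2l // => /eqP.
case=> -[? E]; subst.
  have -> : u' = q' by lia.
  rewrite mul0n addn0 mulnDr mulnDl; lia.
have -> : u = q by lia.
rewrite mul0n addn0 mulnDr mulnDl; lia.
Qed.

(** If [m = 0] the corner $e_i A e_{i+1}$ lies in [J], so enlarging [J] by $A e_{i+1} A$ does not
    change its part in $e_i A$. Then [D i] is projective over [A / J], where [D i'] lives too. *)
Lemma pres_i : m = 0%N -> exists r : 'Hom(regular A, D i), cyclic_pres (e i) J r.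
Proof.
rewrite edim_Ds_corner => /dim_mod_eq0 aJ; have [r [rA r1 r0]] := Delta_pres closedK he 1%g i.
exists r; split=> // a; rewrite r0 (trace_idealU1 he above_1_i).
split=> [/memv_addP[q qJ [w wLR E]]|aiJ]; last exact: (subvP (addvSl _ _)).
have -> : e i * a = e i * (e i * a) by rewrite mulrA ei.
rewrite E mulrDr; apply: memvD; first exact: two_sidedl.
have /subvP : (<[e i]> * L i' * R i' <= J)%VS.
  by apply/prodvP=> x y /(subvP aJ) xJ _; apply: two_sidedr.
by apply; rewrite -prodvA; apply/line_prodE; exists w.
Qed.

Lemma nabla_sub_i : h = 0%N -> nabla_sub e I s i = nabla_sub e I 1%g i :> {vspace I i}.
Proof.
move=> h0; apply: (nabla_sub_of_dim closedK he).
  by move=> l; rewrite above_step_i => ->.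
by rewrite dim_Ns_i h0 mul0n addn0.
Qed.

Lemma ext_Delta0P : ext1_dim (D i) (D i') = 0%N <-> m = 0%N.
Proof.
rewrite ext1_dim0P; split=> [|m0].
  apply: (ext_Delta_nonvanish closedK he above_step_i).
  - by move=> l; rewrite above_twist_i.
  - by rewrite eq_sym.
  - exact: dim_Ds_i.
have [r rP] := pres_i m0; apply: (ext_vanish_cyclic he ei rP) => k x.
exact: Delta_kill.
Qed.

Lemma ext_nabla0P : ext1_dim (N i') (N i) = 0%N <-> h = 0%N.
Proof.
rewrite ext1_dim0P -edim_nabla_i; split.
  apply: (ext_nabla_nonvanish closedK he hI above_step_i).
  - by move=> l; rewrite above_twist_i.
  - by rewrite edim_nabla_i dim_Ns_i.
  - exact: dim_N_gt0.
  - exact: dim_N_gt0.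
rewrite edim_nabla_i => h0; apply: (ext_vanish_nabla closedK he hI (s' := s)).
  exact: above_twist_i.
exact: nabla_sub_i.
Qed.

Lemma Delta_condition : m = 0%N ->
  (\dim {:D i'} = \dim {:Ds i'} + h * \dim {:D i})%N <->
  exists U : submodule (D i'),
    isomorphic (submod U) (direct_power (D i) (hom_dim (D i) (D i'))).
Proof.
move=> m0; have [r rP] := pres_i m0.
by have [-> _] := Delta_embed closedK he above_step_i' rP.
Qed.

Lemma nabla_condition : h = 0%N ->
  (\dim {:N i'} = \dim {:Ns i'} + m * \dim {:N i})%N <->
  exists V : submodule (N i'),
    isomorphic (quomod V) (direct_power (N i) (hom_dim (N i') (N i))).
Proof.
move=> h0; rewrite -edim_nabla_i'.
have := nabla_quot closedK he hI above_step_i' above_twist_i (nabla_sub_i h0).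
by case=> ->.
Qed.

Lemma twistable_iff : quasi_hereditary e s <->
  (ext1_dim (D i) (D i') = 0%N /\ exists U : submodule (D i'),
     isomorphic (submod U) (direct_power (D i) (hom_dim (D i) (D i')))) \/
  (ext1_dim (N i') (N i) = 0%N /\ exists V : submodule (N i'),
     isomorphic (quomod V) (direct_power (N i) (hom_dim (N i') (N i)))).
Proof.
rewrite twist_dims ext_Delta0P ext_nabla0P; split.
  by case=> -[x0]; [move/(Delta_condition x0) | move/(nabla_condition x0)]; [left|right].
by case=> -[x0]; [move/(Delta_condition x0) | move/(nabla_condition x0)]; [left|right].
Qed.

(** With $m = h = 0$ all bounds collapse and the dimensions agree. The kernels, respectively
    submodules, defining the two families are nested, hence equal. *)
Lemma twist_same : ext1_dim (D i) (D i') = 0%N -> ext1_dim (N i') (N i) = 0%N ->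
  [/\ quasi_hereditary e s, forall j, isomorphic (Ds j) (D j) &
      forall j, isomorphic (Ns j) (N j)].
Proof.
move=> /ext_Delta0P m0 /ext_nabla0P h0.
have dDi : \dim {:Ds i} = \dim {:D i} by rewrite dim_Ds_i m0 addn0.
have dNi : \dim {:Ns i} = \dim {:N i} by rewrite dim_Ns_i h0 addn0.
have dDi' : \dim {:Ds i'} = \dim {:D i'}.
  apply/eqP; rewrite eqn_leq dim_D_i'_ge; have := dim_D_i'_le.
  by rewrite h0 mul0n addn0.
have dNi' : \dim {:Ns i'} = \dim {:N i'}.
  apply/eqP; rewrite eqn_leq dim_N_i'_ge; have := dim_N_i'_le.
  by rewrite m0 mul0n addn0.
have sub_i l : above s i l -> above 1%g i l by rewrite above_step_i => ->.
have sub_i' l : above 1%g i' l -> above s i' l by rewrite above_step_i' => ->.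
split.
- by apply/twist_count; rewrite dDi dNi dDi' dNi'.
- move=> j; have [->|ji] := eqVneq j i; first exact: Delta_iso_of_dim.
  have [->|ji'] := eqVneq j i'; first by apply: iso_sym; apply: Delta_iso_of_dim.
  have [dD _] := dim_twist_other ji ji'; apply: Delta_iso_of_dim => // l.
  by rewrite above_twist_other.
- move=> j; apply: submod_ext; have [->|ji] := eqVneq j i.
    exact: nabla_sub_of_dim.
  have [->|ji'] := eqVneq j i'; first by apply: esym; apply: nabla_sub_of_dim.
  have [_ dN] := dim_twist_other ji ji'; apply: nabla_sub_of_dim => // l.
  by rewrite above_twist_other.
Qed.

End Main.

Local Close Scope ring_scope.

Theorem theorem3p4 (K : closedFieldType) (A : falgType K) (n : nat)
    (e : 'I_n -> A) (I : 'I_n -> rmod A)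
    (he : indexed_primitive_idempotents e)
    (hI : forall j, injective_envelope (Smod e j) (I j))
    (hqh : quasi_hereditary e 1%g)
    (i i' : 'I_n) (hi' : i' = i.+1 :> nat) :
  let D := Delta e 1%g in
  let N := nabla e I 1%g in
  let s := tperm i i' in
  let H := hom_dim (D i) (D i') in
  let E := ext1_dim (D i) (D i') in
  let Hbar := hom_dim (N i') (N i) in
  let Ebar := ext1_dim (N i') (N i) in
  (quasi_hereditary e s <->
     (E = 0 /\ exists U : submodule (D i'), isomorphic (submod U) (direct_power (D i) H)) \/
     (Ebar = 0 /\
        exists V : submodule (N i'), isomorphic (quomod V) (direct_power (N i) Hbar))) /\
  (E = 0 -> Ebar = 0 ->
     [/\ quasi_hereditary e s,
         forall j, isomorphic (Delta e s j) (D j) &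
         forall j, isomorphic (nabla e I s j) (N j)]).
Proof.
have closedK : alg_closed K by move=> p; apply: closed_rootP.
split; first exact: twistable_iff.
exact: twist_same.
Qed.
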